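(* Let $N\ge 2$ and $\Omega=\mathbb{R}\times\omega\subset\mathbb{R}^N$, where $\omega\subset\mathbb{R}^{N-1}$ is a bounded connected open set of class $C^1$, and let $n$ denote the outward unit normal on $\partial\Omega$. Let $p\in C^1(\Omega,\mathbb{R})$ and $v\in C^1(\Omega,\mathbb{R}^N)\cap C(\overline{\Omega},\mathbb{R}^N)$ be a solution of either the steady incompressible Euler equations $$v\cdot\nabla v+\nabla p=0\ \text{in }\Omega,\qquad \mathrm{div}\,v=0\ \text{in }\Omega,\qquad v\cdot n=0\ \text{on }\partial\Omega,$$ or the steady incompressible Navier–Stokes equations $$\mu\Delta v+v\cdot\nabla v+\nabla p=0\ \text{in }\Omega,\qquad \mathrm{div}\,v=0\ \text{in }\Omega,\qquad v\cdot n=0\ \text{on }\partial\Omega,$$ for some $\mu>0$ (the latter understood in the weak sense, $v\in W^{2,q}_{loc}(\Omega,\mathbb{R}^N)$ for all $q\in[1,\infty)$). Assume that $v$ is a potential flow, i.e. there exists $\psi\in C^2(\Omega,\mathbb{R})\cap C^1(\overline{\Omega},\mathbb{R})$ with $v=\nabla\psi$ in $\overline{\Omega}$, and that $v$ is away from stagnation, i.e. $\inf_{\overline{\Omega}}|v|>0$. Then there exists $a\in\mathbb{R}\setminus\{0\}$ such that $v=(a,0,\dots,0)$ in $\overline{\Omega}$, and $p$ is constant in $\overline{\Omega}$.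
   Context: $|\cdot|$ denotes the Euclidean norm on $\mathbb{R}^N$ and $x\cdot y$ the Euclidean inner product. *)

(* Defs.v *)
From HB Require Import structures.
From mathcomp Require Import all_boot all_order all_algebra.
From mathcomp Require Import all_classical all_reals all_analysis.
Set Implicit Arguments. Unset Strict Implicit. Unset Printing Implicit Defensive.
Import Order.TTheory GRing.Theory Num.Theory.
Import numFieldNormedType.Exports.
Local Open Scope classical_set_scope.
Local Open Scope ring_scope.

Section Defs.
Variable R : realType.

Definition dotv {d} (x y : 'rV[R]_d) : R := \sum_(i < d) x 0 i * y 0 i.
Definition enorm {d} (x : 'rV[R]_d) : R := Num.sqrt (dotv x x).

Definition evec {d} (i : 'I_d) : 'rV[R]_d := delta_mx 0 i.
Definition partial {d} (i : 'I_d) (f : 'rV[R]_d -> R) (x : 'rV[R]_d) : R :=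
  derive f x (evec i).
Definition grad {d} (f : 'rV[R]_d -> R) (x : 'rV[R]_d) : 'rV[R]_d :=
  \row_i partial i f x.
Definition laplacian {d} (f : 'rV[R]_d -> R) (x : 'rV[R]_d) : R :=
  \sum_i partial i (partial i f) x.

Definition C1_on {d} (U : set 'rV[R]_d) (f : 'rV[R]_d -> R) : Prop :=
  forall x, U x -> differentiable f x /\
    forall i, partial i f y @[y --> x] --> partial i f x.
Definition C2_on {d} (U : set 'rV[R]_d) (f : 'rV[R]_d -> R) : Prop :=
  C1_on U f /\ forall i, C1_on U (partial i f).

Definition local_defining {d} (U : set 'rV[R]_d) (z : 'rV[R]_d) (r : R)
    (rho : 'rV[R]_d -> R) : Prop :=
  0 < r /\ C1_on (ball z r) rho /\ grad rho z != 0 /\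
  forall y, ball z r y -> (U y <-> rho y < 0).

Definition C1_open {d} (U : set 'rV[R]_d) : Prop :=
  open U /\ forall z, (closure U `\` U) z -> exists r rho, local_defining U z r rho.

Definition outward_normal {d} (U : set 'rV[R]_d) (z nu : 'rV[R]_d) : Prop :=
  exists r rho, local_defining U z r rho /\
    nu = (enorm (grad rho z))^-1 *: grad rho z.

Lemma tail_idx_proof {N} (j : 'I_N.-1) : (j.+1 < N)%N.
Proof. by rewrite -ltn_predRL. Qed.
Definition tail_idx {N} (j : 'I_N.-1) : 'I_N := Ordinal (tail_idx_proof j).
Definition tailv {N} (x : 'rV[R]_N) : 'rV[R]_N.-1 := \row_j x 0 (tail_idx j).
Definition cylinder {N} (om : set 'rV[R]_N.-1) : set 'rV[R]_N :=
  [set x | om (tailv x)].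

Definition convect {N} (v : 'rV[R]_N -> 'rV[R]_N) (x : 'rV[R]_N) : 'rV[R]_N :=
  \row_i \sum_j v x 0 j * partial j (fun y => v y 0 i) x.
Definition divv {N} (v : 'rV[R]_N -> 'rV[R]_N) (x : 'rV[R]_N) : R :=
  \sum_i partial i (fun y => v y 0 i) x.

(* integral over R^n of (continuous, compactly supported) functions,
   computed as an iterated Lebesgue integral over the coordinates *)
Fixpoint iint (n : nat) : ('rV[R]_n -> R) -> R :=
  match n with
  | 0 => fun f => f 0
  | n'.+1 => fun f => Rintegral lebesgue_measure setT
      (fun t : R => iint (fun y : 'rV[R]_n' => f (row_mx (const_mx t : 'rV[R]_1) y)))
  end.

Definition test_fun {N} (U : set 'rV[R]_N) (phi : 'rV[R]_N -> R) : Prop :=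
  C2_on setT phi /\ exists K, compact K /\ K `<=` U /\ forall x, ~ K x -> phi x = 0.

End Defs.

(* Main.v *)
(* Away from stagnation, following the field v = grad psi makes psi increase at a
   definite rate, so every trajectory escapes to one of the two ends of the
   cylinder.  The basins of the two ends are open and disjoint; by connectedness
   psi is bounded above on one half of the cylinder, and likewise -psi.  Both
   bounds cannot hold on the same half, so up to sign psi is bounded below on
   {x_1 > 0} and above on {x_1 < 0}.

   The averages of the harmonic Neumann function psi over slabs grow at most
   linearly, since the flux of v through cross-sections is constant; with the
   one-sided bounds and a local L^1-L^2 estimate, the L^2 norm of psi on unit
   slabs grows at most linearly, hence by Caccioppoli the energy on slabs of
   length n is O(n).  The differences psi(x + r e_1) - psi(x) then have
   L^2 norm squared O(n) on such slabs, so by Caccioppoli their gradient vanishes: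
   v does not depend on x_1.  Hence v_1 is a constant a, psi - a x_1 is a bounded
   Neumann function, and a last use of Caccioppoli gives v = a e_1. *)

Require Import Defs.
From HB Require Import structures.
From mathcomp Require Import all_boot all_order all_algebra.
From mathcomp Require Import finmap.
From mathcomp Require Import all_classical all_reals all_analysis.
From mathcomp Require Import ring lra.
Import Order.TTheory GRing.Theory Num.Theory.
Import numFieldNormedType.Exports.
Local Open Scope classical_set_scope.
Local Open Scope ring_scope.

Set Implicit Arguments.
Unset Strict Implicit.
Unset Printing Implicit Defensive.

(** The boundary is only C^1 and [v] only continuous up to it, so elliptic regularity at the
    boundary and the flow of [v] are not at hand. Three devices replace them. Integrals over the
    cylinder are suprema over weights supported inside it, and v.n = 0 enters through cutoffs of the
    cross-section: a boundary layer of width eps has volume O(eps), the cutoff has gradient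
    O(1/eps), but its derivative along [v] is only o(1/eps) plus a bounded term, hence small in L^1.
    Trajectories become finite compositions of explicit ascent steps, bent inward at the boundary
    and weighted so as to depend continuously on the point. The local L^1-L^2 estimate up to the
    boundary pushes points inward along a cone, where the interior mean value property is available.
    The powers of n: a squared L^2 norm O(n^2) on each of O(n) slabs gives O(n^3); the Caccioppoli
    factor n^-2 leaves an energy O(n); a second factor n^-2, applied to the differences, leaves
    O(1/n). The momentum equation enters once [v] is known, to find the pressure. *)

Section Calculus.
Variable R : realType.
Implicit Types (n : nat).

(** * Inner product, sup norm and compactness on row vectors *)

Lemma dotvC n (x y : 'rV[R]_n) : dotv x y = dotv y x.
Proof. by apply: eq_bigr => i _; rewrite mulrC. Qed.

Lemma dotvDl n (x y z : 'rV[R]_n) : dotv (x + y) z = dotv x z + dotv y z.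
Proof. by rewrite -big_split; apply: eq_bigr => i _; rewrite mxE mulrDl. Qed.

Lemma dotvZl n (a : R) (x z : 'rV[R]_n) : dotv (a *: x) z = a * dotv x z.
Proof. by rewrite /dotv mulr_sumr; apply: eq_bigr => i _; rewrite mxE mulrA. Qed.

Lemma dotvNl n (x z : 'rV[R]_n) : dotv (- x) z = - dotv x z.
Proof. by rewrite -scaleN1r dotvZl mulN1r. Qed.

Lemma dotv0l n (z : 'rV[R]_n) : dotv 0 z = 0.
Proof. by rewrite -[0](scale0r 0) dotvZl mul0r. Qed.

Lemma dotvDr n (x y z : 'rV[R]_n) : dotv z (x + y) = dotv z x + dotv z y.
Proof. by rewrite dotvC dotvDl !(dotvC _ z). Qed.

Lemma dotvZr n (a : R) (x z : 'rV[R]_n) : dotv z (a *: x) = a * dotv z x.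
Proof. by rewrite dotvC dotvZl (dotvC _ z). Qed.

Lemma dotvNr n (x z : 'rV[R]_n) : dotv z (- x) = - dotv z x.
Proof. by rewrite dotvC dotvNl (dotvC _ z). Qed.

Lemma dotv0r n (z : 'rV[R]_n) : dotv z 0 = 0.
Proof. by rewrite dotvC dotv0l. Qed.

Lemma dotv_evecr n (x : 'rV[R]_n) i : dotv x (evec R i) = x 0 i.
Proof.
rewrite /dotv (bigD1 i) //= big1 ?addr0 ?mxE ?eqxx ?mulr1 // => j ji.
by rewrite mxE eqxx (negbTE ji) mulr0.
Qed.

Lemma dotv_ge0 n (x : 'rV[R]_n) : 0 <= dotv x x.
Proof. by apply: sumr_ge0 => i _; rewrite -expr2 sqr_ge0. Qed.

Lemma dotv_eq0 n (x : 'rV[R]_n) : (dotv x x == 0) = (x == 0).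
Proof.
apply/eqP/eqP => [h|->]; last exact: dotv0l.
apply/rowP => i; rewrite mxE; apply/eqP; rewrite -sqrf_eq0 expr2; apply/eqP.
have /psumr_eq0P h' : forall j : 'I_n, true -> 0 <= x 0 j * x 0 j.
  by move=> j _; rewrite -expr2 sqr_ge0.
exact: (h' h i).
Qed.

Lemma dotv_gt0 n (x : 'rV[R]_n) : (0 < dotv x x) = (x != 0).
Proof. by rewrite lt_def dotv_eq0 dotv_ge0 andbT. Qed.

Lemma enorm_sq n (x : 'rV[R]_n) : enorm x ^+ 2 = dotv x x.
Proof. by rewrite sqr_sqrtr ?dotv_ge0. Qed.

Lemma enorm_ge0 n (x : 'rV[R]_n) : 0 <= enorm x.
Proof. exact: sqrtr_ge0. Qed.

Lemma cauchy_schwarz n (x y : 'rV[R]_n) :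
  dotv x y ^+ 2 <= dotv x x * dotv y y.
Proof.
have [->|y0] := eqVneq y 0; first by rewrite !dotv0r expr0n mulr0.
have hy : 0 < dotv y y by rewrite dotv_gt0.
have := dotv_ge0 (dotv y y *: x - dotv x y *: y).
rewrite !(dotvDl, dotvDr, dotvNl, dotvNr, dotvZl, dotvZr) (dotvC y x).
set a := dotv x x; set b := dotv x y; set c := dotv y y => h.
have : 0 <= c * (a * c - b ^+ 2) by move: h; lra.
by rewrite pmulr_rge0 // subr_ge0.
Qed.

Lemma cauchy_schwarz_enorm n (x y : 'rV[R]_n) :
  `|dotv x y| <= enorm x * enorm y.
Proof.
rewrite -sqrtrM ?dotv_ge0 // -sqrtr_sqr ler_wsqrtr //; exact: cauchy_schwarz.
Qed.

(** [|x|] is the sup norm, so balls are cubes; the Euclidean [enorm] appears only where the inner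
    product does, and the two are compared with crude dimensional factors. *)
Lemma coord_le_norm n (x : 'rV[R]_n) i : `|x 0 i| <= `|x|.
Proof.
rewrite [leRHS]mx_normrE.
exact: (le_bigmax _ (fun k : 'I_1 * 'I_n => `|x k.1 k.2|) (0, i)).
Qed.

Lemma norm_le_coord n (x : 'rV[R]_n) (M : R) :
  0 <= M -> (forall i, `|x 0 i| <= M) -> `|x| <= M.
Proof.
move=> M0 h; rewrite [leLHS]mx_normrE; apply: bigmax_le => // -[i j] _ /=.
by rewrite (ord1 i).
Qed.

Lemma norm_lt_coord n (x : 'rV[R]_n) (M : R) :
  0 < M -> (forall i, `|x 0 i| < M) -> `|x| < M.
Proof.
move=> M0 h; rewrite [ltLHS]mx_normrE; apply: bigmax_lt => // -[i j] _ /=.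
by rewrite (ord1 i).
Qed.

Lemma enorm_le_norm n (x : 'rV[R]_n) : enorm x <= n%:R * `|x|.
Proof.
rewrite -(@ler_pXn2r _ 2) ?nnegrE ?enorm_ge0 ?mulr_ge0 //.
rewrite enorm_sq exprMn; apply: (@le_trans _ _ (\sum_(i < n) `|x| ^+ 2)).
  apply: ler_sum => i _; rewrite -expr2 -real_normK ?num_real //.
  by rewrite ler_pXn2r ?nnegrE // coord_le_norm.
rewrite sumr_const card_ord -[leLHS]mulr_natl.
apply: ler_wpM2r; first exact: sqr_ge0.
by rewrite -natrX ler_nat; case: (n) => // k; rewrite -mulnn leq_pmull.
Qed.

Lemma norm_le_enorm n (x : 'rV[R]_n) : `|x| <= enorm x.
Proof.
apply: norm_le_coord => [|i]; first exact: enorm_ge0.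
rewrite -sqrtr_sqr ler_wsqrtr // expr2 [leRHS](bigD1 i) //= lerDl.
by apply: sumr_ge0 => j _; rewrite -expr2 sqr_ge0.
Qed.

Lemma ball_normP n (x y : 'rV[R]_n) (e : R) : ball x e y <-> `|x - y| < e.
Proof. by rewrite mx_norm_ball. Qed.

Lemma cvg_ballP n (T : normedModType R) (f : 'rV[R]_n -> T) (x : 'rV[R]_n) l :
  f y @[y --> x] --> l <->
  forall e : R, 0 < e -> exists2 d : R, 0 < d & forall y, `|x - y| < d -> `|l - f y| < e.
Proof.
split.
  move=> /(@cvgrPdist_lt _ _ _ (nbhs x) (nbhs_filter x) f l) h e e0.
  have /nbhs_ballP[d d0 H] := h e e0.
  by exists d => // y /ball_normP /H.
move=> h; apply/(@cvgrPdist_lt _ _ _ (nbhs x) (nbhs_filter x) f l) => e e0; have [d d0 H] := h e e0.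
by apply/nbhs_ballP; exists d => // y /ball_normP /H.
Qed.

Lemma nbhs_normP n (x : 'rV[R]_n) (A : set 'rV[R]_n) :
  nbhs x A <-> exists2 d : R, 0 < d & forall y, `|x - y| < d -> A y.
Proof.
split=> [/nbhs_ballP[d d0 H]|[d d0 H]].
  by exists d => // y /ball_normP /H.
by apply/nbhs_ballP; exists d => // y /ball_normP /H.
Qed.

Lemma open_normP n (U : set 'rV[R]_n) : open U <->
  forall x, U x -> exists2 d : R, 0 < d & forall y, `|x - y| < d -> U y.
Proof.
rewrite openE; split=> h x Ux; first by have /nbhs_normP := h _ Ux.
by apply/nbhs_normP; exact: h.
Qed.

Lemma closure_normP n (U : set 'rV[R]_n) x : closure U x <->
  forall d : R, 0 < d -> exists y, U y /\ `|x - y| < d.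
Proof.
split=> [h d d0|h B /nbhs_normP[d d0 H]].
  by have [y [Uy /ball_normP xy]] := h _ (nbhsx_ballx x d d0); exists y.
by have [y [Uy xy]] := h d d0; exists y; split => //; exact: H.
Qed.

Lemma closed_normP n (K : set 'rV[R]_n) : closed K <->
  forall x, (forall d : R, 0 < d -> exists y, K y /\ `|x - y| < d) -> K x.
Proof. by split=> h x H; apply: h; apply/closure_normP. Qed.

Lemma closed_norm_le n (A : R) : closed [set x : 'rV[R]_n | `|x| <= A].
Proof.
apply/closed_normP => x h /=; rewrite leNgt; apply/negP => Ax.
have [|y [/= yA xy]] := h (`|x| - A); first by rewrite subr_gt0.
have := lerB_dist x y; lra.
Qed.

Lemma within_normP n (T : normedModType R) (A : set 'rV[R]_n) (f : 'rV[R]_n -> T) :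
  {within A, continuous f} <->
  forall x, A x -> forall e : R, 0 < e ->
    exists2 d : R, 0 < d & forall y, A y -> `|x - y| < d -> `|f x - f y| < e.
Proof.
rewrite subspace_continuousP; split=> h x Ax.
  move=> e e0; have /cvgrPdist_lt/(_ e e0) := h x Ax.
  rewrite near_withinE => /nbhs_normP[d d0 H].
  by exists d => // y Ay xy; apply: H.
apply/cvgrPdist_lt => e e0; have [d d0 H] := h x Ax e e0.
by rewrite near_withinE; apply/nbhs_normP; exists d => // y xy Ay; exact: H.
Qed.

Lemma compact_normP n (K : set 'rV[R]_n) : compact K <->
  closed K /\ exists A : R, forall x, K x -> `|x| <= A.
Proof.
split.
  move=> cK; split; first exact: (compact_closed _ cK).
  have [A [_ h]] := compact_bounded cK.
  by exists (A + 1) => x Kx; apply: (h (A + 1)) => //; rewrite ltrDl.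
case=> clK [A hA]; apply: bounded_closed_compact => //.
exists A; split; first exact: num_real.
by move=> B AB x Kx; apply: le_trans (hA x Kx) (ltW AB).
Qed.

Lemma compact_dist_le n (z : 'rV[R]_n) (B : R) : compact [set y | `|z - y| <= B].
Proof.
apply/compact_normP; split; last first.
  by exists (`|z| + B) => y /= h; have := lerB_dist y z; rewrite distrC; lra.
apply/closed_normP => y h /=; rewrite leNgt; apply/negP => By.
have [|u [/= uB yu]] := h (`|z - y| - B); first by rewrite subr_gt0.
have := ler_normD (z - u) (u - y); rewrite addrA subrK (distrC u y); lra.
Qed.

Lemma compact_fun_bounded n (T : normedModType R) (K : set 'rV[R]_n)
    (f : 'rV[R]_n -> T) : compact K -> {within K, continuous f} ->
  exists2 B : R, 0 < B & forall x, K x -> `|f x| <= B.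
Proof.
move=> cK cf; have [M [_ h]] := compact_bounded (continuous_compact cf cK).
exists (`|M| + 1) => [|x Kx]; first by rewrite ltr_wpDl.
apply: (h (`|M| + 1)); last by exists x.
by have := ler_norm M; lra.
Qed.

Lemma compact_finite_cover n (K : set 'rV[R]_n) (r : 'rV[R]_n -> R) :
  compact K -> (forall x, K x -> 0 < r x) ->
  exists2 s : seq 'rV[R]_n, (forall x, x \in s -> K x) &
    forall y, K y -> exists2 x, x \in s & `|x - y| < r x.
Proof.
move=> cK r0; have cc : cover_compact K by rewrite -compact_cover.
have [||D DK KD] := cc _ K (fun x => ball x (r x)).
- by move=> x _; exact: ball_open.
- by move=> x Kx; exists x => //; apply: ballxx; exact: r0.
exists (enum_fset D) => [x xD|y Ky].
  by apply: set_mem; exact: DK.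
by have [x xD /ball_normP xy] := KD y Ky; exists x.
Qed.

Lemma pos_lower_bound (T : eqType) (s : seq T) (r : T -> R) :
  (forall x, x \in s -> 0 < r x) ->
  exists2 m : R, 0 < m & forall x, x \in s -> m <= r x.
Proof.
elim: s => [|a s IH] h; first by exists 1.
have [|m m0 hm] := IH; first by move=> x xs; apply: h; rewrite inE xs orbT.
have ra : 0 < r a by apply: h; rewrite mem_head.
exists (Num.min m (r a)); first by rewrite lt_min m0.
move=> x; rewrite inE => /predU1P[->|xs]; first by rewrite ge_min lexx orbT.
by rewrite ge_min hm.
Qed.

Lemma compact_unif_cont n (T : normedModType R) (K : set 'rV[R]_n)
    (f : 'rV[R]_n -> T) : compact K -> {within K, continuous f} ->
  forall e : R, 0 < e -> exists2 d : R, 0 < d &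
    forall x y, K x -> K y -> `|x - y| < d -> `|f x - f y| < e.
Proof.
move=> cK /within_normP cf e e0.
have e2 : 0 < e / 2 by rewrite divr_gt0.
have /choice[d hd] : forall x, exists d : R, K x -> 0 < d /\
    forall y, K y -> `|x - y| < d -> `|f x - f y| < e / 2.
  move=> x; have [Kx|nKx] := pselect (K x); last by exists 0.
  by have [d d0 H] := cf x Kx _ e2; exists d.
have hd2 x : K x -> 0 < d x / 2.
  by move=> Kx; rewrite divr_gt0 //; have [] := hd x Kx.
have [s sK Ks] := compact_finite_cover cK hd2.
have [m m0 hm] := pos_lower_bound (fun x xs => hd2 x (sK x xs)).
exists m => // x y Kx Ky xy.
have [z zs zx] := Ks x Kx.
have [dz H] := hd z (sK z zs).
have zx' : `|z - x| < d z by lra.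
have zy' : `|z - y| < d z.
  have -> : z - y = (z - x) + (x - y) by rewrite addrA subrK.
  apply: le_lt_trans (ler_normD _ _) _.
  have := hm z zs; lra.
have -> : f x - f y = (f z - f y) - (f z - f x).
  by rewrite opprB [RHS]addrC addrA subrK.
apply: le_lt_trans (ler_normB _ _) _.
have := H x Kx zx'; have := H y Ky zy'; lra.
Qed.

End Calculus.

(** * Gradients *)

Section Gradient.
Variable R : realType.

(** Carries the gradient as data, so that the field of a potential can be combined, shifted and
    rescaled without computing [grad]. Differentiability is included because directional derivatives
    alone would not yield the chain rule. *)
Definition gradient_at n (f : 'rV[R]_n -> R) (x g : 'rV[R]_n) : Prop :=
  differentiable f x /\ forall e, 'D_e f x = dotv g e.

Lemma rV_sum_evec n (e : 'rV[R]_n) : e = \sum_i e 0 i *: evec R i.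
Proof. exact: row_sum_delta. Qed.

Lemma differentiable_gradient n (f : 'rV[R]_n -> R) x :
  differentiable f x -> gradient_at f x (grad f x).
Proof.
move=> df; split=> // e; rewrite deriveE // {1}(rV_sum_evec e) linear_sum.
apply: eq_bigr => i _; rewrite linearZ mxE /= /partial deriveE //.
by rewrite mulrC.
Qed.

Lemma gradient_atE n (f : 'rV[R]_n -> R) x g : gradient_at f x g -> grad f x = g.
Proof.
by case=> _ h; apply/rowP => i; rewrite mxE /partial h dotv_evecr.
Qed.

Lemma gradient_at_partial n (f : 'rV[R]_n -> R) x g i :
  gradient_at f x g -> partial i f x = g 0 i.
Proof. by move=> h; rewrite -(gradient_atE h) mxE. Qed.

Lemma gradient_at_cst n (c : R) (x : 'rV[R]_n) : gradient_at (fun=> c) x 0.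
Proof.
split=> [|e]; first exact: differentiable_cst.
by rewrite derive_cst dotv0l.
Qed.

Lemma gradient_atD n (f g : 'rV[R]_n -> R) x df dg :
  gradient_at f x df -> gradient_at g x dg ->
  gradient_at (fun y => f y + g y) x (df + dg).
Proof.
move=> [f1 f2] [g1 g2]; split=> [|e]; first exact: differentiableD.
by rewrite (deriveD (diff_derivable f1) (diff_derivable g1)) f2 g2 dotvDl.
Qed.

Lemma gradient_atM n (f g : 'rV[R]_n -> R) x df dg :
  gradient_at f x df -> gradient_at g x dg ->
  gradient_at (fun y => f y * g y) x (f x *: dg + g x *: df).
Proof.
move=> [f1 f2] [g1 g2]; split=> [|e]; first exact: differentiableM.
rewrite (deriveM (diff_derivable f1) (diff_derivable g1)) f2 g2.
by rewrite dotvDl !dotvZl.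
Qed.

Lemma gradient_atZ n (a : R) (f : 'rV[R]_n -> R) x df :
  gradient_at f x df -> gradient_at (fun y => a * f y) x (a *: df).
Proof.
move=> h; have := gradient_atM (gradient_at_cst a x) h.
by rewrite scaler0 addr0.
Qed.

Lemma gradient_atN n (f : 'rV[R]_n -> R) x df :
  gradient_at f x df -> gradient_at (fun y => - f y) x (- df).
Proof.
move=> /(gradient_atZ (-1)); rewrite scaleN1r.
by under eq_fun do rewrite mulN1r.
Qed.

Lemma gradient_atB n (f g : 'rV[R]_n -> R) x df dg :
  gradient_at f x df -> gradient_at g x dg ->
  gradient_at (fun y => f y - g y) x (df - dg).
Proof. by move=> h1 /gradient_atN; exact: gradient_atD. Qed.

Lemma dotv_le_norm n (x y : 'rV[R]_n) : `|dotv x y| <= n%:R ^+ 2 * `|x| * `|y|.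
Proof.
apply: le_trans (cauchy_schwarz_enorm _ _) _.
rewrite expr2 -mulrA mulrACA; apply: ler_pM; rewrite ?enorm_ge0 // enorm_le_norm //.
Qed.

Lemma dotv_continuous n (g : 'rV[R]_n) : continuous (dotv g : 'rV[R]_n -> R).
Proof.
move=> x; apply/cvg_ballP => e e0; set C := n%:R ^+ 2 * `|g| + 1.
have C0 : 0 < C by rewrite ltr_wpDl // mulr_ge0 // exprn_ge0.
exists (e / C); first by rewrite divr_gt0.
move=> y; rewrite ltr_pdivlMr // => h.
rewrite -dotvNr -dotvDr; apply: le_lt_trans (dotv_le_norm _ _) _.
apply: le_lt_trans h; rewrite mulrC ler_wpM2l // lerDl.
by [].
Qed.

Lemma littleo_normP (V W : normedModType R) (f df : V -> W) (x : V) :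
  (f \o shift x = cst (f x) + df +o_ 0 id) <->
  forall e : R, 0 < e -> \forall h \near 0, `|f (h + x) - f x - df h| <= e * `|h|.
Proof.
split=> [/eqaddoP H e e0|H].
  by near do rewrite -addrA -opprD; exact: H.
apply/eqaddoP => e e0.
by near do rewrite /= !fctE opprD addrA; exact: H.
Unshelve. all: by end_near. Qed.

Lemma gradient_atP n (f : 'rV[R]_n -> R) x g : gradient_at f x g <->
  forall e : R, 0 < e -> exists2 d : R, 0 < d & forall h, `|h| < d ->
    `|f (x + h) - f x - dotv g h| <= e * `|h|.
Proof.
have eqv (df : 'rV[R]_n -> R) : (forall h, df h = dotv g h) ->
   (f \o shift x = cst (f x) + df +o_ (0 : 'rV[R]_n) id) <->
   forall e : R, 0 < e -> exists2 d : R, 0 < d & forall h, `|h| < d ->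
    `|f (x + h) - f x - dotv g h| <= e * `|h|.
  move=> hdf; split.
    move/littleo_normP => H e e0; have /nbhs_normP[d d0 K] := H e e0.
    exists d => // h hd; have := K h; rewrite sub0r normrN => /(_ hd).
    by rewrite hdf [h + x]addrC.
  move=> H; apply/littleo_normP => e e0; have [d d0 K] := H e e0.
  apply/nbhs_normP; exists d => // h; rewrite sub0r normrN => hd.
  by have := K h hd; rewrite hdf [h + x]addrC.
split=> [[f1 f2]|h].
  apply/(eqv ('d f x)) => [h|]; first by rewrite -deriveE.
  exact: diff_locally.
have dl : linear (dotv g : 'rV[R]_n -> R).
  by move=> a u v; rewrite dotvDr dotvZr.
(* Once [dotv g] is bundled as a continuous linear map, uniqueness of the differential identifies it
   with the differential of [f] at [x]. *)
pose dM := GRing.isLinear.Build _ _ _ _ _ dl.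
pose dL : {linear 'rV[R]_n -> R} := HB.pack (dotv g : 'rV[R]_n -> R) dM.
have cd : continuous (dL : 'rV[R]_n -> R).
  exact: dotv_continuous.
have ex := iffRL (eqv dL (fun=> erefl)) h.
have dE := diff_unique cd ex.
have df : differentiable f x by apply/diff_locallyP; rewrite dE.
by split=> // e; rewrite deriveE // dE.
Qed.

Lemma gradient_at_near n (f g : 'rV[R]_n -> R) x df :
  (\near x, f x = g x) -> gradient_at f x df -> gradient_at g x df.
Proof.
move=> fg /gradient_atP h; apply/gradient_atP => e e0.
have [d d0 H] := h e e0.
have [d' d'0 H'] := iffLR (nbhs_normP _ _) fg.
exists (Num.min d d'); first by rewrite lt_min d0.
move=> k; rewrite lt_min => /andP[k1 k2].
have xx := H' x; rewrite subrr normr0 in xx.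
rewrite -(xx d'0) -(H' (x + k)); first exact: H.
by rewrite opprD addrA subrr add0r normrN.
Qed.

Lemma gradient_at_comp n (phi : R -> R) (f : 'rV[R]_n -> R) x df d :
  is_derive (f x) 1 phi d -> gradient_at f x df ->
  gradient_at (fun y => phi (f y)) x (d *: df).
Proof.
move=> [p1 p2] [f1 f2].
have dphi : differentiable phi (f x) by apply/derivable1_diffP.
split=> [|e]; first exact: differentiable_comp.
rewrite deriveE; last exact: differentiable_comp.
rewrite diff_comp //= diff1E // derive1E p2 dotvZl -f2 deriveE //.
by rewrite mulrC.
Qed.

Lemma gradient_at_coord n (i : 'I_n) (x : 'rV[R]_n) :
  gradient_at (fun y : 'rV[R]_n => y 0 i) x (evec R i).
Proof.
apply/gradient_atP => e e0; exists 1 => // h _.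
rewrite mxE dotvC dotv_evecr [x 0 i + _]addrC addrK subrr normr0.
by rewrite mulr_ge0 // ltW.
Qed.

Lemma gradient_at_line n (f : 'rV[R]_n -> R) (x e g : 'rV[R]_n) (s : R) :
  gradient_at f (x + s *: e) g ->
  is_derive s 1 (fun t => f (x + t *: e)) (dotv g e).
Proof.
move=> [f1 f2].
have l : is_diff s (fun t : R => x + t *: e) (0 + ( *:%R ^~ e)).
  exact: (is_diffD (is_diff_cst x s) (is_diff_scalel s e)).
have dc : differentiable (fun t : R => f (x + t *: e)) s.
  exact: (@differentiable_comp _ _ _ _ (fun t : R => x + t *: e) f).
split; first exact/derivable1_diffP.
rewrite deriveE //.
rewrite (@diff_comp _ _ _ _ (fun t : R => x + t *: e) f) //= diff_val /= fctE add0r scale1r.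
by rewrite -f2 deriveE.
Qed.

Lemma mean_value n (f : 'rV[R]_n -> R) (x e : 'rV[R]_n) (w : 'rV[R]_n -> 'rV[R]_n)
    (t : R) : 0 <= t ->
  (forall s, 0 <= s <= t -> gradient_at f (x + s *: e) (w (x + s *: e))) ->
  exists2 s, 0 <= s <= t & f (x + t *: e) - f x = t * dotv (w (x + s *: e)) e.
Proof.
move=> t0 h.
have hs s : s \in `[0, t]%R ->
    is_derive s 1 (fun t => f (x + t *: e)) (dotv (w (x + s *: e)) e).
  by rewrite in_itv /= => st; apply: gradient_at_line; exact: h.
have [|s st] := MVT_segment t0 (fun s st => hs s (subset_itv_oo_cc st)).
  apply: derivable_within_continuous => s st.
  by have [] := hs s st.
rewrite scale0r addr0 subr0 => ->.
by exists s; [rewrite in_itv in st|rewrite mulrC].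
Qed.

End Gradient.

(** * Iterated integrals *)

Section Integral1.
Variable R : realType.
Notation mu := (@lebesgue_measure R).

Definition compactly_supported1 (g : R -> R) : Prop :=
  continuous g /\ exists2 A : R, 0 < A & forall t, A < `|t| -> g t = 0.

Lemma compactly_supported1D g1 g2 : compactly_supported1 g1 -> compactly_supported1 g2 ->
  compactly_supported1 (fun t => g1 t + g2 t).
Proof.
move=> [c1 [A1 A10 h1]] [c2 [A2 A20 h2]]; split.
  by move=> x; apply: cvgD; [exact: c1|exact: c2].
exists (Num.max A1 A2); first by rewrite lt_max A10.
by move=> t; rewrite gt_max => /andP[t1 t2]; rewrite h1 // h2 // addr0.
Qed.

Lemma compactly_supported1_integrable g : compactly_supported1 g -> mu.-integrable setT (EFin \o g).
Proof.
move=> [cg [A A0 hg]].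
have -> : EFin \o g = (EFin \o g) \_ `[- A, A].
  apply/funext => t; rewrite patchE; case: ifPn => //.
  rewrite notin_setE /= in_itv /= -ler_norml => /negP; rewrite -ltNge => h.
  by rewrite /= hg.
rewrite -integrable_mkcond //.
apply: continuous_compact_integrable; first exact: segment_compact.
exact: continuous_subspaceT.
Qed.

Lemma Rint_bound g A M : 0 < A -> compactly_supported1 g ->
  (forall t, A < `|t| -> g t = 0) -> (forall t, g t <= M) ->
  \int[mu]_(t in setT) g t <= M * (2 * A).
Proof.
move=> A0 cg hA hM.
have -> : \int[mu]_(t in setT) g t = \int[mu]_(t in `[- A, A]) g t.
  rewrite [RHS]Rintegral_mkcond; congr Rintegral; apply/funext => t.
  rewrite patchE; case: ifPn => //.
  rewrite notin_setE /= in_itv /= -ler_norml => /negP; rewrite -ltNge => h.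
  by rewrite /= hA.
have <- : \int[mu]_(t in `[- A, A]) (fun=> M) t = M * (2 * A).
  rewrite Rintegral_cst //= lebesgue_measure_itv /= lte_fin.
  by rewrite ifT; [rewrite opprK mulr2n mulrDl mul1r|lra].
apply: le_Rintegral => //.
- by apply: (integrableS measurableT) => //; exact: compactly_supported1_integrable.
- apply: continuous_compact_integrable; first exact: segment_compact.
  by apply: continuous_subspaceT => x; exact: cvg_cst.
Qed.

Lemma Rint_pos g t0 : compactly_supported1 g -> (forall t, 0 <= g t) -> 0 < g t0 ->
  0 < \int[mu]_(t in setT) g t.
Proof.
move=> cg g0 gt0; have [cont _] := cg.
have := cont t0 => /cvgrPdist_lt/(_ (g t0 / 2)) []; first by rewrite divr_gt0.
move=> d /= d0 hd.
have ig := compactly_supported1_integrable cg.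
apply: (@lt_le_trans _ _ (\int[mu]_(t in `[t0 - d / 2, t0 + d / 2]) (fun=> g t0 / 2) t)).
  rewrite Rintegral_cst //= lebesgue_measure_itv /= lte_fin.
  rewrite ifT /=; last by lra.
  by rewrite mulr_gt0 ?divr_gt0 //; lra.
apply: (@le_trans _ _ (\int[mu]_(t in `[t0 - d / 2, t0 + d / 2]) g t)).
  apply: le_Rintegral => //.
  - apply: continuous_compact_integrable; first exact: segment_compact.
    by apply: continuous_subspaceT => x; exact: cvg_cst.
  - exact: (integrableS measurableT).
  move=> t /=; rewrite in_itv /= => /andP[t1 t2].
  have := hd t; rewrite /ball_ /= => /(_ _).
  have : `|t0 - t| < d by rewrite ltr_norml; apply/andP; split; lra.
  move=> td /(_ td); rewrite ltr_norml => /andP[_]; lra.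
rewrite [leLHS]Rintegral_mkcond; apply: le_Rintegral => //.
  have -> : EFin \o g \_ `[t0 - d / 2, t0 + d / 2] = (EFin \o g) \_ `[t0 - d / 2, t0 + d / 2].
    by rewrite restrict_EFin.
  by rewrite -integrable_mkcond //; exact: (integrableS measurableT).
by move=> t _; rewrite patchE; case: ifP.
Qed.

Lemma Rint_affine_ge0 (g : R -> R) (a r : R) : 0 < r -> continuous g -> (forall t, 0 <= g t) ->
  \int[mu]_(t in setT) g t = \int[mu]_(t in setT) (g (r * t + a) * r).
Proof.
move=> r0 cg g0.
have dF (x : R) : is_derive x 1 (fun t : R => r * t + a) r.
  have h1 : is_derive x (1 : R) (r \*: (id : R -> R)) (r *: (1 : R)).
    exact: is_deriveZ.
  have := is_deriveD h1 (is_derive_cst a x (1 : R)).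
  by rewrite addr0 /GRing.scale /= mulr1.
have dF1 : derive1 (fun t : R => r * t + a) = cst r.
  by apply/funext => x; rewrite derive1E; have [] := dF x.
rewrite /Rintegral (@increasing_ge0_integration_by_substitutionT _ (fun t => r * t + a)) //.
- by rewrite dF1.
- by move=> x y xy; rewrite ltrD2r ltr_pM2l.
- by rewrite dF1; move=> x; exact: cvg_cst.
- by rewrite dF1; exact: is_cvg_cst.
- by rewrite dF1; exact: is_cvg_cst.
- apply/cvgrNyPle => M; near=> x.
  have : x <= (M - a) / r by near: x; apply: nbhs_ninfty_le; exact: num_real.
  by rewrite ler_pdivlMr // mulrC; lra.
- apply/cvgryPge => M; near=> x.
  have : (M - a) / r <= x by near: x; apply: nbhs_pinfty_ge; exact: num_real.
  by rewrite ler_pdivrMr // mulrC; lra.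
Unshelve. all: by end_near. Qed.

Lemma compactly_supported1_norm g : compactly_supported1 g ->
  compactly_supported1 (fun t => `|g t|).
Proof.
move=> [c1 [A1 A10 h1]]; split.
  by move=> x; apply: cvg_norm; exact: c1.
by exists A1 => // t tA; rewrite h1 // normr0.
Qed.

Lemma compactly_supported1_affine g a r : 0 < r -> compactly_supported1 g ->
  compactly_supported1 (fun t => g (r * t + a)).
Proof.
move=> r0 [c1 [A1 A10 h1]]; split.
  move=> x; apply: (@continuous_comp _ _ _ (fun t => r * t + a) g); last exact: c1.
  by apply: cvgD; [apply: cvgMr; exact: cvg_id|exact: cvg_cst].
exists ((A1 + `|a|) / r); first by rewrite divr_gt0 // ltr_wpDr.
move=> t; rewrite ltr_pdivrMr // => tA; apply: h1.
apply: lt_le_trans (lerB_normD _ _); rewrite normrM (gtr0_norm r0).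
lra.
Qed.

Lemma RintD g1 g2 : compactly_supported1 g1 -> compactly_supported1 g2 ->
  \int[mu]_(t in setT) (g1 t + g2 t) = \int[mu]_(t in setT) g1 t + \int[mu]_(t in setT) g2 t.
Proof. by move=> c1 c2; rewrite RintegralD //; exact: compactly_supported1_integrable. Qed.

Lemma RintZ c g : compactly_supported1 g ->
  \int[mu]_(t in setT) (c * g t) = c * \int[mu]_(t in setT) g t.
Proof. by move=> c1; rewrite RintegralZl //; exact: compactly_supported1_integrable. Qed.

(** The substitution formula holds for the nonnegative functions [|g|] and [|g| + g]; subtracting
    the two gives it for [g]. *)
Lemma Rint_affine g a r : 0 < r -> compactly_supported1 g ->
  \int[mu]_(t in setT) g t = r * \int[mu]_(t in setT) g (r * t + a).
Proof.
move=> r0 cg; have cn := compactly_supported1_norm cg.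
have cs := compactly_supported1D cn cg.
have H h : compactly_supported1 h -> (forall t, 0 <= h t) ->
    \int[mu]_(t in setT) h t = r * \int[mu]_(t in setT) h (r * t + a).
  move=> ch h0; rewrite (Rint_affine_ge0 a r0) //; last by have [] := ch.
  rewrite -RintZ; last exact: compactly_supported1_affine.
  by under eq_Rintegral do rewrite mulrC.
have can := compactly_supported1_affine a r0 cn.
have ca := compactly_supported1_affine a r0 cg.
have E : \int[mu]_t (`|g t| + g t) = r * \int[mu]_t (`|g (r * t + a)| + g (r * t + a)).
  by apply: H => // t; have := ler_norm (- g t); rewrite normrN; lra.
rewrite RintD // (H _ cn) // (RintD can ca) mulrDr in E.
exact: (addrI (r * \int[mu]_(t in setT) `|g (r * t + a)|)).
Qed.

End Integral1.

(** * Iterated integrals of continuous compactly supported functions *)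

Section IteratedIntegral.
Variable R : realType.
Notation mu := (@lebesgue_measure R).

Definition compactly_supported n (f : 'rV[R]_n -> R) : Prop :=
  continuous f /\ exists2 A : R, 0 < A & forall x, A < `|x| -> f x = 0.

Definition cons_rv n (t : R) (y : 'rV[R]_n) : 'rV[R]_n.+1 :=
  row_mx (const_mx t : 'rV[R]_1) y.

Lemma cons_rvK n (x : 'rV[R]_n.+1) : exists t y, x = cons_rv t y.
Proof.
exists (x 0 0), (rsubmx (x : 'rV_(1 + n))).
rewrite /cons_rv -[LHS](@hsubmxK _ 1 1 n); apply: (f_equal2 (@row_mx _ 1 1 n)) => //.
apply/rowP => i; rewrite !mxE (ord1 i); congr (x _ _); exact: val_inj.
Qed.

Lemma cons_rvD n t s (y z : 'rV[R]_n) : cons_rv t y + cons_rv s z = cons_rv (t + s) (y + z).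
Proof.
rewrite /cons_rv (@add_row_mx _ 1 1 n); apply: (f_equal2 (@row_mx _ 1 1 n)) => //.
by apply/rowP => i; rewrite !mxE.
Qed.

Lemma cons_rvZ n a t (y : 'rV[R]_n) : a *: cons_rv t y = cons_rv (a * t) (a *: y).
Proof.
rewrite /cons_rv (@scale_row_mx _ 1 1 n); apply: (f_equal2 (@row_mx _ 1 1 n)) => //.
by apply/rowP => i; rewrite !mxE.
Qed.

Lemma cons_rvB n t s (y z : 'rV[R]_n) : cons_rv t y - cons_rv s z = cons_rv (t - s) (y - z).
Proof. by rewrite -scaleN1r cons_rvZ cons_rvD scaleN1r mulN1r. Qed.

Lemma cons_rv_norm_le n t (y : 'rV[R]_n) (M : R) :
  (`|cons_rv t y| <= M) = (`|t| <= M) && (`|y| <= M).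
Proof.
apply/idP/andP => [h|[h1 h2]].
  have M0 : 0 <= M by apply: le_trans h.
  split.
    have := coord_le_norm (cons_rv t y) (lshift n (0 : 'I_1)).
    by rewrite /cons_rv (@row_mxEl _ 1 1 n) mxE => h'; exact: le_trans h' h.
  apply: norm_le_coord => // i.
  have := coord_le_norm (cons_rv t y) (rshift 1 i).
  by rewrite /cons_rv (@row_mxEr _ 1 1 n) => h'; exact: le_trans h' h.
apply: norm_le_coord => [|i]; first exact: le_trans h1.
rewrite /cons_rv; case: (split_ordP (i : 'I_(1 + n))) => j ->.
  by rewrite (@row_mxEl _ 1 1 n) mxE.
by rewrite (@row_mxEr _ 1 1 n); apply: le_trans h2; exact: coord_le_norm.
Qed.

Lemma cons_rv_norm n t (y : 'rV[R]_n) : `|cons_rv t y| = Num.max `|t| `|y|.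
Proof.
apply/le_anti/andP; split; first by rewrite cons_rv_norm_le !le_max !lexx orbT.
by rewrite ge_max -cons_rv_norm_le.
Qed.

Lemma cons_rv_norm_lt n t (y : 'rV[R]_n) (M : R) :
  (M < `|cons_rv t y|) = (M < `|t|) || (M < `|y|).
Proof. by rewrite !ltNge cons_rv_norm_le negb_and. Qed.

Lemma compactly_supported_unif_cont n (f : 'rV[R]_n -> R) :
  compactly_supported f -> forall e : R, 0 < e -> exists2 d : R, 0 < d &
    forall x y, `|x - y| < d -> `|f x - f y| < e.
Proof.
move=> [cf [A A0 hA]] e e0.
pose K := [set x : 'rV[R]_n | `|x| <= A + 1].
have cK : compact K.
  apply/compact_normP; split; last by exists (A + 1).
  exact: closed_norm_le.
have [d d0 hd] := compact_unif_cont cK (continuous_subspaceT cf) e0.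
exists (Num.min d 1); first by rewrite lt_min d0 /=.
move=> x y; rewrite lt_min => /andP[xy xy1].
have h1 : `|x| <= `|y| + 1 by have := lerB_dist x y; lra.
have h2 : `|y| <= `|x| + 1 by have := lerB_dist y x; rewrite distrC; lra.
have [Ax|xA] := ltP A `|x|; last first.
  by apply: hd => //; rewrite /K /=; lra.
have [Ay|yA] := ltP A `|y|; first by rewrite !hA // subrr normr0.
by apply: hd => //; rewrite /K /=; lra.
Qed.

Lemma compactly_supportedD n (f g : 'rV[R]_n -> R) : compactly_supported f ->
  compactly_supported g -> compactly_supported (fun x => f x + g x).
Proof.
move=> [c1 [A1 A10 h1]] [c2 [A2 A20 h2]]; split.
  by move=> x; apply: continuousD; [exact: c1|exact: c2].
exists (Num.max A1 A2); first by rewrite lt_max A10.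
by move=> t; rewrite gt_max => /andP[t1 t2]; rewrite h1 // h2 // addr0.
Qed.

Lemma compactly_supportedZ n c (f : 'rV[R]_n -> R) : compactly_supported f ->
  compactly_supported (fun x => c * f x).
Proof.
move=> [c1 [A1 A10 h1]]; split.
  by move=> x; apply: continuousM; [exact: cst_continuous|exact: c1].
by exists A1 => // t tA; rewrite h1 // mulr0.
Qed.

Lemma compactly_supportedN n (f : 'rV[R]_n -> R) : compactly_supported f ->
  compactly_supported (fun x => - f x).
Proof.
move=> /(compactly_supportedZ (-1)); by under eq_fun do rewrite mulN1r.
Qed.

Lemma compactly_supportedB n (f g : 'rV[R]_n -> R) : compactly_supported f ->
  compactly_supported g -> compactly_supported (fun x => f x - g x).
Proof. by move=> cf /compactly_supportedN; exact: compactly_supportedD. Qed.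

Lemma continuous_affine_comp n (T : normedModType R) (f : 'rV[R]_n -> T) (r : R)
    (a x : 'rV[R]_n) :
  {for (r *: x + a), continuous f} -> {for x, continuous (fun y : 'rV[R]_n => f (r *: y + a))}.
Proof.
move=> /cvg_ballP cf; apply/cvg_ballP => e e0; have [d d0 h] := cf e e0.
exists (d / (`|r| + 1)); first by rewrite divr_gt0 // ltr_wpDl.
move=> y; rewrite ltr_pdivlMr ?ltr_wpDl // => xy; apply: h.
rewrite opprD addrACA subrr addr0 -scalerBr normrZ.
by apply: le_lt_trans xy; rewrite mulrC ler_wpM2l // lerDl.
Qed.

Lemma compactly_supported_slice n (f : 'rV[R]_n.+1 -> R) t :
  compactly_supported f -> compactly_supported (fun y => f (cons_rv t y)).
Proof.
move=> [cf [A A0 hA]]; split.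
  move=> y; apply/cvg_ballP => e e0.
  have /cvg_ballP/(_ e e0)[d d0 h] := cf (cons_rv t y).
  exists d => // z yz; apply: h; rewrite cons_rvB subrr.
  by rewrite cons_rv_norm gt_max normr0 d0.
by exists A => // y yA; apply: hA; rewrite cons_rv_norm_lt yA orbT.
Qed.

(** Additivity, homogeneity and the volume bound go through one induction: for the outer integral in
    dimension [n.+1] to make sense, the slice integrals must be continuous in [t], and that
    continuity uses all three properties in dimension [n]. *)
Let iint_spec n := forall f : 'rV[R]_n -> R, compactly_supported f ->
  (forall g, compactly_supported g -> iint (fun x => f x + g x) = iint f + iint g) /\
  (forall c, iint (fun x => c * f x) = c * iint f) /\
  (forall A M, 0 < A -> (forall x, A < `|x| -> f x = 0) -> (forall x, f x <= M) ->
     iint f <= M * (2 * A) ^+ n).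

Let iint_slice_cs n (f : 'rV[R]_n.+1 -> R) : iint_spec n -> compactly_supported f ->
  compactly_supported1 (fun t => iint (fun y => f (cons_rv t y))).
Proof.
move=> IH cf; have [cont [A A0 hA]] := cf.
split; last first.
  exists A => // t tA.
  have -> : (fun y => f (cons_rv t y)) = fun y => 0 * f (cons_rv t y).
    by apply/funext => y; rewrite mul0r hA // cons_rv_norm_lt tA.
  have [_ [-> _]] := IH _ (compactly_supported_slice t cf).
  by rewrite mul0r.
have C0 : 0 < (2 * A) ^+ n by rewrite exprn_gt0 // mulr_gt0.
(* A one-sided bound is enough: exchanging [s] and [t] gives the absolute value. *)
have key (e : R) : 0 < e -> exists2 d : R, 0 < d & forall s t, `|s - t| < d ->
    iint (fun y => f (cons_rv s y)) - iint (fun y => f (cons_rv t y)) < e.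
  move=> e0; have e1 : 0 < e / 2 / (2 * A) ^+ n by rewrite !divr_gt0.
  have [d d0 hd] := compactly_supported_unif_cont cf e1.
  exists d => // s t st.
  have cs := compactly_supported_slice s cf; have ct := compactly_supported_slice t cf.
  have [_ [E _]] := IH _ ct; have [E' _] := IH _ cs.
  rewrite -[X in _ + X]mulN1r -E -E'; last exact: compactly_supportedZ.
  have csb := compactly_supportedD cs (compactly_supportedZ (-1) ct).
  have [_ [_ B]] := IH _ csb.
  apply: (@le_lt_trans _ _ (e / 2 / (2 * A) ^+ n * (2 * A) ^+ n)); last first.
    by rewrite divfK ?gt_eqF //; lra.
  apply: B => // [y yA|y].
    by rewrite !hA ?mulr0 ?addr0 // cons_rv_norm_lt yA orbT.
  have := hd (cons_rv s y) (cons_rv t y).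
  rewrite cons_rvB [y - y]subrr => H.
  have : `|f (cons_rv s y) - f (cons_rv t y)| < e / 2 / (2 * A) ^+ n.
    by apply: H; rewrite cons_rv_norm gt_max normr0 d0 st.
  by rewrite mulN1r => /ltW; apply: le_trans; exact: ler_norm.
move=> t; apply/cvgrPdist_lt => e e0; have [d d0 h] := key e e0.
apply/nbhs_ballP; exists d => // s; rewrite /ball /= => ts.
rewrite ltr_norml (h t s) // andbT ltrNl opprB; apply: h.
by rewrite distrC.
Qed.

Let iint_specP n : iint_spec n.
Proof.
elim: n => [|n IH] f cf.
  by split => //; split => // A M _ _ h; rewrite expr0 mulr1; exact: h.
have cs := iint_slice_cs IH cf.
split=> [g cg|].
  have cs' := iint_slice_cs IH cg.
  rewrite /= -RintD //; congr Rintegral; apply/funext => t.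
  have [H _] := IH _ (compactly_supported_slice t cf).
  by apply: H; exact: compactly_supported_slice.
split=> [c|A M A0 hA hM].
  rewrite /= -RintZ //; congr Rintegral; apply/funext => t.
  have [_ [H _]] := IH _ (compactly_supported_slice t cf).
  exact: H.
rewrite exprSr mulrA; apply: Rint_bound => // [t tA|t].
  have E : iint (fun y => 0 * f (cons_rv t y)) = 0.
    by have [_ [-> _]] := IH _ (compactly_supported_slice t cf); rewrite mul0r.
  rewrite -[RHS]E; congr iint; apply/funext => y.
  by rewrite mul0r hA // cons_rv_norm_lt tA.
have [_ [_ H]] := IH _ (compactly_supported_slice t cf).
by apply: H => // y yA; apply: hA; rewrite cons_rv_norm_lt yA orbT.
Qed.

Lemma compactly_supported1_iint n (f : 'rV[R]_n.+1 -> R) : compactly_supported f ->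
  compactly_supported1 (fun t => iint (fun y => f (cons_rv t y))).
Proof. by move=> cf; exact: iint_slice_cs (@iint_specP n) cf. Qed.

Lemma iintD n (f g : 'rV[R]_n -> R) : compactly_supported f -> compactly_supported g ->
  iint (fun x => f x + g x) = iint f + iint g.
Proof. by move=> cf; have [H _] := iint_specP cf; exact: H. Qed.

Lemma iintZ n c (f : 'rV[R]_n -> R) : compactly_supported f ->
  iint (fun x => c * f x) = c * iint f.
Proof. by move=> cf; have [_ [H _]] := iint_specP cf; exact: H. Qed.

Lemma iint_le_bound n (f : 'rV[R]_n -> R) A M : compactly_supported f ->
  0 < A -> (forall x, A < `|x| -> f x = 0) -> (forall x, f x <= M) ->
  iint f <= M * (2 * A) ^+ n.
Proof. by move=> cf; have [_ [_ H]] := iint_specP cf; exact: H. Qed.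

Lemma iintN n (f : 'rV[R]_n -> R) : compactly_supported f ->
  iint (fun x => - f x) = - iint f.
Proof.
by move=> cf; rewrite -mulN1r -iintZ //; congr iint; apply/funext => x; rewrite mulN1r.
Qed.

Lemma iintB n (f g : 'rV[R]_n -> R) : compactly_supported f -> compactly_supported g ->
  iint (fun x => f x - g x) = iint f - iint g.
Proof.
by move=> cf cg; rewrite -iintN // -iintD //; exact: compactly_supportedN.
Qed.

Lemma iint_le n (f g : 'rV[R]_n -> R) : compactly_supported f -> compactly_supported g ->
  (forall x, f x <= g x) -> iint f <= iint g.
Proof.
move=> cf cg fg; rewrite -subr_le0 -iintB //.
have cfg := compactly_supportedB cf cg; have [_ [A A0 hA]] := cfg.
rewrite -(mul0r ((2 * A) ^+ n)); apply: iint_le_bound => // x.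
by rewrite subr_le0.
Qed.

Lemma compactly_supported0 n : compactly_supported (fun _ : 'rV[R]_n => 0).
Proof. by split=> [x|]; [exact: cst_continuous|exists 1]. Qed.

Lemma iint0 n : iint (fun _ : 'rV[R]_n => 0) = 0.
Proof.
have -> : (fun _ : 'rV[R]_n => (0 : R)) = fun _ => 0 * 0 by apply/funext => x; rewrite mul0r.
by rewrite iintZ ?mul0r //; exact: compactly_supported0.
Qed.

Lemma iint_ge0 n (f : 'rV[R]_n -> R) : compactly_supported f ->
  (forall x, 0 <= f x) -> 0 <= iint f.
Proof. by move=> cf f0; rewrite -(iint0 n); apply: iint_le => //; exact: compactly_supported0. Qed.

Lemma iint_norm_bound n (f : 'rV[R]_n -> R) A M : compactly_supported f ->
  0 < A -> (forall x, A < `|x| -> f x = 0) -> (forall x, `|f x| <= M) ->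
  `|iint f| <= M * (2 * A) ^+ n.
Proof.
move=> cf A0 hA hM; rewrite ler_norml; apply/andP; split.
  rewrite lerNl -iintN //; apply: iint_le_bound => //.
  - exact: compactly_supportedN.
  - by move=> x xA; rewrite hA // oppr0.
  - by move=> x; apply: le_trans (hM x); rewrite -normrN; exact: ler_norm.
by apply: iint_le_bound => // x; apply: le_trans (hM x); exact: ler_norm.
Qed.

Lemma iint_norm_le n (f g : 'rV[R]_n -> R) : compactly_supported f -> compactly_supported g ->
  (forall x, `|f x| <= g x) -> `|iint f| <= iint g.
Proof.
move=> cf cg fg; rewrite ler_norml; apply/andP; split.
  rewrite lerNl -iintN //; apply: iint_le => //; first exact: compactly_supportedN.
  by move=> x; apply: le_trans (fg x); rewrite -normrN; exact: ler_norm.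
by apply: iint_le => // x; apply: le_trans (fg x); exact: ler_norm.
Qed.

Lemma compactly_supported_affine n (f : 'rV[R]_n -> R) a r : 0 < r ->
  compactly_supported f -> compactly_supported (fun x => f (r *: x + a)).
Proof.
move=> r0 [c1 [A1 A10 h1]]; split.
  by move=> x; apply: continuous_affine_comp; exact: c1.
exists ((A1 + `|a|) / r); first by rewrite divr_gt0 // ltr_wpDr.
move=> t; rewrite ltr_pdivrMr // => tA; apply: h1.
apply: lt_le_trans (lerB_normD _ _); rewrite normrZ (gtr0_norm r0).
lra.
Qed.

Lemma iint_affine n (f : 'rV[R]_n -> R) a r : 0 < r -> compactly_supported f ->
  iint f = r ^+ n * iint (fun x => f (r *: x + a)).
Proof.
move=> r0; elim: n => [|n IH] in f a *.
  move=> _; rewrite expr0 mul1r /=; congr f; apply/rowP; by case.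
move=> cf; have [t [y ->]] := cons_rvK a.
rewrite /= (Rint_affine t r0); last exact: compactly_supported1_iint.
rewrite exprS -mulrA; congr (r * _).
rewrite -RintZ; last first.
  exact: (compactly_supported1_iint (compactly_supported_affine (cons_rv t y) r0 cf)).
congr Rintegral; apply/funext => s.
rewrite (IH _ y); last exact: compactly_supported_slice.
congr (_ * iint _); apply/funext => z; congr f.
by rewrite -[row_mx _ z]/(cons_rv s z) cons_rvZ cons_rvD.
Qed.

Lemma compactly_supported_shift n (f : 'rV[R]_n -> R) a :
  compactly_supported f -> compactly_supported (fun x => f (x + a)).
Proof.
by move=> /(compactly_supported_affine a ltr01); under eq_fun do rewrite scale1r.
Qed.

Lemma iint_shift n (f : 'rV[R]_n -> R) a : compactly_supported f ->
  iint (fun x => f (x + a)) = iint f.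
Proof.
move=> cf; rewrite [RHS](iint_affine a ltr01) // expr1n mul1r.
by congr iint; apply/funext => x; rewrite scale1r.
Qed.

Lemma iint_gt0 n (f : 'rV[R]_n -> R) x : compactly_supported f ->
  (forall x, 0 <= f x) -> 0 < f x -> 0 < iint f.
Proof.
elim: n => [|n IH] in f x *.
  by move=> _ _; have -> : x = 0 by apply/rowP; case.
move=> cf f0; have [t [y ->]] := cons_rvK x => fx.
apply: (@Rint_pos _ _ t); first exact: (compactly_supported1_iint cf).
  by move=> s; apply: iint_ge0 => //; exact: compactly_supported_slice.
by apply: (IH _ y) => //; exact: compactly_supported_slice.
Qed.

End IteratedIntegral.

(** * Weak formulation *)

Section IntegrationByParts.
Variable R : realType.

Lemma continuous_at_ext n (f g : 'rV[R]_n -> R) x :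
  f =1 g -> {for x, continuous f} -> {for x, continuous g}.
Proof. by move=> /funext ->. Qed.

Lemma continuous_at_sum n (T : Type) (r : seq T) (F : T -> 'rV[R]_n -> R) x :
  (forall i, {for x, continuous (F i)}) ->
  {for x, continuous (fun y => \sum_(i <- r) F i y)}.
Proof.
move=> h; elim: r => [|a r IH].
  by apply: (@continuous_at_ext _ (fun=> 0)) => [y|]; [rewrite big_nil|exact: cst_continuous].
apply: (@continuous_at_ext _ (fun y => F a y + \sum_(i <- r) F i y)) => [y|].
  by rewrite big_cons.
by apply: continuousD; [exact: h|exact: IH].
Qed.

Lemma continuous_at_coord n m (f : 'rV[R]_n -> 'rV[R]_m) x i :
  {for x, continuous f} -> {for x, continuous (fun y => f y 0 i)}.
Proof.
move=> /cvg_ballP cf; apply/cvg_ballP => e e0; have [d d0 h] := cf e e0.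
exists d => // y xy; have := coord_le_norm (f x - f y) i.
by rewrite !mxE => /le_lt_trans; apply; exact: h.
Qed.

Lemma continuous_at_dotv n m (f g : 'rV[R]_n -> 'rV[R]_m) x :
  {for x, continuous f} -> {for x, continuous g} ->
  {for x, continuous (fun y => dotv (f y) (g y))}.
Proof.
move=> cf cg; apply: continuous_at_sum => i.
by apply: continuousM; exact: continuous_at_coord.
Qed.

Lemma continuous_at_row n m (f : 'rV[R]_n -> 'rV[R]_m) x :
  (forall i, {for x, continuous (fun y => f y 0 i)}) -> {for x, continuous f}.
Proof.
move=> h; apply/cvg_ballP => e e0.
have /choice[d hd] : forall i, exists d : R, 0 < d /\
    forall y, `|x - y| < d -> `|f x 0 i - f y 0 i| < e.
  by move=> i; have /cvg_ballP/(_ e e0)[d d0 H] := h i; exists d.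
have [|m0 m00 hm] := @pos_lower_bound _ _ (enum 'I_m) d.
  by move=> i _; have [] := hd i.
exists m0 => // y xy; apply: norm_lt_coord => // i.
rewrite !mxE; have [_ H] := hd i; apply: H; apply: lt_le_trans xy _.
by apply: hm; rewrite mem_enum.
Qed.

Lemma gradient_at_continuous n (f : 'rV[R]_n -> R) x g :
  gradient_at f x g -> {for x, continuous f}.
Proof. by case=> d _; exact: differentiable_continuous. Qed.

(** By translation invariance the difference [f (x + t e) - f x] has integral 0, and by the mean
    value theorem and the uniform continuity of [g] its quotient by [t] is uniformly close to [g] on
    a fixed cube. The direction is arbitrary and no order of integration is exchanged. *)
Lemma iint_directional_derivative n (f g : 'rV[R]_n -> R) e :
  compactly_supported f -> compactly_supported g ->
  (forall x, exists2 w, gradient_at f x w & dotv w e = g x) -> iint g = 0.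
Proof.
move=> cf cg hfg.
have /choice[w hw] : forall x, exists w, gradient_at f x w /\ dotv w e = g x.
  by move=> x; have [w w1 w2] := hfg x; exists w.
have hw1 x : gradient_at f x (w x) by have [] := hw x.
have hw2 x : dotv (w x) e = g x by have [] := hw x.
have [_ [A A0 hA]] := cf; have [_ [B B0 hB]] := cg.
apply/eqP; rewrite -normr_le0; apply/ler_addgt0Pr => eta eta0; rewrite add0r.
(* Volume of a cube containing the supports of [f], of [g] and of every translate of [f] by less
   than 1. *)
pose C := (2 * (A + B + 1)) ^+ n.
have C0 : 0 < C by rewrite exprn_gt0 //; lra.
have [d d0 hd] := compactly_supported_unif_cont cg (divr_gt0 eta0 C0).
have e1 : 0 < `|e| + 1 by rewrite ltr_wpDl.
pose t := Num.min d 1 / 2 / (`|e| + 1).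
have m0 : 0 < Num.min d 1 by rewrite lt_min d0 /=.
have t0 : 0 < t by rewrite !divr_gt0.
have te : t * `|e| < Num.min d 1.
  rewrite /t mulrAC ltr_pdivrMr //; nra.
have cft := compactly_supported_shift (t *: e) cf.
have ctg := compactly_supportedZ t cg.
have cF := compactly_supportedB (compactly_supportedB cft cf) ctg.
have E : iint (fun x => f (x + t *: e) - f x - t * g x) = - (t * iint g).
  by rewrite iintB ?iintB ?iint_shift ?iintZ ?subrr ?sub0r //; exact: compactly_supportedB.
have nte : `|t *: e| < Num.min d 1 by rewrite normrZ gtr0_norm.
have : `|t * iint g| <= t * (eta / C) * C.
  rewrite -normrN -E; apply: iint_norm_bound => //; first by lra.
    move=> x xA; have x1 : A < `|x| by lra.
    rewrite (hA x) // hB; last lra.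
    rewrite hA ?mulr0 ?subrr //.
    have := lerB_normD x (t *: e); move: nte; rewrite lt_min => /andP[_ nte]; lra.
  move=> x.
  have [s /andP[s0 st] ->] := @mean_value _ _ f x e w t (ltW t0) (fun s _ => hw1 _).
  rewrite hw2 -mulrBr normrM gtr0_norm // ler_pM2l // ltW // distrC hd //.
  rewrite opprD addrA subrr sub0r normrN normrZ ger0_norm //.
  apply: le_lt_trans (lt_le_trans te _); last by rewrite ge_min lexx.
  by rewrite ler_wpM2r.
by rewrite -mulrA divfK ?gt_eqF // normrM gtr0_norm // ler_pM2l.
Qed.

Lemma continuous_ext0 n (U K : set 'rV[R]_n) (g : 'rV[R]_n -> R) :
  closed K -> K `<=` U -> (forall x, ~ K x -> g x = 0) ->
  (forall x, U x -> {for x, continuous g}) -> continuous g.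
Proof.
move=> cK KU g0 cg x; have [Kx|nKx] := pselect (K x); first exact/cg/KU.
have /open_normP/(_ x nKx)[d d0 h] := closed_openC cK.
apply/cvg_ballP => e e0; exists d => // y xy.
by rewrite (g0 x nKx) (g0 y (h y xy)) subrr normr0.
Qed.

Lemma compactly_supported_ext0 n (U K : set 'rV[R]_n) (g : 'rV[R]_n -> R) :
  compact K -> K `<=` U -> (forall x, ~ K x -> g x = 0) ->
  (forall x, U x -> {for x, continuous g}) -> compactly_supported g.
Proof.
move=> /compact_normP[cK [A hA]] KU g0 cg; split; first exact: (continuous_ext0 cK KU).
exists (`|A| + 1); first by rewrite ltr_wpDl.
move=> x xA; apply: g0 => /hA; have := ler_norm A; lra.
Qed.

Lemma gradient_at_ext0 n (K : set 'rV[R]_n) (f : 'rV[R]_n -> R) x :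
  closed K -> (forall x, ~ K x -> f x = 0) -> ~ K x -> gradient_at f x 0.
Proof.
move=> cK f0 nKx; have /open_normP/(_ x nKx)[d d0 h] := closed_openC cK.
apply: gradient_at_near (gradient_at_cst 0 x).
by apply/nbhs_normP; exists d => // y /h /f0 ->.
Qed.

Lemma C1_on_gradient n (U : set 'rV[R]_n) f x : C1_on U f -> U x ->
  gradient_at f x (grad f x).
Proof. by move=> h /h[d _]; exact: differentiable_gradient. Qed.

Lemma C1_on_grad_continuous n (U : set 'rV[R]_n) f x : C1_on U f -> U x ->
  {for x, continuous (grad f)}.
Proof.
move=> h /h[_ c]; apply: continuous_at_row => i.
by apply: (@continuous_at_ext _ (partial i f)) => [y|]; [rewrite mxE|exact: c].
Qed.

(** The continuous gradients [D i] of the components are given as witnesses, which makes stability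
    under shifts, dilations and linear combinations immediate. *)
Definition divergence_free n (U : set 'rV[R]_n) (w : 'rV[R]_n -> 'rV[R]_n) : Prop :=
  exists D : 'I_n -> 'rV[R]_n -> 'rV[R]_n, forall x, U x ->
    (forall i, gradient_at (fun y => w y 0 i) x (D i x) /\ {for x, continuous (D i)}) /\
    \sum_i D i x 0 i = 0.

Lemma divergence_freeP n (U : set 'rV[R]_n) (w : 'rV[R]_n -> 'rV[R]_n) :
  (forall i, C1_on U (fun x => w x 0 i)) -> (forall x, U x -> divv w x = 0) ->
  divergence_free U w.
Proof.
move=> hw dw; exists (fun i => grad (fun x => w x 0 i)) => x Ux; split.
  by move=> i; split; [exact: C1_on_gradient (hw i) Ux|exact: C1_on_grad_continuous (hw i) Ux].
by rewrite -[RHS](dw x Ux); apply: eq_bigr => i _; rewrite mxE.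
Qed.

Lemma divergence_free_continuous n (U : set 'rV[R]_n) w x :
  divergence_free U w -> U x -> {for x, continuous w}.
Proof.
move=> [D hD] Ux; have [h _] := hD x Ux.
by apply: continuous_at_row => i; have [g _] := h i; exact: gradient_at_continuous g.
Qed.

(** This integrates div(h q w) = h w.grad q + q w.grad h. Neither [h] nor [q] need have compact
    support in [U]: outside [K] one of them vanishes with its gradient, for instance a cutoff of the
    cross-section on one part and a cutoff in x_1 on the other. *)
Lemma weak_form n (U K : set 'rV[R]_n) (h q : 'rV[R]_n -> R) (gh gq w : 'rV[R]_n -> 'rV[R]_n) :
  compact K -> K `<=` U ->
  (forall x, ~ K x -> (h x = 0 /\ gh x = 0) \/ (q x = 0 /\ gq x = 0)) ->
  (forall x, U x -> gradient_at h x (gh x) /\ {for x, continuous gh}) ->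
  (forall x, U x -> gradient_at q x (gq x) /\ {for x, continuous gq}) ->
  divergence_free U w ->
  [/\ compactly_supported (fun x => h x * dotv (w x) (gq x)),
      compactly_supported (fun x => q x * dotv (w x) (gh x)) &
      iint (fun x => h x * dotv (w x) (gq x)) = - iint (fun x => q x * dotv (w x) (gh x))].
Proof.
move=> cK KU hK hh hq [D hD].
have wU x i : U x -> gradient_at (fun x => w x 0 i) x (D i x).
  by move=> /hD[H _]; have [] := H i.
have cw x : U x -> {for x, continuous w}.
  by move=> Ux; apply: continuous_at_row => i; apply: gradient_at_continuous (wU x i Ux).
have ch x : U x -> {for x, continuous h} by move=> /hh[/gradient_at_continuous].
have cq x : U x -> {for x, continuous q} by move=> /hq[/gradient_at_continuous].
have c1 : compactly_supported (fun x => h x * dotv (w x) (gq x)).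
  apply: (compactly_supported_ext0 cK KU) => x.
    by move=> /hK[[-> _]|[_ ->]]; rewrite ?mul0r ?dotv0r ?mulr0.
  move=> Ux; apply: continuousM; first exact: ch.
  by apply: continuous_at_dotv; [exact: cw|have [] := hq x Ux].
have c2 : compactly_supported (fun x => q x * dotv (w x) (gh x)).
  apply: (compactly_supported_ext0 cK KU) => x.
    by move=> /hK[[_ ->]|[-> _]]; rewrite ?mul0r ?dotv0r ?mulr0.
  move=> Ux; apply: continuousM; first exact: cq.
  by apply: continuous_at_dotv; [exact: cw|have [] := hh x Ux].
split=> //; apply/eqP; rewrite -addr_eq0 -iintD //; apply/eqP.
(* The components of h q w and their gradients; both vanish off [K], so extended by zero they fit
   [iint_directional_derivative] along the i-th axis. *)
pose F i x := h x * q x * w x 0 i.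
pose W i x := (h x * q x) *: D i x
              + w x 0 i *: (h x *: gq x + q x *: gh x).
have F0 i x : ~ K x -> F i x = 0.
  by rewrite /F => /hK[[-> _]|[-> _]]; rewrite ?(mul0r, mulr0).
have FW i x : U x -> gradient_at (F i) x (W i x).
  move=> Ux; apply: gradient_atM; last exact: wU.
  by apply: gradient_atM; [have [] := hh x Ux|have [] := hq x Ux].
have W0 i x : ~ K x -> W i x = 0.
  rewrite /W => /hK[[-> ->]|[-> ->]].
    by rewrite mul0r !scale0r scaler0 addr0 scaler0 addr0.
  by rewrite mulr0 !scale0r scaler0 addr0 scaler0 addr0.
have cF i : compactly_supported (F i).
  apply: (compactly_supported_ext0 cK KU) => [x|x Ux]; first exact: F0.
  exact: gradient_at_continuous (FW i x Ux).
have cW i : compactly_supported (fun x => W i x 0 i).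
  apply: (compactly_supported_ext0 cK KU) => [x nK|x Ux]; first by rewrite W0 // mxE.
  apply: (@continuous_at_ext _ (fun x => h x * q x * D i x 0 i
      + w x 0 i * (h x * gq x 0 i + q x * gh x 0 i))).
    by move=> y; rewrite !mxE.
  apply: continuousD; apply: continuousM.
  - by apply: continuousM; [exact: ch|exact: cq].
  - by apply: continuous_at_coord; have [H _] := hD x Ux; have [] := H i.
  - exact: gradient_at_continuous (wU x i Ux).
  apply: continuousD; apply: continuousM; [exact: ch| |exact: cq| ];
    apply: continuous_at_coord; [by have [] := hq x Ux|by have [] := hh x Ux].
have FWall i x : gradient_at (F i) x (W i x).
  have [Kx|nKx] := pselect (K x); first exact/FW/KU.
  rewrite W0 //; apply: (@gradient_at_ext0 _ K) => //; last exact: F0.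
  by have /compact_normP[] := cK.
have iW i : iint (fun x => W i x 0 i) = 0.
  apply: (@iint_directional_derivative _ (F i) _ (evec R i)) => // x.
  by exists (W i x) => //; rewrite dotv_evecr.
have sumW (r : seq 'I_n) : compactly_supported (fun x => \sum_(i <- r) W i x 0 i) /\
    iint (fun x => \sum_(i <- r) W i x 0 i) = 0.
  elim: r => [|i r [IH1 IH2]].
    by under eq_fun do rewrite big_nil; split; [exact: compactly_supported0|exact: iint0].
  under eq_fun do rewrite big_cons; split; first exact: compactly_supportedD.
  by rewrite iintD // iW IH2 addr0.
have [_ <-] := sumW (index_enum 'I_n).
congr iint; apply/funext => x; have [Kx|nKx] := pselect (K x); last first.
  rewrite big1 => [|i _]; last by rewrite W0 // mxE.
  by case: (hK x nKx) => -[-> ->]; rewrite ?(mul0r, mulr0, dotv0r, addr0).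
have [_ E] := hD x (KU x Kx).
have -> : \sum_(i < n) W i x 0 i = h x * q x * \sum_i D i x 0 i
   + \sum_(i < n) w x 0 i * (h x * gq x 0 i + q x * gh x 0 i).
  by rewrite mulr_sumr -big_split; apply: eq_bigr => i _; rewrite !mxE.
rewrite E mulr0 add0r /dotv !mulr_sumr -big_split; apply: eq_bigr => i _ /=.
by rewrite mulrDr !mulrA ![w x 0 i * _]mulrC.
Qed.

End IntegrationByParts.

(** * Cutoff functions of one real variable *)

Section Cutoff1.
Variable R : realType.

(** A quadratic remainder bound holds across the kinks of piecewise polynomials such as
    [pos t ^+ 2], so their derivatives follow from an inequality instead of one-sided limits. *)
Lemma is_derive_quadratic (f : R -> R) (x d C : R) :
  (forall h, `|f (x + h) - f x - d * h| <= C * h ^+ 2) -> is_derive x 1 f d.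
Proof.
move=> H; have C0 : 0 <= C.
  by have := le_trans (normr_ge0 _) (H 1); rewrite expr1n mulr1.
suff cv : h^-1 *: (f (h *: (1 : R) + x) - f x) @[h --> 0^'] --> d.
  split; first by apply/cvg_ex; exists d; exact: cv.
  exact: cvg_lim cv.
apply/cvgrPdist_lt => e e0; near=> h.
have h0 : h != 0 by near: h; exact: nbhs_dnbhs_neq.
rewrite {1}/GRing.scale /= [h *: 1]mulr1 [h + x]addrC distrC.
have -> : h^-1 * (f (x + h) - f x) - d = h^-1 * (f (x + h) - f x - d * h).
  by rewrite [RHS]mulrBr [d * h]mulrC mulKf.
rewrite normrM normfV mulrC ltr_pdivrMr ?normr_gt0 //.
apply: le_lt_trans (H h) _; rewrite -real_normK ?num_real // expr2 mulrA.
rewrite ltr_pM2r ?normr_gt0 //.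
have : `|h| < e / (C + 1).
  by near: h; apply: dnbhs0_lt; rewrite divr_gt0 // ltr_wpDl.
rewrite ltr_pdivlMr ?ltr_wpDl // => hh.
by have := normr_ge0 h; nra.
Unshelve. all: by end_near. Qed.

Definition pos (t : R) : R := Num.max t 0.

Lemma pos_ge0 t : 0 <= pos t. Proof. by rewrite le_max lexx orbT. Qed.

Lemma pos_lip s t : `|pos s - pos t| <= `|s - t|.
Proof.
have key a b : pos a - pos b <= `|a - b|.
  have := ler_norm (a - b); have := normr_ge0 (a - b).
  by rewrite /pos; case: (ltP a 0); case: (ltP b 0); lra.
by rewrite ler_norml lerNl opprB key distrC key.
Qed.

Lemma lipschitz_continuous (f : R -> R) C :
  (forall s t, `|f s - f t| <= C * `|s - t|) -> continuous f.
Proof.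
move=> H t; have C0 : 0 <= C.
  by have := le_trans (normr_ge0 _) (H 1 0); rewrite subr0 normr1 mulr1.
apply/cvgrPdist_lt => e e0; apply/nbhs_ballP.
exists (e / (C + 1)); first by rewrite /= divr_gt0 // ltr_wpDl.
move=> s; rewrite /ball /= ltr_pdivlMr ?ltr_wpDl // => hh.
apply: le_lt_trans (H t s) _.
by have := normr_ge0 (t - s); nra.
Qed.

Lemma pos_continuous : continuous pos.
Proof. by apply: (@lipschitz_continuous _ 1) => s t; rewrite mul1r pos_lip. Qed.

Lemma is_derive_pos2 (t : R) : is_derive t (1 : R) (fun t => pos t ^+ 2) (2 * pos t).
Proof.
apply: (@is_derive_quadratic _ _ _ 1) => h; rewrite mul1r ler_norml /pos.
by case: (ltP (t + h) 0); case: (ltP t 0) => h1 h2; apply/andP; split; nra.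
Qed.

Lemma is_derive_affine (f : R -> R) (a b t d : R) :
  is_derive (a * t + b) (1 : R) f d -> is_derive t (1 : R) (fun s => f (a * s + b)) (a * d).
Proof.
move=> hf; have h1 : is_derive t (1 : R) (a \*: (id : R -> R)) (a *: (1 : R)).
  exact: is_deriveZ.
have h2 := is_deriveD h1 (is_derive_cst b t (1 : R)).
rewrite addr0 /GRing.scale /= mulr1 in h2.
have := @is_derive1_comp R f (fun s => a * s + b) t d a hf h2.
by rewrite /GRing.scale /= mulrC.
Qed.

(* A C^1 step: two parabolic arcs joining 0 (for t <= 0) to 1 (for t >= 1). *)
Definition step (t : R) : R :=
  2 * pos t ^+ 2 - 4 * pos (t - 2^-1) ^+ 2 + 2 * pos (t - 1) ^+ 2.
Definition dstep (t : R) : R :=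
  4 * pos t - 8 * pos (t - 2^-1) + 4 * pos (t - 1).

Lemma is_derive_step (t : R) : is_derive t (1 : R) step (dstep t).
Proof.
have key c : is_derive t (1 : R) (fun s => pos (s - c) ^+ 2) (2 * pos (t - c)).
  have -> : (fun s => pos (s - c) ^+ 2) = fun s => pos (1 * s + - c) ^+ 2.
    by apply/funext => s; rewrite mul1r.
  rewrite -[2 * _]mul1r.
  by apply: (@is_derive_affine (fun s => pos s ^+ 2)); rewrite mul1r; exact: is_derive_pos2.
have k1 := is_deriveZ 2 (is_derive_pos2 t).
have k2 := is_deriveZ (-4) (key 2^-1).
have k3 := is_deriveZ 2 (key 1).
have k4 := is_deriveD (is_deriveD k1 k2) k3.
have -> : step = 2 \*: (fun t => pos t ^+ 2) + (-4) \*: (fun t => pos (t - 2^-1) ^+ 2)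
    + 2 \*: (fun t => pos (t - 1) ^+ 2).
  by apply/funext => s; rewrite !fctE /step /= /GRing.scale /=; ring.
by apply: is_derive_eq k4 _; rewrite /dstep /GRing.scale /=; ring.
Qed.

Lemma step_le0 t : t <= 0 -> step t = 0.
Proof.
move=> t0; rewrite /step /pos !max_r ?expr0n; try lra.
Qed.

Lemma step_ge1 t : 1 <= t -> step t = 1.
Proof.
move=> t0; rewrite /step /pos !max_l; try lra.
Qed.

Lemma step_ge0 t : 0 <= step t.
Proof.
rewrite /step /pos; case: (ltP t 0); case: (ltP (t - 2^-1) 0); case: (ltP (t - 1) 0);
  move=> h1 h2 h3; nra.
Qed.

Lemma step_le1 t : step t <= 1.
Proof.
rewrite /step /pos; case: (ltP t 0); case: (ltP (t - 2^-1) 0); case: (ltP (t - 1) 0);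
  move=> h1 h2 h3; nra.
Qed.

Lemma dstep_ge0 t : 0 <= dstep t.
Proof.
rewrite /dstep /pos; case: (ltP t 0); case: (ltP (t - 2^-1) 0); case: (ltP (t - 1) 0);
  move=> h1 h2 h3; lra.
Qed.

Lemma dstep_le2 t : dstep t <= 2.
Proof.
rewrite /dstep /pos; case: (ltP t 0); case: (ltP (t - 2^-1) 0); case: (ltP (t - 1) 0);
  move=> h1 h2 h3; lra.
Qed.

Lemma dstep_le0 t : t <= 0 -> dstep t = 0.
Proof.
move=> t0; rewrite /dstep /pos !max_r; lra.
Qed.

Lemma dstep_ge1 t : 1 <= t -> dstep t = 0.
Proof.
move=> t0; rewrite /dstep /pos !max_l; lra.
Qed.

Lemma dstep_continuous : continuous dstep.
Proof.
apply: (@lipschitz_continuous _ 16) => s t.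
have h1 := pos_lip s t; have h2 := pos_lip (s - 2^-1) (t - 2^-1).
have h3 := pos_lip (s - 1) (t - 1).
have E (c : R) : s - c - (t - c) = s - t by ring.
rewrite !E in h2 h3.
rewrite !ler_norml in h1 h2 h3 *; rewrite /dstep.
by move/andP: h1 => [? ?]; move/andP: h2 => [? ?]; move/andP: h3 => [? ?]; apply/andP; split; lra.
Qed.

Lemma step_continuous : continuous step.
Proof.
move=> t; apply: differentiable_continuous; apply/derivable1_diffP.
by have [] := is_derive_step t.
Qed.

Lemma cutoff1 (s d : R) : 0 <= s -> 0 < d -> exists phi dphi : R -> R,
  [/\ forall t, is_derive t (1 : R) phi (dphi t), continuous dphi,
      forall t, 0 <= phi t <= 1,
      forall t, `|t| <= s -> phi t = 1 &
      (forall t, s + d <= `|t| -> phi t = 0 /\ dphi t = 0) /\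
      (forall t, `|dphi t| <= 4 / d)].
Proof.
move=> s0 d0.
(* [l] rises from 0 at [- (s + d)] to 1 at [- s], and [k] is its mirror image; the cutoff is the
   product of the two steps. *)
pose l t := d^-1 * t + (s + d) / d; pose k t := - d^-1 * t + (s + d) / d.
have lE t : l t = (t + (s + d)) / d by rewrite /l; ring.
have kE t : k t = (- t + (s + d)) / d by rewrite /k; ring.
have cl : continuous l.
  by move=> t; apply: cvgD; [apply: cvgMr; exact: cvg_id|exact: cvg_cst].
have ck : continuous k.
  by move=> t; apply: cvgD; [apply: cvgMr; exact: cvg_id|exact: cvg_cst].
exists (fun t => step (l t) * step (k t)).
exists (fun t => step (l t) * (- d^-1 * dstep (k t)) + step (k t) * (d^-1 * dstep (l t))).
split.
- move=> t.
  have h1 := is_derive_affine (is_derive_step (l t)).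
  have h2 := is_derive_affine (is_derive_step (k t)).
  exact: is_deriveM.
- have H (f g : R -> R) t : continuous f -> continuous g -> {for t, continuous (fun t => f (g t))}.
    by move=> cf cg; apply: continuous_comp; [exact: cg|exact: cf].
  move=> t; apply: cvgD; apply: cvgM.
  + exact: H step_continuous cl.
  + by apply: cvgMr; exact: H dstep_continuous ck.
  + exact: H step_continuous ck.
  + by apply: cvgMr; exact: H dstep_continuous cl.
- move=> t; rewrite mulr_ge0 ?step_ge0 //=.
  by rewrite mulr_ile1 ?step_ge0 ?step_le1.
- move=> t; rewrite ler_norml => /andP[t1 t2].
  have l1 : 1 <= l t by rewrite lE ler_pdivlMr //; lra.
  have k1 : 1 <= k t by rewrite kE ler_pdivlMr //; lra.
  by rewrite !step_ge1 ?mulr1.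
split=> t.
  move=> tsd; have [t0|t0] := leP 0 t.
    have k0 : k t <= 0.
      by rewrite ger0_norm // in tsd; rewrite kE pmulr_lle0 ?invr_gt0 //; lra.
    by rewrite (step_le0 k0) (dstep_le0 k0) !(mulr0, mul0r, addr0).
  have l0 : l t <= 0.
    by rewrite ltr0_norm // in tsd; rewrite lE pmulr_lle0 ?invr_gt0 //; lra.
  by rewrite (step_le0 l0) (dstep_le0 l0) !(mulr0, mul0r, addr0).
have di : 0 < d^-1 by rewrite invr_gt0.
have := step_ge0 (l t); have := step_le1 (l t); have := dstep_ge0 (l t).
have := dstep_le2 (l t); have := step_ge0 (k t); have := step_le1 (k t).
have := dstep_ge0 (k t); have := dstep_le2 (k t).
move: (step _) (step _) (dstep _) (dstep _) => a b a' b' h1 h2 h3 h4 h5 h6 h7 h8.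
have -> : a * (- d^-1 * b') + b * (d^-1 * a') = (b * a' - a * b') * d^-1 by ring.
by rewrite normrM (gtr0_norm di) ler_pM2r // ler_norml; apply/andP; split; nra.
Qed.

End Cutoff1.

(** * The axial coordinate and the cross-section *)

Section Cylinder.
Variables (R : realType) (d : nat).
Local Notation V := 'rV[R]_d.+1.
Local Notation V' := 'rV[R]_d.
Implicit Types (x : V) (y : V').

Lemma tail_idxE (j : 'I_d) : tail_idx (N := d.+1) j = lift ord0 j.
Proof. exact: val_inj. Qed.

Lemma tailvE x j : tailv x 0 j = x 0 (lift ord0 j).
Proof. by rewrite mxE tail_idxE. Qed.

Lemma cons_rv0 t y : cons_rv t y 0 ord0 = t.
Proof.
have -> : ord0 = lshift d (0 : 'I_1) by exact: val_inj.
by rewrite /cons_rv (@row_mxEl _ 1 1 d) mxE.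
Qed.

Lemma cons_rvS t y j : cons_rv t y 0 (lift ord0 j) = y 0 j.
Proof.
have -> : lift ord0 j = rshift 1 j by exact: val_inj.
by rewrite /cons_rv (@row_mxEr _ 1 1 d).
Qed.

Lemma tailv_cons t y : tailv (cons_rv t y) = y.
Proof. by apply/rowP => j; rewrite tailvE cons_rvS. Qed.

Lemma cons_rv_tailv x : cons_rv (x 0 ord0) (tailv x) = x.
Proof.
have [t [y ->]] := cons_rvK x.
by rewrite cons_rv0 tailv_cons.
Qed.

Lemma tailvD x z : tailv (x + z) = tailv x + tailv z.
Proof. by apply/rowP => j; rewrite !mxE. Qed.

Lemma tailvZ a x : tailv (a *: x) = a *: tailv x.
Proof. by apply/rowP => j; rewrite !mxE. Qed.

Lemma tailvB x z : tailv (x - z) = tailv x - tailv z.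
Proof. by apply/rowP => j; rewrite !mxE. Qed.

Lemma tailv_norm x : `|tailv x| <= `|x|.
Proof.
by rewrite -[in leRHS](cons_rv_tailv x) cons_rv_norm le_max lexx orbT.
Qed.

Lemma norm_tailv_head x : `|x| = Num.max `|x 0 ord0| `|tailv x|.
Proof. by rewrite -[in LHS](cons_rv_tailv x) cons_rv_norm. Qed.

Lemma dotv_cons a y x : dotv (cons_rv a y) x = a * x 0 ord0 + dotv y (tailv x).
Proof.
rewrite /dotv big_ord_recl cons_rv0; congr (_ + _).
by apply: eq_bigr => j _; rewrite cons_rvS tailvE.
Qed.

Lemma gradient_at_tailv (f : V' -> R) x g :
  gradient_at f (tailv x) g -> gradient_at (fun z : V => f (tailv z)) x (cons_rv 0 g).
Proof.
move=> /gradient_atP h; apply/gradient_atP => e e0; have [r r0 H] := h e e0.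
exists r => // k kr; rewrite dotv_cons mul0r add0r tailvD.
apply: le_trans (H _ (le_lt_trans (tailv_norm k) kr)) _.
by rewrite ler_pM2l // tailv_norm.
Qed.

Lemma continuous_at_tailv (T : normedModType R) (f : V' -> T) x :
  {for tailv x, continuous f} -> {for x, continuous (fun z : V => f (tailv z))}.
Proof.
move=> /cvg_ballP cf; apply/cvg_ballP => e e0; have [r r0 h] := cf e e0.
exists r => // z xz; apply: h; rewrite -tailvB.
exact: le_lt_trans (tailv_norm _) xz.
Qed.

Lemma continuous_at_head (T : normedModType R) (f : R -> T) x :
  {for x 0 ord0, continuous f} -> {for x, continuous (fun z : V => f (z 0 ord0))}.
Proof.
move=> /cvgrPdist_lt cf; apply/cvg_ballP => e e0.
have /nbhs_ballP[r /= r0 h] := cf e e0.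
exists r => // z xz; apply: h; rewrite /ball /=.
by have := coord_le_norm (x - z) ord0; rewrite !mxE => /le_lt_trans; apply.
Qed.

Lemma continuous_at_cons0 n (f : 'rV[R]_n -> V') (x : 'rV[R]_n) :
  {for x, continuous f} -> {for x, continuous (fun z => cons_rv 0 (f z))}.
Proof.
move=> /cvg_ballP cf; apply/cvg_ballP => e e0; have [r r0 h] := cf e e0.
exists r => // z xz; rewrite cons_rvB subrr cons_rv_norm gt_max normr0 e0 /=.
exact: h.
Qed.

Lemma continuous_at_consr n (f : 'rV[R]_n -> R) (x : 'rV[R]_n) :
  {for x, continuous f} -> {for x, continuous (fun z => cons_rv (f z) (0 : V'))}.
Proof.
move=> /cvg_ballP cf; apply/cvg_ballP => e e0; have [r r0 h] := cf e e0.
exists r => // z xz; rewrite cons_rvB subrr cons_rv_norm gt_max normr0 e0 andbT.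
exact: h.
Qed.

Lemma open_cylinder (om : set V') : open om -> open (cylinder (N := d.+1) om).
Proof.
move=> /open_normP oo; apply/open_normP => x /oo[r r0 h].
exists r => // z xz; apply: h; rewrite -tailvB.
exact: le_lt_trans (tailv_norm _) xz.
Qed.

Lemma closure_cylinder (om : set V') x :
  closure (cylinder (N := d.+1) om) x <-> closure om (tailv x).
Proof.
split=> /closure_normP h; apply/closure_normP => r r0.
  have [z [oz xz]] := h r r0; exists (tailv z); split => //.
  rewrite -tailvB; exact: le_lt_trans (tailv_norm _) xz.
have [y [oy xy]] := h r r0; exists (cons_rv (x 0 ord0) y); split.
  by rewrite /cylinder /= tailv_cons.
rewrite -[X in X - _](cons_rv_tailv x) cons_rvB subrr cons_rv_norm gt_max.
by rewrite normr0 r0.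
Qed.

Definition box (K : set V') (A : R) : set V := [set x : V | `|x 0 ord0| <= A /\ K (tailv x)].

Lemma compact_box (K : set V') A : compact K -> compact (box K A).
Proof.
move=> /compact_normP[/closed_normP cK [B hB]]; apply/compact_normP; split.
  apply/closed_normP => x h; split.
    rewrite leNgt; apply/negP => Ax.
    have [|z [[zA _] xz]] := h (`|x 0 ord0| - A); first by rewrite subr_gt0.
    have := coord_le_norm (x - z) ord0; rewrite !mxE => h2.
    have := lerB_dist (x 0 ord0) (z 0 ord0); lra.
  apply: cK => r r0; have [z [[_ Kz] xz]] := h r r0; exists (tailv z); split => //.
  by rewrite -tailvB; exact: le_lt_trans (tailv_norm _) xz.
exists (Num.max A B) => x [x1 /hB x2].
by rewrite norm_tailv_head ge_max !le_max x1 x2 orbT.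
Qed.

Lemma dotv_cons_tailv x g : dotv x (cons_rv 0 g) = dotv (tailv x) g.
Proof. by rewrite dotvC dotv_cons mul0r add0r dotvC. Qed.

Lemma dotv_consr x (c : R) : dotv x (cons_rv c 0) = c * x 0 ord0.
Proof. by rewrite dotvC dotv_cons dotv0l addr0. Qed.

Lemma gradient_at_head (phi : R -> R) x c : is_derive (x 0 ord0) (1 : R) phi c ->
  gradient_at (fun z : V => phi (z 0 ord0)) x (cons_rv c 0).
Proof.
move=> h; have := gradient_at_comp h (gradient_at_coord ord0 x).
have -> // : c *: evec R ord0 = cons_rv c 0 :> V.
apply/rowP => j; rewrite [LHS]mxE [X in _ * X]mxE eqxx /=.
case: (unliftP ord0 j) => [k ->|->]; first by rewrite cons_rvS mxE mulr0.
by rewrite cons_rv0 mulr1.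
Qed.

End Cylinder.

(** * Charts and cutoffs near the boundary *)

Section Charts.
Variables (R : realType) (d : nat).
Local Notation V := 'rV[R]_d.+1.
Local Notation V' := 'rV[R]_d.
Implicit Types (x : V) (y z e : V') (om : set V') (rho : V' -> R) (r m G : R).

(** The slip condition in terms of the cross-section: [grad rho] is a positive multiple of the
    outward normal there, and the normal of the cylinder has no axial component. *)
Definition tangential om (w : V -> V) : Prop :=
  forall x r rho, (closure om `\` om) (tailv x) -> local_defining om (tailv x) r rho ->
  dotv (tailv (w x)) (grad rho (tailv x)) = 0.

(** Instead of straightening the boundary, a chart keeps a fixed transversal direction [e], along
    which [rho] grows at rate at least [m] everywhere in the chart. Moving along [e] thus leads out
    of [om], and along [- e] into it. *)
Definition chart om z r rho e m G : Prop :=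
  [/\ 0 < r, 0 < m, C1_on (ball z r) rho, `|e| <= 1 &
   forall y, `|z - y| < r ->
     [/\ om y <-> rho y < 0, m <= dotv (grad rho y) e & `|grad rho y| <= G]].

Lemma chart_exists om z : C1_open om -> (closure om `\` om) z ->
  exists r rho e m G, chart om z r rho e m G.
Proof.
move=> [_ H] /H[r0 [rho [r00 [C1 [g0 hom]]]]].
have zz : ball z r0 z by exact: ballxx.
have [i gi] : exists i, grad rho z 0 i != 0.
  apply: contrapT => /forallNP hn; move/eqP: g0; apply.
  by apply/rowP => i; rewrite mxE [RHS]mxE; apply/eqP; have /negP := hn i; rewrite negbK mxE.
pose e := Num.sg (grad rho z 0 i) *: evec R i.
have ge : dotv (grad rho z) e = `|grad rho z 0 i| by rewrite dotvZr dotv_evecr normrEsg.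
have m0 : 0 < `|grad rho z 0 i| / 2 by rewrite divr_gt0 // normr_gt0.
have cg := C1_on_grad_continuous C1 zz.
have /cvg_ballP/(_ _ m0)[r1 r10 h1] : {for z, continuous (fun y => dotv (grad rho y) e)}.
  by apply: (@continuous_at_dotv _ _ _ (grad rho) (fun=> e)); [exact: cg|exact: cst_continuous].
have /cvg_ballP/(_ _ ltr01)[r2 r20 h2] := cg.
exists (Num.min r0 (Num.min r1 r2)), rho, e, (`|grad rho z 0 i| / 2), (`|grad rho z| + 1).
split => //.
- by rewrite !lt_min r00 r10.
- move=> y /ball_normP; rewrite !lt_min => /andP[yr _].
  by apply: C1; exact/ball_normP.
- rewrite normrZ normr_sg gi mul1r; apply: norm_le_coord => // j.
  by rewrite !mxE eqxx /=; case: eqP; rewrite ?normr1 ?normr0.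
- move=> y; rewrite !lt_min => /and3P[y0 y1 y2]; split.
  + by apply: hom; exact/ball_normP.
  + have := h1 y y1; rewrite ge ltr_norml => /andP[_]; lra.
  + have := h2 y y2; have := lerB_dist (grad rho y) (grad rho z).
    by rewrite distrC; lra.
Qed.

(** The same [rho] defines [om] near every boundary point of the chart, so tangency can be used at
    points other than the centre [z]. *)
Lemma chart_local_defining om z r rho e m G z' : chart om z r rho e m G ->
  `|z - z'| < r -> local_defining om z' (r - `|z - z'|) rho.
Proof.
move=> [r0 m0 C1 e1 H] zz.
have sub y : ball z' (r - `|z - z'|) y -> `|z - y| < r.
  move=> /ball_normP h; have -> : z - y = (z - z') + (z' - y) by rewrite addrA subrK.
  by apply: le_lt_trans (ler_normD _ _) _; lra.
split; first by rewrite subr_gt0.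
split; first by move=> y /sub yr; apply: C1; exact/ball_normP.
split; last by move=> y /sub yr; have [] := H y yr.
have [_ h _] := H z' zz; apply/eqP => g0.
by rewrite g0 dotv0l in h; lra.
Qed.

Lemma chart_gradient om z r rho e m G y : chart om z r rho e m G -> `|z - y| < r ->
  gradient_at rho y (grad rho y).
Proof. by move=> [_ _ C1 _ _] /ball_normP zy; exact: C1_on_gradient C1 zy. Qed.

Lemma chart_continuous om z r rho e m G y : chart om z r rho e m G -> `|z - y| < r ->
  {for y, continuous rho}.
Proof. by move=> ch zy; exact: gradient_at_continuous (chart_gradient ch zy). Qed.

Lemma norm_segment y z e s t r : `|e| <= 1 -> 0 <= s <= t -> `|z - y| + t < r ->
  `|z - (y + s *: e)| < r.
Proof.
move=> e1 /andP[s0 st] h; rewrite opprD addrA.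
apply: le_lt_trans (ler_normB _ _) _; rewrite normrZ ger0_norm //.
have := normr_ge0 e; nra.
Qed.

Lemma chart_line om z r rho e m G y t : chart om z r rho e m G -> 0 <= t ->
  `|z - y| + t < r -> rho y + m * t <= rho (y + t *: e).
Proof.
move=> ch t0 h; have [_ _ _ e1 H] := ch.
have [s st E] := @mean_value _ _ rho y e (grad rho) t t0
  (fun s st => chart_gradient ch (norm_segment e1 st h)).
have [_ h2 _] := H _ (norm_segment e1 st h).
have : t * m <= t * dotv (grad rho (y + s *: e)) e by rewrite ler_wpM2l.
rewrite -E; lra.
Qed.

Lemma norm_continuous_dist y z : {for y, continuous (fun u : V' => `|z - u|)}.
Proof.
apply/cvg_ballP => eps e0; exists eps => // u yu.
apply: le_lt_trans (ler_dist_dist _ _) _.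
by rewrite opprB addrC addrA subrK distrC.
Qed.

Lemma head_cutoff (A : R) : 0 <= A -> exists X : R -> R,
  [/\ continuous X, forall t, 0 <= X t <= 1, forall t, `|t| <= A -> X t = 1 &
      forall t, A + 1 <= `|t| -> X t = 0].
Proof.
move=> A0; have [X [dX [dXX _ h1 h2 [h3 _]]]] := cutoff1 A0 (@ltr01 R).
exists X; split => //; last by move=> t /h3[].
by move=> t; apply: differentiable_continuous; apply/derivable1_diffP; have [] := dXX t.
Qed.

Lemma sum_at_most_one n (F : 'I_n -> R) (B : R) : 0 <= B ->
  (forall i, F i <= B) -> (forall i j, i != j -> F i = 0 \/ F j = 0) ->
  \sum_(i < n) F i <= B.
Proof.
move=> B0 FB H; have [[i Fi]|/forallNP hn] := pselect (exists i, F i != 0).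
  rewrite (bigD1 i) //= big1 ?addr0 // => j ji.
  by have [//|F0] := H j i ji; rewrite F0 eqxx in Fi.
rewrite big1 // => i _; apply/eqP; have /negP := hn i; by rewrite negbK.
Qed.

Lemma iint_sum n k (F : 'I_n -> 'rV[R]_k -> R) :
  (forall i, compactly_supported (F i)) ->
  compactly_supported (fun u => \sum_(i < n) F i u) /\
  iint (fun u => \sum_(i < n) F i u) = \sum_(i < n) iint (F i).
Proof.
move=> cF; elim: (index_enum 'I_n) => [|i s [IH1 IH2]].
  under eq_fun do rewrite big_nil; rewrite big_nil.
  by split; [exact: compactly_supported0|exact: iint0].
under eq_fun do rewrite big_cons; rewrite big_cons.
by split; [exact: compactly_supportedD|rewrite iintD // IH2].
Qed.

(* The translates of a layer of width O(eps) by multiples of O(eps) e are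
   disjoint, and about 1/eps of them fit into a fixed box. *)
Lemma chart_layer om z r rho e m G (A : R) : chart om z r rho e m G -> 0 <= A ->
  exists2 C : R, 0 < C & forall eps : R, 0 < eps -> exists F : V -> R,
    [/\ compactly_supported F, forall x, 0 <= F x, iint F <= C * eps &
     forall x, `|x 0 ord0| <= A -> `|z - tailv x| <= r / 2 ->
       `|rho (tailv x)| <= 2 * eps -> 1 <= F x].
Proof.
move=> ch A0; have [r0 m0 _ e1 _] := ch.
have [X [cX X01 X1 X0]] := head_cutoff A0.
pose Xi x := step (r + 1 - `|z - tailv x|) * X (x 0 ord0).
have cbox (B : R) : compact (box [set y : V' | `|z - y| <= B] (A + 1)).
  by apply: compact_box; exact: compact_dist_le.
have cstep (B : R) x : {for x, continuous (fun x : V => step (B - `|z - tailv x|))}.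
  apply: (@continuous_at_tailv _ _ _ (fun y => step (B - `|z - y|))).
  apply: (@continuous_comp _ _ _ (fun y : V' => B - `|z - y|) (@step R)); last exact: step_continuous.
  by apply: continuousB; [exact: cst_continuous|exact: norm_continuous_dist].
have cXh x : {for x, continuous (fun x : V => X (x 0 ord0))}.
  by apply: continuous_at_head; exact: cX.
have Xi_cs : compactly_supported Xi.
  apply: (compactly_supported_ext0 (cbox (r + 1)) (@subsetT _ _)) => [x nK|x _].
    rewrite /Xi; have [xA|xA] := leP (A + 1) `|x 0 ord0|; first by rewrite X0 // mulr0.
    rewrite step_le0 ?mul0r // leNgt; apply/negP => h; apply: nK.
    by split => /=; lra.
  by apply: continuousM; [exact: cstep|exact: cXh].
have Xi0 x : 0 <= Xi x by rewrite mulr_ge0 ?step_ge0 //; have /andP[] := X01 (x 0 ord0).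
pose C1 := iint Xi + 1.
have C10 : 0 < C1 by rewrite ltr_wpDl // iint_ge0.
exists (24 / (m * r) * C1); first by rewrite mulr_gt0 // divr_gt0 // mulr_gt0.
move=> eps eps0.
(* Equal to 1 where [y] is within [r / 2] of [z] and [|rho y| <= 2 * eps]; zero beyond distance
   [3 / 4 * r] or where [|rho y| >= 3 * eps]. *)
pose Lam y := step ((3 / 4 * r - `|z - y|) * (4 / r)) * step (3 - eps^-1 * `|rho y|).
pose F x := Lam (tailv x) * X (x 0 ord0).
have near_z y : Lam y != 0 -> `|z - y| < 3 / 4 * r.
  rewrite /Lam; apply: contraR; rewrite -leNgt => h; rewrite step_le0 ?mul0r //.
  by rewrite pmulr_lle0 ?divr_gt0 //; lra.
have near_rho y : Lam y != 0 -> `|rho y| < 3 * eps.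
  rewrite /Lam; apply: contraR; rewrite -leNgt => h; rewrite [X in _ * X]step_le0 ?mulr0 //.
  by rewrite subr_le0 mulrC ler_pdivlMr.
have Lam0 y : 0 <= Lam y by rewrite mulr_ge0 ?step_ge0.
have Lam1 y : Lam y <= 1 by rewrite mulr_ile1 ?step_ge0 ?step_le1.
have F0 x : 0 <= F x by rewrite mulr_ge0 //; have /andP[] := X01 (x 0 ord0).
have F_cs : compactly_supported F.
  apply: (@compactly_supported_ext0 _ _ [set x : V | `|z - tailv x| < r] _ _ (cbox (3 / 4 * r))).
  - move=> x [_ /= h]; lra.
  - move=> x nK; rewrite /F; have [xA|xA] := leP (A + 1) `|x 0 ord0|; first by rewrite X0 // mulr0.
    have [->|/near_z h] := eqVneq (Lam (tailv x)) 0; first by rewrite mul0r.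
    by exfalso; apply: nK; split => /=; lra.
  - move=> x /= xr; apply: continuousM; last exact: cXh.
    apply: continuous_at_tailv; apply: continuousM.
      apply: (@continuous_comp _ _ _ (fun y : V' => (3 / 4 * r - `|z - y|) * (4 / r)) (@step R)); last exact: step_continuous.
      apply: continuousM; last exact: cst_continuous.
      by apply: continuousB; [exact: cst_continuous|exact: norm_continuous_dist].
    apply: (@continuous_comp _ _ _ (fun y : V' => 3 - eps^-1 * `|rho y|) (@step R)); last exact: step_continuous.
    apply: continuousB; first exact: cst_continuous.
    apply: continuousM; first exact: cst_continuous.
    apply: (@continuous_comp _ _ _ rho (fun t : R => `|t|)); first exact: chart_continuous ch xr.
    exact: norm_continuous.
exists F; split => //; last first.
  move=> x xA xz xrho; rewrite /F /Lam X1 // !step_ge1 ?mulr1 //.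
    have : eps^-1 * `|rho (tailv x)| <= 2 by rewrite mulrC ler_pdivrMr // mulrC; lra.
    lra.
  by rewrite mulrA ler_pdivlMr //; lra.
(* A translation by [tau] along [e] raises [rho] by at least [6 * eps], the full width of the
   support of [Lam] in the variable [rho]. *)
pose tau := 6 * eps / m.
have tau0 : 0 < tau by rewrite divr_gt0 // mulr_gt0.
(* More than [r / (4 * tau)] translates, whose displacements all remain at most [r / 4]. *)
pose J := (Num.truncn (r / (4 * tau))).+1.
have JB : r / (4 * tau) < J%:R by exact: truncnS_gt.
have Jj (j : 'I_J) : j%:R * tau <= r / 4.
  have h0 : 0 <= r / (4 * tau) by rewrite ltW // divr_gt0 // mulr_gt0.
  have : j%:R <= r / (4 * tau).
    by have := ltn_ord j; rewrite /J ltnS truncn_ge_nat.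
  have t4 : 0 < 4 * tau by rewrite mulr_gt0.
  by rewrite (ler_pdivlMr _ _ t4); lra.
(* The translates live within [3 / 4 * r + r / 4 = r] of [z], where the first factor of [Xi] is 1.
   Having at most one nonzero term at each point, their sum is at most [Xi], so [J] copies of
   [iint F] fit under a fixed integral. *)
pose Fj (j : 'I_J) x := F (x + - (j%:R * tau) *: cons_rv 0 e).
have Fj_cs j : compactly_supported (Fj j) by exact: compactly_supported_shift.
have [cS ES] := iint_sum Fj_cs.
have tj (j : 'I_J) x : tailv (x + - (j%:R * tau) *: cons_rv 0 e) = tailv x - (j%:R * tau) *: e.
  by rewrite tailvD tailvZ tailv_cons scaleNr.
have hj (j : 'I_J) x : (x + - (j%:R * tau) *: cons_rv 0 e) 0 ord0 = x 0 ord0.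
  by rewrite mxE [X in _ + X]mxE cons_rv0 mulr0 addr0.
have sumF : iint (fun x => \sum_(j < J) Fj j x) <= iint Xi.
  apply: iint_le => // x; apply: sum_at_most_one => // [j|j k jk].
    rewrite /Fj /F tj hj; have [->|Lj] := eqVneq (Lam (tailv x - (j%:R * tau) *: e)) 0.
      by rewrite mul0r.
    rewrite ler_wpM2r //; first by have /andP[] := X01 (x 0 ord0).
    apply: le_trans (Lam1 _) _; rewrite step_ge1 //.
    have := near_z _ Lj; rewrite opprB addrA => h.
    have h2 : `|z - tailv x| <= `|z + (j%:R * tau) *: e - tailv x| + `|(j%:R * tau) *: e|.
      have -> : z - tailv x = z + (j%:R * tau) *: e - tailv x - (j%:R * tau) *: e.
        by rewrite -!addrA [- tailv x - _]addrC addrA addrA addrK.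
      apply: le_trans (ler_normB _ _) _; lra.
    have h3 : `|(j%:R * tau) *: e| <= r / 4.
      rewrite normrZ ger0_norm; last by rewrite mulr_ge0 // ltW.
      have h4 := Jj j; have := normr_ge0 e.
      have : 0 <= j%:R * tau by rewrite mulr_ge0 // ltW.
      nra.
    lra.
  wlog jk' : j k jk / (j < k)%N => [hw|].
    have [lt|lt|/val_inj E] := ltngtP j k; first exact: hw.
      by rewrite eq_sym in jk; have [] := hw k j jk lt; [right|left].
    by rewrite E eqxx in jk.
  rewrite /Fj /F !tj !hj.
  have [->|Lj] := eqVneq (Lam (tailv x - (j%:R * tau) *: e)) 0; first by rewrite mul0r; left.
  have [->|Lk] := eqVneq (Lam (tailv x - (k%:R * tau) *: e)) 0; first by rewrite mul0r; right.
  exfalso; pose yk := tailv x - (k%:R * tau) *: e.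
  pose t := (k%:R - j%:R) * tau.
  have Ej : tailv x - (j%:R * tau) *: e = yk + t *: e.
    by rewrite /yk /t mulrBl scalerBl addrA subrK.
  have kj1 : 1 <= k%:R - j%:R :> R.
    by rewrite lerBrDl natr1 ler_nat.
  have t1 : tau <= t by rewrite /t ler_peMl // ltW.
  have t2 : t <= r / 4.
    by apply: le_trans (Jj k); apply: ler_wpM2r; [exact: ltW|rewrite gerBl].
  have L := chart_line ch (le_trans (ltW tau0) t1) (_ : `|z - yk| + t < r).
  have {}L : rho yk + m * t <= rho (yk + t *: e).
    by apply: L; have := near_z _ Lk; rewrite -/yk; lra.
  have := near_rho _ Lk; rewrite -/yk ltr_norml => /andP[k1 k2].
  have := near_rho _ Lj; rewrite Ej ltr_norml => /andP[j1 j2].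
  have : m * tau <= m * t by rewrite ler_pM2l.
  rewrite /tau [m * _]mulrC divfK ?gt_eqF //; lra.
rewrite ES in sumF.
have EF (j : 'I_J) : iint (Fj j) = iint F by exact: iint_shift.
have {}sumF : J%:R * iint F <= iint Xi.
  apply: le_trans sumF; rewrite (eq_bigr (fun=> iint F)) // sumr_const card_ord.
  by rewrite mulr_natl.
have IF0 : 0 <= iint F by exact: iint_ge0.
have : r / (4 * tau) * iint F <= C1.
  apply: (@le_trans _ _ (J%:R * iint F)); first by rewrite ler_wpM2r // ltW.
  by rewrite /C1; lra.
move=> h; have c0 : 0 <= 4 * tau / r by rewrite ltW // divr_gt0 // mulr_gt0.
have -> : iint F = 4 * tau / r * (r / (4 * tau) * iint F).
  by field; rewrite !gt_eqF.
apply: le_trans (ler_wpM2l c0 h) _.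
rewrite le_eqVlt; apply/orP; left; apply/eqP; rewrite /tau; field.
by rewrite !gt_eqF.
Qed.

End Charts.

(** * The normal component of the field near the boundary *)

Section CutoffCylinder.
Variables (R : realType) (d : nat).
Local Notation V := 'rV[R]_d.+1.
Local Notation V' := 'rV[R]_d.
Implicit Types (x : V) (y z e : V') (rho : V' -> R) (r m G : R).
Variables (om : set V') (w : V -> V).
Hypothesis om_cpt : compact (closure om).
Hypothesis om_open : open om.
Hypothesis wtan : tangential om w.
Hypothesis wcont : {within closure (cylinder (N := d.+1) om), continuous w}.

Lemma cyl_within_box A : {within box (closure om) A, continuous w}.
Proof.
apply: continuous_subspaceW wcont => x [_ h].
by apply/closure_cylinder.
Qed.

(** A point with [rho >= - eps] reaches the boundary after a displacement of at most [T = eps / m]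
    along [e]. There the normal component is exactly 0, and [w] and [grad rho] have varied little by
    uniform continuity. Only continuity of [w] up to the boundary enters. *)
Lemma chart_tangential z r rho e m G (A eta : R) : chart om z r rho e m G -> 0 <= A -> 0 < eta ->
  exists2 eps : R, 0 < eps & forall x, `|x 0 ord0| <= A -> om (tailv x) ->
    `|z - tailv x| <= r / 2 -> - eps <= rho (tailv x) ->
    `|dotv (tailv (w x)) (grad rho (tailv x))| <= eta.
Proof.
move=> ch A0 eta0; have [r0 m0 C1 e1 H] := ch.
have cK := compact_box (A := A) om_cpt.
have [B B0 hB] := compact_fun_bounded cK (@cyl_within_box A).
pose C := d%:R ^+ 2 * (`|G| + B) + 1.
have C0 : 0 < C by rewrite ltr_wpDl // mulr_ge0 ?exprn_ge0 // addr_ge0 // ltW.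
have [d1 d10 h1] := compact_unif_cont cK (@cyl_within_box A) (divr_gt0 eta0 C0).
have cg : {within [set y | `|z - y| <= 3 / 4 * r], continuous (grad rho)}.
  apply/within_normP => y /= yr eps eps0.
  have yr' : `|z - y| < r by lra.
  have /cvg_ballP/(_ eps eps0)[dl dl0 h] := C1_on_grad_continuous C1 (iffRL (ball_normP _ _ _) yr').
  by exists dl => // u _; exact: h.
have [d2 d20 h2] := compact_unif_cont (@compact_dist_le R d z (3 / 4 * r)) cg (divr_gt0 eta0 C0).
pose T := Num.min (r / 8) (Num.min (d1 / 2) (d2 / 2)).
have T0 : 0 < T by rewrite !lt_min !divr_gt0.
have [Tr T1 T2] : [/\ T <= r / 8, T <= d1 / 2 & T <= d2 / 2].
  by rewrite /T; split; rewrite !ge_min lexx ?orbT.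
exists (m * T); first by rewrite mulr_gt0.
move=> x xA ox xz rx; set y := tailv x in ox xz rx *.
have seg s : 0 <= s <= T -> `|z - (y + s *: e)| < r.
  by move=> sT; apply: (norm_segment e1 sT); lra.
have rl s t : 0 <= s -> s <= t -> t <= T -> rho (y + s *: e) + m * (t - s) <= rho (y + t *: e).
  move=> s0 st tT; have -> : y + t *: e = (y + s *: e) + (t - s) *: e.
    by rewrite -addrA -scalerDl [s + _]addrC subrK.
  apply: (chart_line ch); first by rewrite subr_ge0.
  have : `|z - (y + s *: e)| <= `|z - y| + s.
    rewrite opprD addrA; apply: le_trans (ler_normB _ _) _.
    rewrite normrZ ger0_norm //; have := normr_ge0 e; nra.
  lra.
have cr : {within `[0, T], continuous (fun s => rho (y + s *: e))}.
  apply: derivable_within_continuous => s; rewrite in_itv /= => sT.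
  by have [] := gradient_at_line (chart_gradient ch (seg s sT)).
have yr : `|z - y| < r by lra.
have ry : rho y < 0.
  have [hy _ _] := H y yr; exact/hy.
have rT : 0 <= rho (y + T *: e).
  have := rl 0 T (lexx _) (ltW T0) (lexx _).
  rewrite scale0r addr0 subr0; lra.
(* The point where the segment meets [rho = 0]. Since [rho] increases strictly along [e], points
   just before it lie in [om], so it belongs to the closure of [om] but not to [om]. *)
have [|t tT rt] := @IVT R (fun s => rho (y + s *: e)) 0 T 0 (ltW T0) cr.
  by rewrite scale0r addr0 ge_min le_max (ltW ry) rT orbT.
rewrite in_itv /= in tT; have /andP[t0 tT'] := tT.
have {}t0 : 0 < t.
  rewrite lt_neqAle t0 andbT; apply/eqP => E; move: rt ry.
  by rewrite -E scale0r addr0 => ->; rewrite ltxx.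
pose x' := x + t *: cons_rv 0 e.
have tx' : tailv x' = y + t *: e by rewrite /x' tailvD tailvZ tailv_cons.
have hx' : x' 0 ord0 = x 0 ord0.
  by rewrite /x' mxE [X in _ + X]mxE cons_rv0 mulr0 addr0.
have ncl : closure om (tailv x').
  apply/closure_normP => dl dl0; pose s := t - Num.min t (dl / 2).
  have mm : Num.min t (dl / 2) <= t by rewrite ge_min lexx.
  have mm2 : Num.min t (dl / 2) <= dl / 2 by rewrite ge_min lexx orbT.
  have mm0 : 0 < Num.min t (dl / 2) by rewrite lt_min t0 divr_gt0.
  exists (y + s *: e); split.
    have sT : 0 <= s <= T by rewrite /s; apply/andP; split; lra.
    have [h _ _] := H _ (seg s sT); apply/h.
    have := rl s t; rewrite rt; have : 0 < m * (t - s) by rewrite mulr_gt0 // /s; lra.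
    by rewrite /s => q /(_ _ _ _) q2; have := q2 ltac:(lra) ltac:(lra) tT'; lra.
  rewrite tx' opprD addrACA subrr add0r -scalerBl normrZ /s opprB addrC subrK.
  rewrite gtr0_norm //; have := normr_ge0 e; nra.
have nom : ~ om (tailv x').
  rewrite tx' => o; have [h _ _] := H _ (seg t tT); have := iffLR h o.
  by rewrite rt ltxx.
have f0 : dotv (tailv (w x')) (grad rho (tailv x')) = 0.
  apply: (wtan _ (chart_local_defining ch _)); first by split.
  by rewrite tx'; exact: seg.
have Kx : box (closure om) A x by split => //; exact: subset_closure.
have Kx' : box (closure om) A x' by split; rewrite ?hx'.
have dx : `|x - x'| <= T.
  rewrite /x' opprD addrA subrr sub0r normrN normrZ gtr0_norm // cons_rv_norm normr0.
  rewrite max_r //; have := normr_ge0 e; nra.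
have dw : `|tailv (w x - w x')| <= eta / C.
  apply: le_trans (tailv_norm _) _; apply/ltW/h1 => //; lra.
have dy : `|y - tailv x'| <= T by rewrite -tailvB; exact: le_trans (tailv_norm _) dx.
have dg : `|grad rho y - grad rho (tailv x')| <= eta / C.
  apply/ltW/h2; rewrite /=; [lra| |lra].
  have := ler_normD (z - y) (y - tailv x'); rewrite addrA subrK; lra.
have -> : dotv (tailv (w x)) (grad rho y) =
   dotv (tailv (w x - w x')) (grad rho y) +
   dotv (tailv (w x')) (grad rho y - grad rho (tailv x')).
  by rewrite tailvB dotvDl dotvNl dotvDr dotvNr f0 oppr0 addr0 subrK.
apply: le_trans (ler_normD _ _) _.
have [_ _ Gy] := H y yr.
have i1 : `|dotv (tailv (w x - w x')) (grad rho y)| <= d%:R ^+ 2 * (eta / C) * `|G|.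
  apply: le_trans (dotv_le_norm _ _) _; apply: ler_pM => //.
  - by rewrite ler_wpM2l // exprn_ge0.
  - exact: le_trans (ler_norm _).
have i2 : `|dotv (tailv (w x')) (grad rho y - grad rho (tailv x'))| <= d%:R ^+ 2 * B * (eta / C).
  apply: le_trans (dotv_le_norm _ _) _; apply: ler_pM => //.
  by rewrite ler_wpM2l ?exprn_ge0 //; apply: le_trans (tailv_norm _) (hB _ Kx').
have : d%:R ^+ 2 * (eta / C) * `|G| + d%:R ^+ 2 * B * (eta / C) = (C - 1) * (eta / C).
  by rewrite /C; ring.
have : (C - 1) * (eta / C) <= eta.
  rewrite mulrBl mul1r mulrC divfK ?gt_eqF //.
  have := divr_gt0 eta0 C0; lra.
lra.
Qed.

End CutoffCylinder.

(** * Cutoffs vanishing near a piece of the boundary *)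

Section Cut.
Variables (R : realType) (d : nat).
Local Notation V := 'rV[R]_d.+1.
Local Notation V' := 'rV[R]_d.
Implicit Types (x : V) (y z e : V') (rho : V' -> R) (r m G : R).

Lemma ler_sqr_nneg (a b : R) : 0 <= a -> a <= b -> a ^+ 2 <= b ^+ 2.
Proof. by move=> a0 ab; nra. Qed.

Lemma gradient_at_sqdist z y :
  gradient_at (fun u : V' => dotv (u - z) (u - z)) y (2 *: (y - z)).
Proof.
apply/gradient_atP => e e0; set C := d%:R ^+ 2 + 1 : R.
have C0 : 0 < C by rewrite ltr_wpDl // exprn_ge0.
exists (e / C); first by rewrite divr_gt0.
move=> h hd; have -> : y + h - z = (y - z) + h by rewrite addrAC.
move: (y - z) => a; rewrite dotvZl dotvDl !dotvDr (dotvC h a).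
have -> : forall a b c : R, a + b + (b + c) - a - 2 * b = c by move=> *; ring.
apply: le_trans (dotv_le_norm _ _) _; apply: ler_wpM2r => //.
rewrite ltr_pdivlMr // in hd; apply: le_trans (ltW hd).
by rewrite mulrC ler_wpM2l // lerDl.
Qed.

Lemma continuous_at_scale n k (a : 'rV[R]_n -> R) (b : 'rV[R]_n -> 'rV[R]_k) u :
  {for u, continuous a} -> {for u, continuous b} ->
  {for u, continuous (fun v => a v *: b v)}.
Proof.
move=> ca cb; apply: continuous_at_row => i.
apply: (@continuous_at_ext _ _ (fun v => a v * b v 0 i)) => [v|]; first by rewrite mxE.
by apply: continuousM; [exact: ca|exact: continuous_at_coord cb].
Qed.

Lemma continuous_at_compR n (f : 'rV[R]_n -> R) (phi : R -> R) u :
  {for u, continuous f} -> continuous phi -> {for u, continuous (fun v => phi (f v))}.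
Proof.
by move=> cf cp; apply: (@continuous_comp _ _ _ f phi); [exact: cf|exact: cp].
Qed.

Lemma gradient_at_unique n (f : 'rV[R]_n -> R) u g1 g2 :
  gradient_at f u g1 -> gradient_at f u g2 -> g1 = g2.
Proof. by move=> /gradient_atE <- /gradient_atE <-. Qed.

Variables (om : set V') (w : V -> V).
Hypothesis om_cpt : compact (closure om).
Hypothesis om_open : open om.
Hypothesis wtan : tangential om w.
Hypothesis wcont : {within closure (cylinder (N := d.+1) om), continuous w}.

(* A cutoff vanishing near the boundary points of B whose derivative along w is
   small in L^1: this is where tangency of w to the boundary enters. *)
Definition cuttable (A : R) (B : set V') : Prop := forall eta : R, 0 < eta ->
  exists (g : V' -> R) (gg : V' -> V') (F : V -> R),
  [/\ forall y, om y -> [/\ gradient_at g y (gg y), {for y, continuous gg} & 0 <= g y <= 1],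
      forall z, (closure om `\` om) z -> B z ->
        exists2 dl : R, 0 < dl & forall y, om y -> `|z - y| < dl -> g y = 0,
      compactly_supported F /\ (forall x, 0 <= F x), iint F <= eta &
      forall x, `|x 0 ord0| <= A -> om (tailv x) ->
        1 - g (tailv x) <= F x /\ `|dotv (tailv (w x)) (gg (tailv x))| <= F x].

(** The cutoff is [1 - k], with [k] the product of a radial bump at [z] and [1 - u], where [u]
    descends from 1 to 0 across the layer of width [eps]. Its derivative along [w] is at most
    [2 * om_ / eps] from the descent, the normal component being at most [om_], plus a constant from
    the bump; a layer of volume O(eps) makes both small. The radius [r / (4 * d.+1%:R)] puts the
    sup-norm ball inside the Euclidean ball of radius [r / 4] on which the bump is 1. *)
Lemma chart_cut z r rho e m G (A : R) : chart om z r rho e m G -> 0 <= A ->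
  cuttable A [set z' | `|z - z'| < r / (4 * d.+1%:R)].
Proof.
move=> ch A0 eta eta0; have [r0 m0 C1 e1 H] := ch.
have cK := compact_box (A := A) om_cpt.
have [Bw Bw0 hBw] := compact_fun_bounded cK (@cyl_within_box R d om w wcont A).
have [C C0 layer] := chart_layer ch A0.
have s0 : 0 <= (r / 4) ^+ 2 by rewrite sqr_ge0.
(* The radial bump is a function of the squared distance, so its transition has length (r/2)^2 -
   (r/4)^2 = 3 r^2 / 16. *)
have dd0 : 0 < 3 * r ^+ 2 / 16 by rewrite divr_gt0 // mulr_gt0 // exprn_gt0.
have [phi [dphi [phid cdphi phi01 phi1 [phi0 dphib]]]] := cutoff1 s0 dd0.
have sd : (r / 4) ^+ 2 + 3 * r ^+ 2 / 16 = (r / 2) ^+ 2 by field.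
rewrite {}sd in phi0.
pose q y := dotv (y - z) (y - z).
have q0 y : 0 <= q y by exact: dotv_ge0.
pose eta_ y := phi (q y); pose geta y := dphi (q y) *: (2 *: (y - z)).
have ge y : gradient_at eta_ y (geta y).
  exact: (gradient_at_comp (phid _) (gradient_at_sqdist z y)).
have cq y : {for y, continuous q} by exact: gradient_at_continuous (gradient_at_sqdist z y).
have cge y : {for y, continuous geta}.
  apply: continuous_at_scale; first exact: continuous_at_compR.
  apply: continuous_at_scale; first exact: cst_continuous.
  by apply: continuousB; [exact: cvg_id|exact: cst_continuous].
have far y : r / 2 <= `|z - y| -> eta_ y = 0 /\ geta y = 0.
  move=> h; have [|h1 h2] := phi0 (q y).
    rewrite ger0_norm // -[q y]enorm_sq; apply: ler_sqr_nneg; first by lra.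
    by apply: le_trans h _; rewrite distrC; exact: norm_le_enorm.
  by rewrite /eta_ /geta h1 h2 scale0r.
have geb y : `|geta y| <= 4 / (3 * r ^+ 2 / 16) * (2 * (r / 2)).
  have [h|h] := leP (r / 2) `|z - y|.
    have [_ ->] := far y h; rewrite normr0 mulr_ge0 ?mulr_ge0 ?divr_ge0 //; try exact: ltW.
    by rewrite invr_ge0 mulr_ge0 ?invr_ge0 // mulr_ge0 // exprn_ge0 // ltW.
  rewrite normrZ; apply: ler_pM => //.
  by rewrite normrZ ger0_norm // ler_wpM2l // distrC ltW.
pose B2 := d%:R ^+ 2 * Bw * (4 / (3 * r ^+ 2 / 16) * (2 * (r / 2))).
have B20 : 0 <= B2.
  rewrite /B2; apply: mulr_ge0; first by rewrite mulr_ge0 ?exprn_ge0 // ltW.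
  exact: le_trans (normr_ge0 _) (geb z).
(* Tolerance for the normal component: the descent contributes [2 * om_ / eps] times the volume
   [C * eps], which is [eta / 2]. *)
pose om_ := eta / (4 * C).
have om0 : 0 < om_ by rewrite divr_gt0 // mulr_gt0.
have [eps1 eps10 tang] := chart_tangential om_cpt wtan wcont ch A0 om0.
(* The first bound places the layer [rho >= - (2 * eps)] within reach of [chart_tangential]; the
   second makes the remaining contribution [C * (1 + B2) * eps] at most [eta / 2]. *)
pose eps := Num.min (eps1 / 2) (eta / (2 * C * (1 + B2))).
have eps0 : 0 < eps by rewrite lt_min !divr_gt0 // !mulr_gt0 // ltr_wpDr.
have [ep1 ep2] : eps <= eps1 / 2 /\ eps <= eta / (2 * C * (1 + B2)).
  by rewrite /eps !ge_min !lexx orbT.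
have [F [Fcs F0 IF F1]] := layer eps eps0.
(* Hence [u] vanishes for [rho >= - eps] and equals 1 for [rho <= - (2 * eps)]: the cutoff is
   exactly 0 in a neighbourhood of the boundary points concerned. *)
pose l t := - eps^-1 * t + - 1.
pose u y := step (l (rho y)).
pose gu y := (- eps^-1 * dstep (l (rho y))) *: grad rho y.
have gu_ y : `|z - y| < r -> gradient_at u y (gu y).
  move=> yr; apply: (gradient_at_comp (phi := fun t => step (l t)) _ (chart_gradient ch yr)).
  exact: is_derive_affine (is_derive_step _).
have cl : continuous l.
  by move=> t; apply: cvgD; [apply: cvgMr; exact: cvg_id|exact: cvg_cst].
have cgu y : `|z - y| < r -> {for y, continuous gu}.
  move=> yr; apply: continuous_at_scale; last first.
    exact: (C1_on_grad_continuous C1 (iffRL (ball_normP _ _ _) yr)).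
  apply: continuousM; first exact: cst_continuous.
  apply: (@continuous_at_compR _ rho (fun t => dstep (l t))).
    exact: chart_continuous ch yr.
  move=> t; apply: (@continuous_comp _ _ _ l (@dstep R)); [exact: cl|exact: dstep_continuous].
have cu y : `|z - y| < r -> {for y, continuous u}.
  by move=> yr; exact: gradient_at_continuous (gu_ y yr).
pose k y := eta_ y * (1 - u y).
pose gk y := eta_ y *: (- gu y) + (1 - u y) *: geta y.
have gk_ y : gradient_at k y (gk y).
  have [yr|yr] := ltP `|z - y| r.
    apply: gradient_atM; first exact: ge.
    by have := gradient_atB (gradient_at_cst 1 y) (gu_ y yr); rewrite sub0r.
  have [E1 E2] := far y (ltac:(lra)).
  rewrite /gk E1 E2 scale0r scaler0 addr0.
  apply: (@gradient_at_ext0 _ _ [set y | `|z - y| <= r / 2]).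
  - by have /compact_normP[] := @compact_dist_le R d z (r / 2).
  - move=> v /= /negP; rewrite -ltNge => /ltW /far[E _].
    by rewrite /k E mul0r.
  - by move=> /=; lra.
have cgk y : {for y, continuous gk}.
  apply: continuous_at_row => i.
  apply: (@continuous_ext0 _ _ [set y | `|z - y| < r] [set y | `|z - y| <= r / 2]).
  - by have /compact_normP[] := @compact_dist_le R d z (r / 2).
  - by move=> v /=; lra.
  - move=> v /= /negP; rewrite -ltNge => /ltW /far[E1 E2].
    by rewrite /gk E1 E2 scale0r scaler0 addr0 mxE.
  move=> v /= vr; apply: continuous_at_coord; apply: continuousD.
    apply: continuous_at_scale; first exact: gradient_at_continuous (ge v).
    by apply: continuousN; exact: cgu.
  apply: continuous_at_scale; last exact: cge.
  by apply: continuousB; [exact: cst_continuous|exact: cu].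
have k01 y : 0 <= k y <= 1.
  have /andP[p0 p1] := phi01 (q y); have := step_ge0 (l (rho y)); have := step_le1 (l (rho y)).
  rewrite /k /eta_ /u => a b; rewrite mulr_ge0 ?subr_ge0 //=.
  by rewrite mulr_ile1 ?subr_ge0 // lerBlDr lerDl.
pose kap := 2 * om_ / eps + B2.
have kap0 : 0 <= kap by rewrite addr_ge0 // ltW // divr_gt0 // mulr_gt0.
exists (fun y => 1 - k y), (fun y => - gk y), (fun x => (1 + kap) * F x); split.
- move=> y oy; split.
  + by have := gradient_atB (gradient_at_cst 1 y) (gk_ y); rewrite sub0r.
  + by apply: continuousN; exact: cgk.
  + by have /andP[a b] := k01 y; rewrite subr_ge0 b lerBlDr lerDl.
- move=> z' [_ nom] /= zz'.
  have rz : 0 <= rho z'.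
    have zr : `|z - z'| < r.
      apply: lt_le_trans zz' _; rewrite ler_pdivrMr ?mulr_gt0 // ler_peMr ?ltW //.
      have : 1 <= d.+1%:R :> R by rewrite ler1n.
      lra.
    have [h _ _] := H z' zr; rewrite leNgt; apply/negP => h2; apply: nom.
    exact/h.
  have zr : `|z - z'| < r.
      apply: lt_le_trans zz' _; rewrite ler_pdivrMr ?mulr_gt0 // ler_peMr ?ltW //.
      have : 1 <= d.+1%:R :> R by rewrite ler1n.
      lra.
  have /cvg_ballP/(_ eps eps0)[dl dl0 h] := chart_continuous ch zr.
  exists (Num.min dl (r / (4 * d.+1%:R) - `|z - z'|)); first by rewrite lt_min dl0 subr_gt0.
  move=> y oy; rewrite lt_min => /andP[y1 y2].
  have zy : `|z - y| < r / (4 * d.+1%:R).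
    have := ler_normD (z - z') (z' - y); rewrite addrA subrK => h3.
    by apply: le_lt_trans h3 _; rewrite addrC -ltrBrDr.
  have E : eta_ y = 1.
    apply: phi1; rewrite ger0_norm // -[q y]enorm_sq.
    apply: ler_sqr_nneg; first exact: enorm_ge0.
    apply: le_trans (enorm_le_norm _) _; rewrite distrC.
    have d4 : 0 < 4 * d.+1%:R :> R by rewrite mulr_gt0.
    move: zy; rewrite (ltr_pdivlMr _ _ d4) (_ : d.+1%:R = d%:R + 1 :> R) ?natr1 // => zy.
    have := normr_ge0 (z - y); lra.
  have E2 : u y = 0.
    apply: step_le0; rewrite /l mulNr lerBlDr add0r lerNl mulrC ler_pdivlMr //.
    have := h y y1; rewrite ltr_norml => /andP[_]; lra.
  by rewrite /k E E2 subr0 mulr1 subrr.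
- split; first exact: compactly_supportedZ.
  by move=> x; rewrite mulr_ge0 // addr_ge0.
- rewrite iintZ //; apply: (@le_trans _ _ ((1 + kap) * (C * eps))).
    by rewrite ler_wpM2l // addr_ge0.
  have -> : (1 + kap) * (C * eps) = C * (1 + B2) * eps + 2 * om_ * C.
    by rewrite /kap; field; rewrite gt_eqF.
  have -> : 2 * om_ * C = eta / 2 by rewrite /om_; field; rewrite gt_eqF.
  move: ep2; rewrite ler_pdivlMr ?mulr_gt0 ?ltr_wpDr //; lra.
move=> x xA ox; set y := tailv x.
have Fx := F0 x.
have triv : k y = 0 -> gk y = 0 ->
    1 - (1 - k y) <= (1 + kap) * F x /\ `|dotv (tailv (w x)) (- gk y)| <= (1 + kap) * F x.
  move=> -> ->; rewrite subr0 subrr oppr0 dotv0r normr0.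
  by split; rewrite mulr_ge0 // addr_ge0.
have [yr|yr] := leP (r / 2) `|z - y|.
  have [E1 E2] := far y yr.
  by apply: triv; rewrite /k /gk E1 ?E2 ?mul0r // scale0r scaler0 addr0.
have [ry|ry] := leP (rho y) (- (2 * eps)).
  have l1 : 1 <= l (rho y).
    have : eps^-1 * rho y <= - 2 by rewrite mulrC ler_pdivrMr //; lra.
    by rewrite /l; lra.
  apply: triv; rewrite /k /gk /gu /u step_ge1 // ?dstep_ge1 // subrr ?mulr0 //.
  by rewrite !scale0r oppr0 scaler0 addr0.
have yr' : `|z - y| < r by lra.
have ry0 : rho y < 0 by have [h _ _] := H y yr'; apply/h.
have Fge : 1 <= F x.
  apply: (F1 _ xA (ltW yr)); rewrite ltr0_norm // lerNl; exact: ltW.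
have /andP[kk0 kk1] := k01 y.
split.
  rewrite subKr; apply: le_trans kk1 _; apply: (le_trans Fge).
  by rewrite ler_peMl // lerDl.
have T1 : `|dotv (tailv (w x)) (grad rho y)| <= om_.
  by apply: (tang _ xA ox (ltW yr)); move: ry ep1 eps0; clear; rewrite -/y; lra.
have T2 : `|dotv (tailv (w x)) (geta y)| <= B2.
  apply: le_trans (dotv_le_norm _ _) _; apply: ler_pM => //.
  rewrite ler_wpM2l ?exprn_ge0 //; apply: le_trans (tailv_norm _) _.
  by apply: hBw; split => //; exact: subset_closure.
rewrite dotvNr normrN /gk dotvDr !dotvZr dotvNr /gu dotvZr.
have /andP[p0 p1] := phi01 (q y).
have u0 := step_ge0 (l (rho y)); have u1 := step_le1 (l (rho y)).
have v0 := dstep_ge0 (l (rho y)); have v1 := dstep_le2 (l (rho y)).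
have ei : 0 < eps^-1 by rewrite invr_gt0.
apply: le_trans (ler_normD _ _) _.
have I1 : `|eta_ y * - (- eps^-1 * dstep (l (rho y)) * dotv (tailv (w x)) (grad rho y))| <= 2 * om_ / eps.
  have -> : eta_ y * - (- eps^-1 * dstep (l (rho y)) * dotv (tailv (w x)) (grad rho y)) =
     (eta_ y * dstep (l (rho y)) * dotv (tailv (w x)) (grad rho y)) / eps by ring.
  rewrite normrM (gtr0_norm ei) ler_pM2r // normrM.
  apply: ler_pM => //; rewrite ger0_norm; last by rewrite mulr_ge0.
  by apply: le_trans (ler_wpM2r v0 p1) _; rewrite mul1r.
have I2 : `|(1 - u y) * dotv (tailv (w x)) (geta y)| <= B2.
  rewrite normrM ger0_norm; last by rewrite subr_ge0.
  apply: le_trans T2; rewrite ler_piMl //.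
  by rewrite lerBlDr lerDl.
have : 0 <= (1 + kap) * (F x - 1) by apply: mulr_ge0; [rewrite addr_ge0|rewrite subr_ge0].
rewrite /geta !dotvZr in I2; move=> I3; apply: (le_trans (lerD I1 I2)); rewrite -/kap.
by move: I3; rewrite mulrBr mulr1 subr_ge0 => I3; apply: le_trans I3; rewrite lerDr.
Qed.

End Cut.

(** * Cutoffs exhausting the cross-section *)

Section CutGlobal.
Variables (R : realType) (d : nat).
Local Notation V := 'rV[R]_d.+1.
Local Notation V' := 'rV[R]_d.
Implicit Types (x : V) (y z e : V') (rho : V' -> R) (r m G : R).
Variables (om : set V') (w : V -> V).
Hypothesis om_cpt : compact (closure om).
Hypothesis om_C1 : C1_open om.
Hypothesis wtan : tangential om w.
Hypothesis wcont : {within closure (cylinder (N := d.+1) om), continuous w}.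

Lemma cuttable_set0 A : cuttable om w A set0.
Proof.
move=> eta eta0; exists (fun=> 1), (fun=> 0), (fun=> 0); split => //.
- move=> y _; split; [exact: gradient_at_cst|exact: cst_continuous|by rewrite ler01 lexx].
- by split => // ; exact: compactly_supported0.
- by rewrite iint0 ltW.
- by move=> x _ _; rewrite subrr dotv0r normr0.
Qed.

(** The product of the two cutoffs is majorized by the sum of the two majorants: 1 - st is at most
    (1 - s) + (1 - t) for s, t in [0, 1], and each term of the product rule keeps one factor at most
    1. *)
Lemma cuttableU A (B1 B2 : set V') : cuttable om w A B1 -> cuttable om w A B2 ->
  cuttable om w A (B1 `|` B2).
Proof.
move=> c1 c2 eta eta0; have e2 : 0 < eta / 2 by rewrite divr_gt0.
have [g1 [gg1 [F1 [h1 b1 [F1c F10] iF1 E1]]]] := c1 _ e2.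
have [g2 [gg2 [F2 [h2 b2 [F2c F20] iF2 E2]]]] := c2 _ e2.
exists (fun y => g1 y * g2 y), (fun y => g1 y *: gg2 y + g2 y *: gg1 y),
  (fun x => F1 x + F2 x); split.
- move=> y oy; have [a1 a2 /andP[a3 a4]] := h1 y oy; have [a5 a6 /andP[a7 a8]] := h2 y oy.
  split; first exact: gradient_atM.
    apply: continuousD; apply: continuous_at_scale => //.
    + exact: gradient_at_continuous a1.
    + exact: gradient_at_continuous a5.
  by rewrite mulr_ge0 // mulr_ile1.
- move=> z bz [Bz|Bz].
    have [dl dl0 h] := b1 z bz Bz; exists dl => // y oy zy.
    by rewrite h // mul0r.
  have [dl dl0 h] := b2 z bz Bz; exists dl => // y oy zy.
  by rewrite h // mulr0.
- split; first exact: compactly_supportedD.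
  by move=> x; rewrite addr_ge0.
- by rewrite iintD //; lra.
move=> x xA ox; have [p1 q1] := E1 x xA ox; have [p2 q2] := E2 x xA ox.
have [_ _ /andP[a3 a4]] := h1 _ ox; have [_ _ /andP[a7 a8]] := h2 _ ox.
move: (g1 _) (g2 _) (gg1 _) (gg2 _) p1 q1 p2 q2 a3 a4 a7 a8 => s t u v p1 q1 p2 q2 a3 a4 a7 a8.
split; first by nra.
rewrite dotvDr !dotvZr; apply: le_trans (ler_normD _ _) _.
rewrite !normrM (ger0_norm a3) (ger0_norm a7) addrC; apply: lerD.
  by apply: le_trans q1; rewrite ler_piMl.
by apply: le_trans q2; rewrite ler_piMl.
Qed.

Lemma cuttable_sub A (B1 B2 : set V') : B2 `<=` B1 -> cuttable om w A B1 ->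
  cuttable om w A B2.
Proof.
move=> sB c eta eta0; have [g [gg [F [h1 b1 h2 h3 h4]]]] := c eta eta0.
exists g, gg, F; split => // z bz /sB; exact: b1.
Qed.

Lemma cuttable_boundary A : 0 <= A -> cuttable om w A (closure om `\` om).
Proof.
move=> A0; have om_open : open om by have [] := om_C1.
have cb : compact (closure om `\` om).
  have [cl [B hB]] := iffLR (compact_normP _) om_cpt.
  apply/compact_normP; split; last by exists B => x [/hB].
  by rewrite setDE; apply: closedI => //; exact: open_closedC.
have /choice[rad hrad] : forall z, exists r, (closure om `\` om) z ->
    0 < r /\ cuttable om w A [set z' | `|z - z'| < r].
  move=> z; have [bz|nbz] := pselect ((closure om `\` om) z); last by exists 0.
  have [r [rho [e [m [G ch]]]]] := chart_exists om_C1 bz.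
  exists (r / (4 * d.+1%:R)) => _; split; last exact: (chart_cut om_cpt wtan wcont ch A0).
  by have [r0 _ _ _ _] := ch; rewrite divr_gt0 // mulr_gt0.
have [|s sb cov] := compact_finite_cover (r := rad) cb.
  by move=> z /hrad[].
apply: (@cuttable_sub _ [set z' | exists2 z, z \in s & `|z - z'| < rad z]) => //.
elim: s sb {cov} => [|z s IH] sb.
  by apply: cuttable_sub (cuttable_set0 A) => y [].
have IH' : cuttable om w A [set z' | exists2 z, z \in s & `|z - z'| < rad z].
  by apply: IH => x xs; apply: sb; rewrite inE xs orbT.
have [_ cz] := hrad z (sb z (mem_head _ _)).
apply: cuttable_sub (cuttableU cz IH') => y [v]; rewrite inE => /predU1P[->|vs] h.
  by left.
by right; exists v.
Qed.

(** This is the substitute for the divergence theorem with v.n = 0: testing with [h] costs at most a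
    constant times [eta]. Both errors are stated through one continuous compactly supported [F],
    because [1 - h] restricted to [om] is in general discontinuous across the boundary and the
    estimates on [iint] do not cover it. *)
Lemma cutoff_cylinder (A eta : R) : 0 <= A -> 0 < eta ->
  exists (K : set V') (h : V' -> R) (gh : V' -> V') (F : V -> R),
  [/\ compact K /\ K `<=` om,
      forall y, ~ K y -> h y = 0 /\ gh y = 0,
      forall y, om y -> gradient_at h y (gh y) /\ {for y, continuous gh},
      forall y, 0 <= h y <= 1 &
      [/\ compactly_supported F, forall x, 0 <= F x, iint F <= eta &
       forall x, `|x 0 ord0| <= A -> om (tailv x) ->
         1 - h (tailv x) <= F x /\ `|dotv (tailv (w x)) (gh (tailv x))| <= F x]].
Proof.
move=> A0 eta0; have [g [gg [F [h1 b1 [Fc F0] iF E]]]] := cuttable_boundary A0 eta0.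
have om_open : open om by have [] := om_C1.
(* Since [g] vanishes near every boundary point, the closed support of [g] cannot touch the boundary
   and is compact in [om]. *)
pose K := closure [set y | om y /\ g y != 0].
have sub : K `<=` om.
  move=> y Ky; have cy : closure om y by apply: closure_subset Ky => u [].
  apply: contrapT => noy; have [dl dl0 hd] := b1 y (conj cy noy) (conj cy noy).
  have [u [[ou gu] yu]] := iffLR (closure_normP _ _) Ky dl dl0.
  by rewrite hd ?eqxx in gu.
have cK : compact K.
  have [cl [B hB]] := iffLR (compact_normP _) om_cpt.
  apply/compact_normP; split; first exact: closed_closure.
  by exists B => y Ky; apply: hB; apply: subset_closure; exact: sub.
have [clK _] := iffLR (compact_normP _) cK.
pose h y := if `[< om y >] then g y else 0.
pose gh y := if `[< om y >] then gg y else 0.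
have hE y : om y -> h y = g y by move=> oy; rewrite /h asboolT.
have ghE y : om y -> gh y = gg y by move=> oy; rewrite /gh asboolT.
have near_om y : om y -> \near y, om y.
  by move=> oy; exact: open_nbhs_nbhs.
have gr y : om y -> gradient_at h y (gh y).
  move=> oy; rewrite ghE //; have [a _ _] := h1 y oy.
  apply: gradient_at_near a; near=> u.
  by rewrite hE //; near: u; exact: near_om.
have h0 y : ~ K y -> h y = 0.
  move=> nK; have [oy|noy] := pselect (om y); last by rewrite /h asboolF.
  rewrite hE //; apply: contrapT => /eqP gy; apply: nK.
  by apply: subset_closure.
exists K, h, gh, F; split => //.
- move=> y nK; split; first exact: h0.
  have [oy|noy] := pselect (om y); last by rewrite /gh asboolF.
  apply: (gradient_at_unique (gr y oy)).
  exact: (gradient_at_ext0 clK h0 nK).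
- move=> y oy; split; first exact: gr.
  have [_ c _] := h1 y oy.
  apply/cvg_ballP => e e0; have /cvg_ballP/(_ e e0)[dl dl0 H] := c.
  have [dl' dl'0 H'] := iffLR (open_normP _) om_open y oy.
  exists (Num.min dl dl'); first by rewrite lt_min dl0.
  move=> u; rewrite lt_min => /andP[u1 u2]; by rewrite asboolT ?(ghE y oy); [exact: H|exact: H' u u2].
- move=> y; have [oy|noy] := pselect (om y); last by rewrite /h asboolF // lexx ler01.
  by rewrite hE //; have [] := h1 y oy.
split => // x xA ox; rewrite hE // ghE //; exact: E.
Unshelve. all: by end_near. Qed.

End CutGlobal.

(** * Estimates for potentials of tangential divergence-free fields *)

Section Averages.
Variables (R : realType) (d : nat).
Local Notation V := 'rV[R]_d.+1.
Local Notation V' := 'rV[R]_d.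
Implicit Types (x : V) (y z : V').
Variable (om : set V').
Hypothesis om_cpt : compact (closure om).
Hypothesis om_C1 : C1_open om.

Lemma continuous_at_shift n (T : normedModType R) (f : 'rV[R]_n -> T)
    (a v : 'rV[R]_n) :
  {for v + a, continuous f} -> {for v, continuous (fun u : 'rV[R]_n => f (u + a))}.
Proof.
move=> /cvg_ballP cf; apply/cvg_ballP => e e0; have [r r0 h] := cf e e0.
by exists r => // u vu; apply: h; rewrite opprD addrACA subrr addr0.
Qed.

Lemma cons_rv00 : cons_rv 0 0 = 0 :> V.
Proof. by rewrite -[RHS](scale0r (cons_rv 0 0)) cons_rvZ mul0r scaler0. Qed.

(** Continuity is asked only inside the cylinder and boundedness on bounded pieces, so products and
    differences of [psi], the components of [v] and weights in x_1 qualify without extension across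
    the lateral boundary. *)
Definition box_bounded (f : V -> R) : Prop :=
  (forall x, om (tailv x) -> {for x, continuous f}) /\
  forall A : R, exists B : R, forall x, om (tailv x) -> `|x 0 ord0| <= A -> `|f x| <= B.

Definition loc (f : V -> R) : Prop :=
  box_bounded f /\ exists A : R, forall x, om (tailv x) -> A < `|x 0 ord0| -> f x = 0.

Lemma box_boundedD f g : box_bounded f -> box_bounded g -> box_bounded (fun x => f x + g x).
Proof.
move=> [cf bf] [cg bg]; split=> [x ox|A]; first by apply: continuousD; [exact: cf|exact: cg].
have [B hB] := bf A; have [C hC] := bg A; exists (B + C) => x ox xA.
by apply: le_trans (ler_normD _ _) _; apply: lerD; [exact: hB|exact: hC].
Qed.

Lemma box_boundedM f g : box_bounded f -> box_bounded g -> box_bounded (fun x => f x * g x).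
Proof.
move=> [cf bf] [cg bg]; split=> [x ox|A]; first by apply: continuousM; [exact: cf|exact: cg].
have [B hB] := bf A; have [C hC] := bg A; exists (B * C) => x ox xA.
by rewrite normrM; apply: ler_pM => //; [exact: hB|exact: hC].
Qed.

Lemma box_bounded_cst c : box_bounded (fun=> c).
Proof. by split=> [x _|A]; [exact: cst_continuous|exists `|c|]. Qed.

Lemma box_boundedN f : box_bounded f -> box_bounded (fun x => - f x).
Proof.
move=> bf; have := box_boundedM (box_bounded_cst (-1)) bf.
by under eq_fun do rewrite mulN1r.
Qed.

Lemma box_bounded_norm f : box_bounded f -> box_bounded (fun x => `|f x|).
Proof.
move=> [cf bf]; split=> [x ox|A].
  by apply: (@continuous_at_compR _ _ f (fun t : R => `|t|)); [exact: cf|exact: norm_continuous].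
by have [B hB] := bf A; exists B => x ox xA; rewrite normr_id; exact: hB.
Qed.

Lemma box_bounded_head (phi : R -> R) : continuous phi -> box_bounded (fun x => phi (x 0 ord0)).
Proof.
move=> cp; split=> [x _|A]; first by apply: continuous_at_head; exact: cp.
have [B [_ hB]] := compact_bounded (continuous_compact (continuous_subspaceT cp) (@segment_compact R (- A) A)).
exists (B + 1) => x _ xA; apply: (hB (B + 1)); first by rewrite ltrDl.
by exists (x 0 ord0) => //=; rewrite in_itv /= -ler_norml.
Qed.

Lemma box_bounded_tail (k : V' -> R) : continuous k -> (exists B, forall y, om y -> `|k y| <= B) ->
  box_bounded (fun x => k (tailv x)).
Proof.
move=> ck [B hB]; split=> [x _|A]; first by apply: continuous_at_tailv; exact: ck.
by exists B => x ox _; exact: hB.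
Qed.

Lemma locD f g : loc f -> loc g -> loc (fun x => f x + g x).
Proof.
move=> [bf [A hA]] [bg [B hB]]; split; first exact: box_boundedD.
exists (Num.max A B) => x ox; rewrite gt_max => /andP[xA xB].
by rewrite hA // hB // addr0.
Qed.

Lemma locM f g : loc f -> box_bounded g -> loc (fun x => f x * g x).
Proof.
move=> [bf [A hA]] bg; split; first exact: box_boundedM.
by exists A => x ox xA; rewrite hA // mul0r.
Qed.

Lemma locMr f g : box_bounded f -> loc g -> loc (fun x => f x * g x).
Proof.
by move=> bf lg; have := locM lg bf; under eq_fun do rewrite mulrC.
Qed.

Lemma locZ c f : loc f -> loc (fun x => c * f x).
Proof. by move=> lf; apply: locMr lf; exact: box_bounded_cst. Qed.

Lemma loc_head (phi : R -> R) (A : R) : continuous phi -> (forall t, A < `|t| -> phi t = 0) ->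
  loc (fun x => phi (x 0 ord0)).
Proof.
move=> cp h; split; first exact: box_bounded_head.
by exists A => x _; exact: h.
Qed.

Lemma loc_norm f : loc f -> loc (fun x => `|f x|).
Proof.
move=> [bf [A hA]]; split; first exact: box_bounded_norm.
by exists A => x ox xA; rewrite hA // normr0.
Qed.

(** These weights truncate the cross-section only; truncation in x_1 is left to the integrand,
    through [loc]. *)
Definition adm (g : V -> R) : Prop :=
  [/\ continuous g, forall x, 0 <= g x <= 1 &
      exists2 K : set V', compact K /\ K `<=` om & forall x, ~ K (tailv x) -> g x = 0].

Lemma adm_ge0 g x : adm g -> 0 <= g x.
Proof. by move=> [_ h _]; have /andP[] := h x. Qed.

Lemma adm_le1 g x : adm g -> g x <= 1.
Proof. by move=> [_ h _]; have /andP[] := h x. Qed.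

Lemma adm_out g x : adm g -> ~ om (tailv x) -> g x = 0.
Proof. by move=> [_ _ [K [_ Ko] h]] nx; apply: h => /Ko. Qed.

Lemma adm_loc_cs g f : adm g -> loc f -> compactly_supported (fun x => g x * f x).
Proof.
move=> [cg _ [K [cK Ko] g0]] [[cf _] [A hA]].
apply: (compactly_supported_ext0 (compact_box (A := A) cK) (@subset_refl _ _)) => [x nK|x [_ /Ko ox]].
  have [Kx|/g0 ->] := pselect (K (tailv x)); last by rewrite mul0r.
  have [xA|xA] := ltP A `|x 0 ord0|; first by rewrite hA ?mulr0 //; exact: Ko.
  by exfalso; apply: nK.
by apply: continuousM; [exact: cg|exact: cf].
Qed.

Lemma adm0 : adm (fun=> 0).
Proof.
split; first exact: cst_continuous.
  by move=> x; rewrite lexx ler01.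
exists set0 => //; split => //; exact: compact0.
Qed.

Lemma adm_shift1 g s : adm g -> adm (fun x => g (x + cons_rv s 0)).
Proof.
move=> [cg g01 [K [cK Ko] g0]]; split.
- by move=> x; apply: continuous_at_shift; exact: cg.
- by move=> x; exact: g01.
exists K => // x nK; apply: g0.
by rewrite tailvD tailv_cons addr0.
Qed.

(* A substitute for the integral of f over the cylinder: only compactly
   supported continuous integrands can be handled by iint. *)
Definition J (f : V -> R) : R := sup [set iint (fun x => g x * f x) | g in adm].

Lemma loc_bounded f : loc f -> exists2 M, 0 <= M & forall x, om (tailv x) -> `|f x| <= M.
Proof.
move=> [[_ bf] [A hA]]; have [B hB] := bf A; exists `|B| => // x ox.
have [xA|xA] := ltP A `|x 0 ord0|; first by rewrite hA // normr0.
by apply: le_trans (ler_norm B); exact: hB.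
Qed.

Lemma J_has_sup f : loc f -> has_sup [set iint (fun x => g x * f x) | g in adm].
Proof.
move=> lf; have [M M0 hM] := loc_bounded lf.
have [cl [B hB]] := iffLR (compact_normP _) om_cpt.
have [_ [A hA]] := lf.
split; first by exists (iint (fun x => 0 * f x)); exists (fun=> 0) => //; exact: adm0.
pose C := `|A| + `|B| + 1.
have C0 : 0 < C by rewrite ltr_wpDl // addr_ge0.
exists (M * (2 * C) ^+ d.+1) => _ [g ag <-].
apply: le_trans (ler_norm _) _; apply: iint_norm_bound => //.
- exact: adm_loc_cs.
- move=> x; rewrite norm_tailv_head lt_max => h.
  have [ox|nx] := pselect (om (tailv x)); last by rewrite (adm_out ag nx) mul0r.
  rewrite hA ?mulr0 //; case/orP: h => h.
    apply: le_lt_trans h; have := ler_norm A; have := normr_ge0 B; rewrite /C; lra.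
  have := hB _ (subset_closure ox); have := ler_norm B; have := normr_ge0 A.
  move: h; rewrite /C; lra.
- move=> x; have [ox|nx] := pselect (om (tailv x)); last by rewrite (adm_out ag nx) mul0r normr0.
  rewrite normrM; apply: le_trans (hM x ox).
  by rewrite ler_piMl // ger0_norm ?(adm_ge0 _ ag) // (adm_le1 _ ag).
Qed.

Lemma J_ub g f : adm g -> loc f -> iint (fun x => g x * f x) <= J f.
Proof.
move=> ag lf; apply: ub_le_sup; last by exists g.
by have [] := J_has_sup lf.
Qed.

Lemma J_le f B : loc f -> (forall g, adm g -> iint (fun x => g x * f x) <= B) -> J f <= B.
Proof.
move=> lf h; apply: ge_sup; first by have [] := J_has_sup lf.
by move=> _ [g ag <-]; exact: h.
Qed.

Lemma J_ge0 f : loc f -> 0 <= J f.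
Proof.
move=> lf; apply: le_trans (J_ub adm0 lf).
by under eq_fun do rewrite mul0r; rewrite iint0.
Qed.

Lemma J_mono f1 f2 : loc f1 -> loc f2 -> (forall x, om (tailv x) -> f1 x <= f2 x) -> J f1 <= J f2.
Proof.
move=> l1 l2 h; apply: J_le => // g ag; apply: le_trans (J_ub ag l2).
apply: iint_le => [||x]; try exact: adm_loc_cs.
have [ox|nx] := pselect (om (tailv x)); last by rewrite (adm_out ag nx) !mul0r.
by apply: ler_wpM2l; [exact: adm_ge0|exact: h].
Qed.

(** As a supremum [J] is subadditive, which is the direction used by upper bounds. *)
Lemma J_add f1 f2 : loc f1 -> loc f2 -> J (fun x => f1 x + f2 x) <= J f1 + J f2.
Proof.
move=> l1 l2; apply: J_le => [|g ag]; first exact: locD.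
have -> : (fun x => g x * (f1 x + f2 x)) = fun x => g x * f1 x + g x * f2 x.
  by apply/funext => x; rewrite mulrDr.
rewrite iintD; try exact: adm_loc_cs.
by apply: lerD; exact: J_ub.
Qed.

Lemma J_Z c f : 0 <= c -> loc f -> J (fun x => c * f x) <= c * J f.
Proof.
move=> c0 lf; apply: J_le => [|g ag]; first exact: locZ.
have -> : (fun x => g x * (c * f x)) = fun x => c * (g x * f x).
  by apply/funext => x; rewrite mulrCA.
rewrite iintZ; last exact: adm_loc_cs.
by apply: ler_wpM2l => //; exact: J_ub.
Qed.

Lemma box_bounded_shift1 f s : box_bounded f -> box_bounded (fun x => f (x + cons_rv s 0)).
Proof.
move=> [cf bf]; have tE x : tailv (x + cons_rv s 0) = tailv x by rewrite tailvD tailv_cons addr0.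
split=> [x ox|A].
  by apply: continuous_at_shift; apply: cf; rewrite tE.
have [B hB] := bf (A + `|s|); exists B => x ox xA; apply: hB; first by rewrite tE.
by rewrite mxE cons_rv0; apply: le_trans (ler_normD _ _) _; rewrite lerD2r.
Qed.

Lemma loc_shift1 f s : loc f -> loc (fun x => f (x + cons_rv s 0)).
Proof.
move=> [bf [A hA]]; split; first exact: box_bounded_shift1.
exists (A + `|s|) => x ox xA; apply: hA; first by rewrite tailvD tailv_cons addr0.
rewrite mxE cons_rv0; have := lerB_normD (x 0 ord0) s; move: xA; lra.
Qed.

Lemma J_shift1 f s : loc f -> J (fun x => f (x + cons_rv s 0)) <= J f.
Proof.
move=> lf; apply: J_le => [|g ag]; first exact: loc_shift1.
have := iint_shift (cons_rv (- s) 0) (adm_loc_cs ag (loc_shift1 s lf)).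
have E x : x + cons_rv (- s) 0 + cons_rv s 0 = x.
  by rewrite -addrA cons_rvD addNr addr0 cons_rv00 addr0.
under eq_fun do rewrite E; move=> <-.
by apply: J_ub => //; exact: adm_shift1.
Qed.

Lemma adm_bump x0 : om (tailv x0) -> exists2 g, adm g & g x0 = 1.
Proof.
move=> ox; have [oo _] := om_C1; have [r r0 hr] := iffLR (open_normP _) oo _ ox.
exists (fun x => step (2 - `|tailv x0 - tailv x| * (4 / r))).
  split.
  - move=> x; apply: (@continuous_at_tailv _ _ _ (fun y => step (2 - `|tailv x0 - y| * (4 / r)))).
    apply: (@continuous_at_compR _ _ (fun y => 2 - `|tailv x0 - y| * (4 / r)) (@step R)).
      apply: continuousB; first exact: cst_continuous.
      by apply: continuousM; [exact: norm_continuous_dist|exact: cst_continuous].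
    exact: step_continuous.
  - by move=> x; rewrite step_ge0 step_le1.
  exists [set y | `|tailv x0 - y| <= r / 2].
    split; first exact: compact_dist_le.
    by move=> y /= h; apply: hr; lra.
  move=> x /= /negP; rewrite -ltNge => h; apply: step_le0.
  have : r / 2 * (4 / r) <= `|tailv x0 - tailv x| * (4 / r).
    by apply: ler_wpM2r; [rewrite ltW // divr_gt0|exact: ltW].
  have -> : r / 2 * (4 / r) = 2 by field; rewrite gt_eqF.
  lra.
by rewrite subrr normr0 mul0r subr0 step_ge1 // ler1n.
Qed.

Lemma J_eq0 f x : loc f -> (forall x, om (tailv x) -> 0 <= f x) -> J f <= 0 ->
  om (tailv x) -> f x = 0.
Proof.
move=> lf f0 Jf ox; have [g ag gx] := adm_bump ox.
apply/eqP; rewrite eq_le f0 // andbT leNgt; apply/negP => fx.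
have : 0 < iint (fun x => g x * f x).
  apply: (iint_gt0 (x := x)); first exact: adm_loc_cs.
    move=> u; have [ou|nu] := pselect (om (tailv u)); last by rewrite (adm_out ag nu) mul0r.
    by apply: mulr_ge0; [exact: adm_ge0|exact: f0].
  by rewrite gx mul1r.
by rewrite ltNge (le_trans (J_ub ag lf) Jf).
Qed.

End Averages.

(** * Neumann potentials and the Caccioppoli inequality *)

Section Neumann.
Variables (R : realType) (d : nat).
Local Notation V := 'rV[R]_d.+1.
Local Notation V' := 'rV[R]_d.
Implicit Types (x : V) (y z : V').
Variable (om : set V').
Hypothesis om_cpt : compact (closure om).
Hypothesis om_C1 : C1_open om.

(** A harmonic function with zero normal derivative, in first-order form: all conditions bear on the
    gradient [w]. The class is stable under multiples, differences and axial shifts, so the same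
    estimates serve for [psi], [- psi], the increments of [psi] along the axis, and
    [psi - a * x_1]. *)
Definition neumann (u : V -> R) (w : V -> V) : Prop :=
  [/\ forall x, om (tailv x) -> gradient_at u x (w x),
      divergence_free (cylinder (N := d.+1) om) w, tangential om w,
      {within closure (cylinder (N := d.+1) om), continuous w} & box_bounded om u].

Lemma within_box_bounded (f : V -> V) i :
  (forall x, om (tailv x) -> {for x, continuous f}) ->
  {within closure (cylinder (N := d.+1) om), continuous f} ->
  box_bounded om (fun x => f x 0 i).
Proof.
move=> cf wf; split=> [x ox|A]; first by apply: continuous_at_coord; exact: cf.
have cK := compact_box (A := A) om_cpt.
have [B B0 hB] := compact_fun_bounded cK (@cyl_within_box R d om f wf A).
exists B => x ox xA; apply: le_trans (coord_le_norm _ _) _.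
by apply: hB; split => //; exact: subset_closure.
Qed.

Lemma neumann_coord u w i : neumann u w -> box_bounded om (fun x => w x 0 i).
Proof.
move=> [_ df _ wc _]; apply: within_box_bounded => // x ox.
exact: (divergence_free_continuous df).
Qed.

Lemma neumann_sq u w : neumann u w -> box_bounded om (fun x => dotv (w x) (w x)).
Proof.
move=> nw; rewrite /dotv; elim: (index_enum _) => [|i s IH].
  by under eq_fun do rewrite big_nil; exact: box_bounded_cst.
under eq_fun do rewrite big_cons; apply: box_boundedD => //.
by apply: box_boundedM; exact: neumann_coord nw.
Qed.

Lemma adm_tail (h : V' -> R) (K : set V') : compact K -> K `<=` om ->
  (forall y, ~ K y -> h y = 0) -> (forall y, om y -> {for y, continuous h}) ->
  (forall y, 0 <= h y <= 1) -> adm om (fun x => h (tailv x)).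
Proof.
move=> cK Ko h0 ch h01; have [clK _] := iffLR (compact_normP _) cK.
split; last by exists K => // x; exact: h0.
  move=> x; apply: continuous_at_tailv.
  exact: (continuous_ext0 clK Ko h0 ch).
by move=> x; exact: h01.
Qed.

(* Testing the equation against phi^2 u and a cutoff h of the cross-section;
   the error terms involving grad h are controlled by cutoff_cylinder. *)
Lemma caccioppoli u w (phi dphi : R -> R) (A : R) : neumann u w ->
  (forall t, is_derive t (1 : R) phi (dphi t)) -> continuous dphi -> 0 <= A ->
  (forall t, A < `|t| -> phi t = 0 /\ dphi t = 0) ->
  J om (fun x => phi (x 0 ord0) ^+ 2 * dotv (w x) (w x)) <=
  4 * J om (fun x => dphi (x 0 ord0) ^+ 2 * u x ^+ 2).
Proof.
move=> nw dp cdp A0 pA; have [gu df wtan wc bu] := nw.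
have cp : continuous phi.
  by move=> t; apply: differentiable_continuous; apply/derivable1_diffP; have [] := dp t.
have sqc (f : R -> R) : continuous f -> continuous (fun t => f t ^+ 2).
  by move=> cf t; apply: continuousM; exact: cf.
have lp2 : loc om (fun x => phi (x 0 ord0) ^+ 2).
  by apply: (@loc_head _ _ _ (fun t => phi t ^+ 2) A (sqc _ cp)) => t /pA[-> _]; rewrite expr0n.
have ldp2 : loc om (fun x => dphi (x 0 ord0) ^+ 2).
  by apply: (@loc_head _ _ _ (fun t => dphi t ^+ 2) A (sqc _ cdp)) => t /pA[_ ->]; rewrite expr0n.
have bu2 : box_bounded om (fun x => u x ^+ 2) by exact: box_boundedM.
have bph : box_bounded om (fun x => phi (x 0 ord0)) by exact: box_bounded_head.
have lE : loc om (fun x => phi (x 0 ord0) ^+ 2 * dotv (w x) (w x)).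
  by apply: locM => //; exact: neumann_sq nw.
have lU : loc om (fun x => dphi (x 0 ord0) ^+ 2 * u x ^+ 2) by exact: locM.
have lq : loc om (fun x => phi (x 0 ord0) ^+ 2 * u x) by exact: locM.
have [M1 M10 hM1] := loc_bounded lE; have [M2 M20 hM2] := loc_bounded lq.
apply: J_le => // g ag; apply/ler_addgt0Pr => eta eta0.
(* Replacing [g] by [h] costs [M1] times the integral of [F], and the lateral term costs [M2] times
   it, counted twice; with [eta / M] for that integral the total is at most [eta]. *)
pose M := M1 + 2 * M2 + 1.
have M0 : 0 < M by rewrite /M; lra.
have [K [h [gh [F [[cK Ko] h0 hg h01 [Fc F0 iF FE]]]]]] :=
  cutoff_cylinder om_cpt om_C1 wtan wc A0 (divr_gt0 eta0 M0).
have ch y : om y -> {for y, continuous h} by move=> /hg[/gradient_at_continuous].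
have ah : adm om (fun x => h (tailv x)).
  by apply: (adm_tail cK Ko) => // y /h0[].
pose q x := phi (x 0 ord0) ^+ 2 * u x.
pose gq x := phi (x 0 ord0) ^+ 2 *: w x +
  u x *: cons_rv (2 * phi (x 0 ord0) * dphi (x 0 ord0)) 0.
have dp2 t : is_derive t (1 : R) (fun t => phi t ^+ 2) (2 * phi t * dphi t).
  have D := is_deriveM (dp t) (dp t).
  by apply: is_derive_eq D _; rewrite /GRing.scale /=; ring.
have gq_ x : om (tailv x) -> gradient_at q x (gq x) /\ {for x, continuous gq}.
  move=> ox; split.
    apply: gradient_atM; last exact: gu.
    exact: (gradient_at_head (dp2 _)).
  apply: continuousD; apply: continuous_at_scale.
  - by apply: (continuous_at_head (f := fun t => phi t ^+ 2)); exact: sqc.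
  - exact: (divergence_free_continuous df).
  - by have [c _] := bu; exact: c.
  - apply: (@continuous_at_consr _ _ _ (fun x : V => 2 * phi (x 0 ord0) * dphi (x 0 ord0))).
    apply: (@continuous_at_head _ _ _ (fun t => 2 * phi t * dphi t)).
    apply: continuousM; last exact: cdp.
    by apply: continuousM; [exact: cst_continuous|exact: cp].
have gh_ x : om (tailv x) -> gradient_at (fun x => h (tailv x)) x (cons_rv 0 (gh (tailv x))) /\
    {for x, continuous (fun x => cons_rv 0 (gh (tailv x)))}.
  move=> ox; have [g1 g2] := hg _ ox; split; first exact: gradient_at_tailv.
  by apply: (@continuous_at_cons0 _ _ _ (fun x : V => gh (tailv x))); exact: continuous_at_tailv.
have cB := compact_box (A := A) cK.
have Bo : box K A `<=` cylinder (N := d.+1) om by move=> x [_ /Ko].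
have out x : ~ box K A x -> (h (tailv x) = 0 /\ cons_rv 0 (gh (tailv x)) = 0) \/ (q x = 0 /\ gq x = 0).
  move=> nb; have [Kx|/h0[-> ->]] := pselect (K (tailv x)); last by left; rewrite cons_rv00.
  right; have xA : A < `|x 0 ord0| by rewrite ltNge; apply/negP => xA; apply: nb.
  have [p0 _] := pA _ xA.
  by rewrite /q /gq p0 expr0n /= mul0r mulr0 mul0r scale0r cons_rv00 scaler0 addr0.
have [W1 W2 WE] := weak_form cB Bo out gh_ gq_ df.
have iMF : iint (fun x => M2 * F x) <= M2 * (eta / M) by rewrite iintZ // ler_wpM2l.
have iMF1 : iint (fun x => M1 * F x) <= M1 * (eta / M) by rewrite iintZ // ler_wpM2l.
have hq : `|iint (fun x => q x * dotv (w x) (cons_rv 0 (gh (tailv x))))| <= M2 * (eta / M).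
  apply: le_trans iMF; apply: iint_norm_le => // [|x]; first exact: compactly_supportedZ.
  have [ox|nx] := pselect (om (tailv x)); last first.
    have nK : ~ K (tailv x) by move=> /Ko.
    by have [_ ->] := h0 _ nK; rewrite cons_rv00 dotv0r mulr0 normr0 mulr_ge0.
  have [xA|xA] := leP `|x 0 ord0| A; last first.
    by have [p0 _] := pA _ xA; rewrite /q p0 expr0n /= !mul0r normr0 mulr_ge0.
  rewrite normrM dotv_cons_tailv; apply: ler_pM => //; first exact: hM2.
  by have [_] := FE x xA ox.
have lE2 : compactly_supported (fun x => h (tailv x) * (phi (x 0 ord0) ^+ 2 * dotv (w x) (w x))).
  exact: adm_loc_cs ah lE.
have lU2 := adm_loc_cs ah lU.
have step1 : iint (fun x => g x * (phi (x 0 ord0) ^+ 2 * dotv (w x) (w x))) <=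
   iint (fun x => h (tailv x) * (phi (x 0 ord0) ^+ 2 * dotv (w x) (w x))) + M1 * (eta / M).
  apply: (@le_trans _ _ (iint (fun x => h (tailv x) * (phi (x 0 ord0) ^+ 2 * dotv (w x) (w x)) + M1 * F x))).
    apply: iint_le => [||x].
    - exact: (adm_loc_cs ag lE).
    - by apply: compactly_supportedD => //; exact: compactly_supportedZ.
    have [ox|nx] := pselect (om (tailv x)); last first.
      by rewrite (adm_out ag nx) mul0r (adm_out ah nx) mul0r add0r mulr_ge0.
    have e0 : 0 <= phi (x 0 ord0) ^+ 2 * dotv (w x) (w x) by rewrite mulr_ge0 ?sqr_ge0 ?dotv_ge0.
    have [xA|xA] := leP `|x 0 ord0| A; last first.
      by have [p0 _] := pA _ xA; rewrite p0 expr0n /= !(mul0r, mulr0) add0r mulr_ge0.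
    have [a1 _] := FE x xA ox.
    have a2 := adm_le1 x ag; have /andP[a3 a4] := h01 (tailv x).
    have a5 := hM1 x ox; rewrite (ger0_norm e0) in a5.
    move: (g x) (h _) (phi _ ^+ 2 * _) (F x) e0 a1 a2 a3 a4 a5 => b1 b2 b3 b4.
    move: M10; clear => ? ? ? ? ? ? ?.
    have : b3 * (b1 - b2) <= M1 * b4.
      by apply: (@le_trans _ _ (b3 * (1 - b2))); [rewrite ler_wpM2l //; lra|rewrite ler_pM //; lra].
    lra.
  by rewrite iintD //; [lra|exact: compactly_supportedZ].
have step2 : iint (fun x => h (tailv x) * (phi (x 0 ord0) ^+ 2 * dotv (w x) (w x))) <=
    2 * (M2 * (eta / M)) + 4 * iint (fun x => h (tailv x) * (dphi (x 0 ord0) ^+ 2 * u x ^+ 2)).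
  have : iint (fun x => h (tailv x) * (phi (x 0 ord0) ^+ 2 * dotv (w x) (w x))) <=
    iint (fun x => 2 * (h (tailv x) * dotv (w x) (gq x)) +
      4 * (h (tailv x) * (dphi (x 0 ord0) ^+ 2 * u x ^+ 2))).
    apply: iint_le => // [|x].
      by apply: compactly_supportedD; exact: compactly_supportedZ.
    rewrite /gq dotvDr !dotvZr dotv_consr.
    have /andP[a3 _] := h01 (tailv x).
    have a4 : (w x 0 ord0) ^+ 2 <= dotv (w x) (w x).
      rewrite -[dotv (w x) (w x)]enorm_sq -real_normK ?num_real //.
      apply: ler_sqr_nneg => //; apply: le_trans (coord_le_norm _ _) _.
      exact: norm_le_enorm.
    move: (h _) (phi _) (dphi _) (u x) (dotv _ _) (w x 0 ord0) a3 a4 => H P D U W w1.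
    clear => H0 wW.
    rewrite -subr_ge0.
    (* The cross term is absorbed by completing a square; the remainder is nonnegative because [w1]
       is one coordinate of a vector of squared norm [W]. This is the origin of the factor 4 in the
       statement. *)
    have -> : 2 * (H * (P ^+ 2 * W + U * (2 * P * D * w1))) + 4 * (H * (D ^+ 2 * U ^+ 2)) - H * (P ^+ 2 * W)
      = H * (P ^+ 2 * (W - w1 ^+ 2) + (P * w1 + 2 * D * U) ^+ 2) by ring.
    by rewrite mulr_ge0 // addr_ge0 ?sqr_ge0 // mulr_ge0 ?sqr_ge0 // subr_ge0.
  rewrite iintD ?iintZ //; try exact: compactly_supportedZ.
  rewrite WE => H1.
  have H2 := ler_norm (- iint (fun x => q x * dotv (w x) (cons_rv 0 (gh (tailv x))))).
  rewrite normrN in H2.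
  move: hq H1 H2; clear; lra.
have step3 := J_ub om_cpt ah lU.
have : 2 * (M2 * (eta / M)) + M1 * (eta / M) <= eta.
  have -> : 2 * (M2 * (eta / M)) + M1 * (eta / M) = (M - 1) * (eta / M) by rewrite /M; ring.
  rewrite mulrBl mul1r mulrC divfK ?gt_eqF //.
  by rewrite gerBl ltW // divr_gt0.
move: step1 step2 step3; clear; lra.
Qed.

End Neumann.

(** * The mean value property *)

Section MeanValue.
Variables (R : realType).

Lemma fine_subdivision (r dl : R) : 0 <= r -> 0 < dl -> exists2 n : nat, (0 < n)%N & r / n%:R < dl.
Proof.
move=> r0 dl0; exists (Num.truncn (r / dl)).+1 => //.
have : r / dl < (Num.truncn (r / dl)).+1%:R by exact: truncnS_gt.
by rewrite ltr_pdivrMr // ltr_pdivrMr // mulrC.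
Qed.

(** A uniform form of having zero derivative, checked on subdivisions, so that no differentiation
    under the integral sign is required. *)
Lemma constant_of_small_increments (f : R -> R) (r : R) : 0 <= r ->
  (forall e : R, 0 < e -> exists2 dl : R, 0 < dl & forall s t, 0 <= s -> s <= t -> t <= r ->
     t - s < dl -> `|f t - f s| <= e * (t - s)) -> f r = f 0.
Proof.
move=> r0 H; apply/eqP; rewrite -subr_eq0 -normr_le0; apply/ler_addgt0Pr => e e0.
rewrite add0r; have e1 : 0 < e / (r + 1) by rewrite divr_gt0 // ltr_wpDl.
have [dl dl0 h] := H _ e1; have [n n0 hn] := fine_subdivision r0 dl0.
have nR : 0 < n%:R :> R by rewrite ltr0n.
have q0 : 0 <= r / n%:R by rewrite divr_ge0 // ltW.
have key k : (k <= n)%N -> `|f (k%:R * (r / n%:R)) - f 0| <= e / (r + 1) * (k%:R * (r / n%:R)).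
  elim: k => [_|k IH kn]; first by rewrite mul0r subrr normr0 mulr0.
  have := IH (ltnW kn).
  have E : k.+1%:R * (r / n%:R) - k%:R * (r / n%:R) = r / n%:R.
    by rewrite -mulrBl -natr1 addrC addKr mul1r.
  have := h (k%:R * (r / n%:R)) (k.+1%:R * (r / n%:R)).
  rewrite E => h1 h2.
  have {}h1 : `|f (k.+1%:R * (r / n%:R)) - f (k%:R * (r / n%:R))| <= e / (r + 1) * (r / n%:R).
    apply: h1 => //; first by rewrite mulr_ge0.
      by rewrite ler_wpM2r // ler_nat.
    by rewrite mulrCA -[leRHS]mulr1 ler_wpM2l // ler_pdivrMr // mul1r ler_nat.
  have -> : f (k.+1%:R * (r / n%:R)) - f 0 =
    (f (k.+1%:R * (r / n%:R)) - f (k%:R * (r / n%:R))) + (f (k%:R * (r / n%:R)) - f 0).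
    by rewrite addrA subrK.
  apply: le_trans (ler_normD _ _) _; apply: le_trans (lerD h1 h2) _.
  by rewrite -mulrDr -[X in _ * (X + _)]E subrK.
have := key n (leqnn _); rewrite [n%:R * _]mulrC divfK ?gt_eqF // => h1.
apply: le_trans h1 _; rewrite mulrAC ler_pdivrMr ?ltr_wpDl //.
by apply: ler_wpM2l; [exact: ltW|rewrite lerDl].
Qed.

Lemma gradient_at_affine n (f : 'rV[R]_n -> R) (a x g : 'rV[R]_n) (r : R) :
  gradient_at f (r *: x + a) g -> gradient_at (fun y => f (r *: y + a)) x (r *: g).
Proof.
move=> /gradient_atP h; apply/gradient_atP => e e0.
have r1 : 0 < `|r| + 1 by rewrite ltr_wpDl.
have [dl dl0 H] := h _ (divr_gt0 e0 r1).
exists (dl / (`|r| + 1)); first by rewrite divr_gt0.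
move=> k; rewrite ltr_pdivlMr // => hk.
have rk : `|r *: k| <= `|k| * (`|r| + 1).
  by rewrite normrZ mulrC ler_wpM2l // lerDl.
have := H (r *: k) (le_lt_trans rk hk).
have -> : r *: (x + k) + a = r *: x + a + r *: k by rewrite scalerDr addrAC.
rewrite dotvZr dotvZl => h1; apply: le_trans h1 _.
apply: (le_trans (ler_wpM2l (ltW (divr_gt0 e0 r1)) rk)).
by rewrite mulrCA divfK ?gt_eqF // mulrC.
Qed.

Lemma divergence_free_affine n (U : set 'rV[R]_n) w (a : 'rV[R]_n) r :
  divergence_free U w -> divergence_free [set x | U (r *: x + a)] (fun x => w (r *: x + a)).
Proof.
move=> [D hD]; exists (fun i x => r *: D i (r *: x + a)) => x /= Ux.
have [h1 h2] := hD _ Ux; split=> [i|].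
  have [h3 h4] := h1 i; split; first exact: (gradient_at_affine (f := fun y => w y 0 i)).
  apply: continuous_at_scale; first exact: cst_continuous.
  exact: (@continuous_affine_comp R _ _ (D i)).
rewrite (eq_bigr (fun i => r * D i (r *: x + a) 0 i)); last by move=> i _; rewrite mxE.
by rewrite -mulr_sumr h2 mulr0.
Qed.

(** This radial weight b is chosen because b(y) y is the gradient of - b(y)^2 / 4. The mean value
    property then follows from [weak_form], without surface integrals. *)
Definition tentball n (y : 'rV[R]_n) : R := pos (1 - dotv y y).

Lemma tentball_continuous n : continuous (@tentball n).
Proof.
move=> y; apply: (@continuous_at_compR _ _ (fun y : 'rV[R]_n => 1 - dotv y y) (@pos R)).
  apply: continuousB; first exact: cst_continuous.
  by apply: (@continuous_at_dotv _ _ _ id id); exact: cvg_id.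
exact: pos_continuous.
Qed.

Lemma tentball_out n (y : 'rV[R]_n) : 1 < `|y| -> tentball y = 0.
Proof.
move=> y1; rewrite /tentball /pos max_r // subr_le0 -enorm_sq.
rewrite -[leLHS](expr1n _ 2); apply: ler_sqr_nneg => //.
by apply: le_trans (ltW y1) _; exact: norm_le_enorm.
Qed.

Lemma tentball_ge0 n (y : 'rV[R]_n) : 0 <= tentball y.
Proof. exact: pos_ge0. Qed.

Lemma tentball_le1 n (y : 'rV[R]_n) : tentball y <= 1.
Proof. by rewrite /tentball /pos ge_max ler01 gerBl dotv_ge0. Qed.

Lemma tentball_cs n : compactly_supported (@tentball n).
Proof. by split; [exact: tentball_continuous|exists 1 => // x; exact: tentball_out]. Qed.

Lemma iint_tentball_gt0 n : 0 < iint (@tentball n).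
Proof.
apply: (iint_gt0 (x := 0)); first exact: tentball_cs.
  exact: tentball_ge0.
by rewrite /tentball dotv0l subr0 /pos max_l ?ltr01.
Qed.

Lemma gradient_at_tentball_sq n (y : 'rV[R]_n) :
  gradient_at (fun y => tentball y ^+ 2) y (-4 * tentball y *: y).
Proof.
have h1 : gradient_at (fun y : 'rV[R]_n => 1 - dotv y y) y (- (2 *: y)).
  have := gradient_atB (gradient_at_cst 1 y) (gradient_at_sqdist 0 y).
  by under eq_fun do rewrite subr0; rewrite subr0 sub0r.
have := gradient_at_comp (is_derive_pos2 (1 - dotv y y)) h1.
by rewrite scalerN scalerA -scaleNr; congr (gradient_at _ _ (_ *: _)); rewrite /tentball; ring.
Qed.

(* r |-> iint (b(y) u(x + r y)) is constant: its derivative is the integral of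
   w(x + r y) . y b(y), and y b(y) is a gradient. *)
Lemma mean_value_tentball n (U : set 'rV[R]_n) (u : 'rV[R]_n -> R) w x r :
  open U -> 0 < r -> (forall z, `|z - x| <= r -> U z) ->
  (forall z, U z -> gradient_at u z (w z)) -> divergence_free U w ->
  compactly_supported (fun y : 'rV[R]_n => tentball y * u (r *: y + x)) /\
  iint (fun y : 'rV[R]_n => tentball y * u (r *: y + x)) = u x * iint (@tentball n).
Proof.
move=> oU r0 hU gu df.
pose Bn := [set y : 'rV[R]_n | `|y| <= 1].
have cB : compact Bn.
  have := @compact_dist_le R n 0 1; congr compact.
  by apply/funext => y /=; rewrite sub0r normrN.
have inU (s : R) (y : 'rV[R]_n) : 0 <= s <= r -> `|y| <= 1 -> U (s *: y + x).
  move=> /andP[s0 sr] y1; apply: hU; rewrite addrK normrZ ger0_norm //.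
  have := normr_ge0 y; nra.
have cu s (y : 'rV[R]_n) : 0 <= s <= r -> `|y| <= 1 -> {for y, continuous (fun y : 'rV[R]_n => u (s *: y + x))}.
  move=> sr y1; apply: (@continuous_affine_comp R _ _ u).
  exact: gradient_at_continuous (gu _ (inU _ _ sr y1)).
have cw z : U z -> {for z, continuous w} by exact: divergence_free_continuous df.
have csF s : 0 <= s <= r -> compactly_supported (fun y : 'rV[R]_n => tentball y * u (s *: y + x)).
  move=> sr; apply: (compactly_supported_ext0 cB (@subset_refl _ _)) => [y /= /negP|y yB].
    by rewrite -ltNge => /tentball_out ->; rewrite mul0r.
  by apply: continuousM; [exact: tentball_continuous|exact: cu].
split; first by apply: csF; rewrite lexx ltW.
(* The derivative of the average at radius [s] vanishes: [weak_form] with [h = 1] and [q] the square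
   of the weight. *)
have W s : 0 <= s <= r -> compactly_supported (fun y : 'rV[R]_n => tentball y * dotv (w (s *: y + x)) y) /\
    iint (fun y : 'rV[R]_n => tentball y * dotv (w (s *: y + x)) y) = 0.
  move=> sr; have BU : Bn `<=` [set y | U (s *: y + x)] by move=> y; exact: inU.
  have g1 (y : 'rV[R]_n) : U (s *: y + x) -> gradient_at (fun=> 1 : R) y 0 /\ {for y, continuous (fun=> 0 : 'rV[R]_n)}.
    by move=> _; split; [exact: gradient_at_cst|exact: cst_continuous].
  have g2 (y : 'rV[R]_n) : U (s *: y + x) -> gradient_at (fun y : 'rV[R]_n => tentball y ^+ 2) y (-4 * tentball y *: y) /\
     {for y, continuous (fun y : 'rV[R]_n => -4 * tentball y *: y)}.
    move=> _; split; first exact: gradient_at_tentball_sq.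
    apply: continuous_at_scale; last exact: cvg_id.
    by apply: continuousM; [exact: cst_continuous|exact: tentball_continuous].
  have out y : ~ Bn y -> ((1 : R) = 0 /\ 0 = 0 :> 'rV[R]_n) \/
      (tentball y ^+ 2 = 0 /\ -4 * tentball y *: y = 0).
    move=> /= /negP; rewrite -ltNge => /tentball_out ->; right.
    by rewrite expr0n mulr0 scale0r.
  have [c1 c2 E] := weak_form cB BU out g1 g2 (divergence_free_affine x s df).
  have EE : (fun y : 'rV[R]_n => tentball y * dotv (w (s *: y + x)) y) =
     fun y : 'rV[R]_n => (- (4^-1)) * (1 * dotv (w (s *: y + x)) (-4 * tentball y *: y)).
    by apply/funext => y; rewrite mul1r dotvZr; field.
  rewrite EE; split; first exact: compactly_supportedZ.
  rewrite iintZ // E.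
  have -> : (fun y : 'rV[R]_n => tentball y ^+ 2 * dotv (w (s *: y + x)) 0) = fun=> 0.
    by apply/funext => y; rewrite dotv0r mulr0.
  by rewrite iint0 oppr0 mulr0.
pose F s := iint (fun y : 'rV[R]_n => tentball y * u (s *: y + x)).
have -> : u x * iint (@tentball n) = F 0.
  rewrite -iintZ; last exact: tentball_cs.
  by congr iint; apply/funext => y; rewrite scale0r add0r mulrC.
apply: (@constant_of_small_increments F r (ltW r0)) => e e0.
pose Kx := [set z : 'rV[R]_n | `|x - z| <= r].
have cK : compact Kx by exact: compact_dist_le.
have wK : {within Kx, continuous w}.
  apply/within_normP => z Kz ep ep0.
  have Uz : U z by apply: hU; rewrite distrC.
  by have /cvg_ballP/(_ ep ep0)[dl dl0 h] := cw z Uz; exists dl => // z' _; exact: h.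
(* The factor [n%:R ^+ 2] bounds an inner product by sup norms, and [2 ^+ n] is the volume of the
   unit cube [|y| <= 1]. *)
pose C := n%:R ^+ 2 * 2 ^+ n + 1 : R.
have C0 : 0 < C by rewrite ltr_wpDl // mulr_ge0 ?exprn_ge0.
have [dl dl0 hd] := compact_unif_cont cK wK (divr_gt0 e0 C0).
exists dl => // s t s0 st tr ts.
have sr : 0 <= s <= r by rewrite s0 (le_trans st tr).
have tr' : 0 <= t <= r by rewrite (le_trans s0 st).
have [cWs iW] := W s sr.
have -> : F t - F s = iint (fun y : 'rV[R]_n => (tentball y * u (t *: y + x) - tentball y * u (s *: y + x))
    - (t - s) * (tentball y * dotv (w (s *: y + x)) y)).
  rewrite !iintB ?iintZ // ?iW ?mulr0 ?subr0 //; try exact: csF.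
    by apply: compactly_supportedB; exact: csF.
  exact: compactly_supportedZ.
have ts0 : 0 <= t - s by rewrite subr_ge0.
apply: (@le_trans _ _ ((t - s) * (n%:R ^+ 2 * (e / C)) * (2 * 1) ^+ n)).
  apply: iint_norm_bound => // [|y y1|y].
  - apply: compactly_supportedB; last exact: compactly_supportedZ.
    by apply: compactly_supportedB; exact: csF.
  - by rewrite tentball_out // !mul0r subrr mulr0 subrr.
  have ec : 0 <= e / C by rewrite ltW // divr_gt0.
  have [y1|y1] := ltP 1 `|y|.
    rewrite tentball_out // !mul0r subrr mulr0 subrr normr0.
    by rewrite mulr_ge0 // mulr_ge0 // exprn_ge0.
  have gl q : 0 <= q <= t - s -> gradient_at u ((s *: y + x) + q *: y) (w ((s *: y + x) + q *: y)).
    move=> /andP[q0 qt]; have -> : s *: y + x + q *: y = (s + q) *: y + x.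
      by rewrite addrAC -scalerDl.
    apply: gu; apply: inU => //; apply/andP; split; first by rewrite addr_ge0.
    by apply: le_trans tr; rewrite addrC -lerBrDr.
  have [q /andP[q0 qt] E] := mean_value ts0 gl.
  have E1 : s *: y + x + (t - s) *: y = t *: y + x by rewrite addrAC -scalerDl addrC [s + _]addrC subrK addrC.
  rewrite E1 in E.
  rewrite -mulrBr E mulrCA -mulrBr -mulrBr -dotvNl -dotvDl normrM ger0_norm //.
  rewrite ler_wpM2l // normrM.
  have b0 := tentball_ge0 y; have b1 := tentball_le1 y.
  rewrite (ger0_norm b0); apply: (@le_trans _ _ (1 * `|dotv (w (s *: y + x + q *: y) - w (s *: y + x)) y|)).
    by rewrite ler_wpM2r.
  rewrite mul1r; apply: le_trans (dotv_le_norm _ _) _.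
apply: (@le_trans _ _ (n%:R ^+ 2 * (e / C) * 1)); last by rewrite mulr1.
  apply: ler_pM => //.
  rewrite ler_wpM2l ?exprn_ge0 //; apply: ltW; apply: hd.
  - rewrite /Kx /= distrC -[_ + q *: y]addrA [x + _]addrC addrA addrK -scalerDl normrZ.
    rewrite ger0_norm ?addr_ge0 //; have : s + q <= r by move: qt tr; clear; lra.
    have := normr_ge0 y; move: y1 s0 q0; clear; nra.
  - rewrite /Kx /= distrC addrK normrZ ger0_norm //.
    have /andP[_ sr2] := sr; have := normr_ge0 y; move: y1 s0 sr2; clear; nra.
  - rewrite addrAC subrr add0r normrZ ger0_norm //.
    by apply: le_lt_trans ts; apply: le_trans qt; rewrite ler_piMr.
have -> : (t - s) * (n%:R ^+ 2 * (e / C)) * (2 * 1) ^+ n = e * (t - s) * ((C - 1) / C).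
  by rewrite mulr1 /C; ring.
rewrite ler_piMr // ?mulr_ge0 //; first exact: ltW.
by rewrite ler_pdivrMr // mul1r gerBl.
Qed.

End MeanValue.

(** * Pointwise bounds and differences of translates *)

Section Estimates.
Variables (R : realType) (d : nat).
Local Notation V := 'rV[R]_d.+1.
Local Notation V' := 'rV[R]_d.
Implicit Types (x z : V) (y : V').
Variable (om : set V').
Hypothesis om_cpt : compact (closure om).
Hypothesis om_C1 : C1_open om.

Let om_open : open om. Proof. by have [] := om_C1. Qed.

(** The weight of the mean value formula, rescaled to radius [r] around [x], is itself admissible
    for [J], so the average of [u] is directly bounded by [J om f]. *)
Lemma neumann_pointwise u w x r f : neumann om u w -> 0 < r ->
  (forall z : V, `|z - x| <= r -> om (tailv z)) -> loc om f ->
  (forall z, om (tailv z) -> 0 <= f z) -> (forall z, `|z - x| <= r -> `|u z| <= f z) ->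
  `|u x| * iint (@tentball R d.+1) * r ^+ d.+1 <= J om f.
Proof.
move=> [gu df _ _ _] r0 hr lf f0 uf.
have [cG iG] := mean_value_tentball (open_cylinder om_open) r0 hr gu df.
have ri : 0 < r^-1 by rewrite invr_gt0.
pose a := - (r^-1 *: x).
have aff := iint_affine a ri cG; have cH := compactly_supported_affine a ri cG.
have E z : r *: (r^-1 *: z + a) + x = z.
  by rewrite /a scalerDr scalerN !scalerA divff ?gt_eqF // !scale1r subrK.
have aE z : r^-1 *: z + a = r^-1 *: (z - x) by rewrite scalerBr.
pose g z := tentball (r^-1 *: z + a).
have gout z : r < `|z - x| -> g z = 0.
  move=> h; apply: tentball_out; rewrite aE normrZ gtr0_norm // mulrC ltr_pdivlMr //.
  by rewrite mul1r.
have ag : adm om g.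
  split.
  - move=> z; apply: (@continuous_affine_comp R _ _ (@tentball R d.+1)).
    exact: tentball_continuous.
  - by move=> z; rewrite tentball_ge0 tentball_le1.
  exists [set y : V' | `|tailv x - y| <= r].
    split; first exact: compact_dist_le.
    move=> y /= h; have := hr (cons_rv (x 0 ord0) y).
    rewrite tailv_cons; apply.
    rewrite -[X in _ - X](cons_rv_tailv x) cons_rvB subrr cons_rv_norm normr0.
    by rewrite ge_max (ltW r0) distrC.
  move=> z /= /negP; rewrite -ltNge => h; apply: gout; apply: lt_le_trans h _.
  by rewrite -tailvB distrC tailv_norm.
have eH : (fun z => tentball (r^-1 *: z + a) * u (r *: (r^-1 *: z + a) + x)) = fun z => g z * u z.
  by apply/funext => z; rewrite E.
rewrite eH in aff cH.
have : `|iint (fun z => g z * u z)| <= J om f.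
  apply: le_trans (J_ub om_cpt ag lf); apply: iint_norm_le => // [|z].
    exact: adm_loc_cs ag lf.
  have g0 := adm_ge0 z ag; rewrite normrM (ger0_norm g0).
  have [zr|zr] := leP `|z - x| r; first by rewrite ler_wpM2l // uf.
  by rewrite gout // !mul0r.
apply: le_trans; rewrite iG in aff.
have c0 := iint_tentball_gt0 R d.+1.
have -> : `|u x| * iint (@tentball R d.+1) = `|u x * iint (@tentball R d.+1)|.
  by rewrite normrM (gtr0_norm c0).
rewrite aff normrM ger0_norm; last by rewrite exprn_ge0 // ltW.
by rewrite exprVn mulrAC mulVf ?mul1r // expf_neq0 // gt_eqF.
Qed.

Lemma sum_sq_le n (a : nat -> R) :
  (\sum_(i < n) a i) ^+ 2 <= n%:R * \sum_(i < n) a i ^+ 2.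
Proof.
elim: n => [|n IH]; first by rewrite !big_ord0 mulr0 expr0n.
rewrite !big_ord_recr /= -natr1; set s := \sum_(i < n) a i in IH *.
set q := \sum_(i < n) _ in IH *.
have [n0|n0] := posnP n.
  have -> : s = 0 by rewrite /s n0 big_ord0.
  have -> : q = 0 by rewrite /q n0 big_ord0.
  by rewrite n0 !add0r mul1r.
have nR : 0 < n%:R :> R by rewrite ltr0n.
have h : 2 * s * a n <= n%:R * a n ^+ 2 + q.
  have : 0 <= (n%:R * a n - s) ^+ 2 by rewrite sqr_ge0.
  rewrite sqrrB exprMn => h1.
  rewrite -(ler_pM2l nR); move: h1 IH; move: (n%:R : R) (a n) => N b; clear; nra.
move: IH h; move: (n%:R : R) (a n) => N b; clear; nra.
Qed.

(* Subdividing the segment and using Cauchy-Schwarz replaces the integral of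
   the derivative along e; the factor 2 absorbs the oscillation of w. *)
Lemma translation_difference u w (e : V) r (g0 : V -> R) (S : set V) (A E : R) :
  neumann om u w -> 0 <= r -> compact S -> continuous g0 ->
  (forall x, 0 <= g0 x) -> (forall x, ~ S x -> g0 x = 0) ->
  (forall x t, S x -> 0 <= t <= r -> om (tailv (x + t *: e)) /\ `|(x + t *: e) 0 ord0| <= A) ->
  (forall t, 0 <= t <= r -> iint (fun z => g0 (z - t *: e) * dotv (w z) (w z)) <= E) ->
  compactly_supported (fun x => g0 x * (u (x + r *: e) - u x) ^+ 2) /\
  iint (fun x => g0 x * (u (x + r *: e) - u x) ^+ 2) <= 2 * r ^+ 2 * dotv e e * E.
Proof.
move=> nw r0 cS cg g00 gS hS hE; have [gu df _ wc bu] := nw.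
have cu t x : 0 <= t <= r -> S x -> {for x, continuous (fun x => u (x + t *: e))}.
  move=> tr Sx; apply: continuous_at_shift; have [ox _] := hS x t Sx tr.
  exact: gradient_at_continuous (gu _ ox).
have cw t x : 0 <= t <= r -> S x -> {for x, continuous (fun x => w (x + t *: e))}.
  move=> tr Sx; apply: continuous_at_shift; have [ox _] := hS x t Sx tr.
  exact: divergence_free_continuous df ox.
have cs_diff s t : 0 <= s <= r -> 0 <= t <= r ->
    compactly_supported (fun x => g0 x * (u (x + s *: e) - u (x + t *: e)) ^+ 2).
  move=> sr tr; apply: (compactly_supported_ext0 cS (@subset_refl _ _)) => [x /gS ->|x Sx].
    by rewrite mul0r.
  apply: continuousM; first exact: cg.
  by apply: continuousM; apply: continuousB; exact: cu.
have csg : compactly_supported g0.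
  by apply: (compactly_supported_ext0 cS (@subset_refl _ _)) => // x _; exact: cg.
have cs_w t : 0 <= t <= r ->
    compactly_supported (fun x => g0 x * dotv (w (x + t *: e)) (w (x + t *: e))).
  move=> tr; apply: (compactly_supported_ext0 cS (@subset_refl _ _)) => [x /gS ->|x Sx].
    by rewrite mul0r.
  apply: continuousM; first exact: cg.
  by apply: (@continuous_at_dotv _ _ _ (fun x => w (x + t *: e)) (fun x => w (x + t *: e))); exact: cw.
have iw t : 0 <= t <= r ->
    iint (fun x => g0 x * dotv (w (x + t *: e)) (w (x + t *: e))) <= E.
  move=> tr; apply: le_trans (hE t tr).
  rewrite -(iint_shift (- (t *: e)) (cs_w t tr)).
  by under eq_fun do rewrite subrK.
have rr : 0 <= r <= r by rewrite r0 lexx.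
have r00 : (0 : R) <= (0 : R) <= r by rewrite lexx r0.
split.
  by have := cs_diff r 0 rr r00; under eq_fun do rewrite scale0r addr0.
apply/ler_addgt0Pr => eta eta0.
pose C := 2 * r ^+ 2 * iint g0 + 1.
have ig0 : 0 <= iint g0 by exact: iint_ge0.
have C0 : 0 < C by rewrite ltr_wpDl // mulr_ge0 // mulr_ge0 // exprn_ge0.
(* [nu] bounds the oscillation of w.e on each piece of the segment: [nu <= 1] gives [nu ^+ 2 <= nu],
   and [nu <= eta / C] makes the accumulated error at most [eta]. *)
have [nu nu0 [nu1 nu2]] : exists2 nu : R, 0 < nu & nu <= 1 /\ nu <= eta / C.
  exists (Num.min 1 (eta / C)); first by rewrite lt_min ltr01 divr_gt0.
  by rewrite !ge_min !lexx orbT.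
have ne1 : 0 < d.+1%:R ^+ 2 * `|e| + 1 by rewrite ltr_wpDl // mulr_ge0 // exprn_ge0.
have cK := compact_box (A := A) om_cpt.
have [dl dl0 hdl] := compact_unif_cont cK (@cyl_within_box R d om w wc A) (divr_gt0 nu0 ne1).
have e1 : 0 < `|e| + 1 by rewrite ltr_wpDl.
have [n n0 hn] := fine_subdivision r0 (divr_gt0 dl0 e1).
have nR : 0 < n%:R :> R by rewrite ltr0n.
pose h := r / n%:R.
have h0 : 0 <= h by rewrite divr_ge0 // ltW.
have nh : n%:R * h = r by rewrite /h mulrC divfK // gt_eqF.
have hk (k : nat) : (k <= n)%N -> 0 <= k%:R * h <= r.
  by move=> kn; rewrite mulr_ge0 //= -nh ler_wpM2r // ler_nat.
pose a (i : nat) x := u (x + (i.+1%:R * h) *: e) - u (x + (i%:R * h) *: e).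
have tel x : u (x + r *: e) - u x = \sum_(i < n) a i x.
  have -> : \sum_(i < n) a i x = u (x + (n%:R * h) *: e) - u (x + (0%:R * h) *: e).
    rewrite -(big_mkord xpredT (fun i => a i x)).
    by rewrite (@telescope_sumr _ 0 n (fun i => u (x + (i%:R * h) *: e))).
  by rewrite nh mul0r scale0r addr0.
have ca (i : 'I_n) : compactly_supported (fun x => g0 x * a i x ^+ 2).
  by apply: cs_diff; apply: hk; [exact: ltn_ord|exact: ltnW].
have cwi (i : 'I_n) := cs_w _ (hk i (ltnW (ltn_ord i))).
have ai (i : 'I_n) : iint (fun x => g0 x * a i x ^+ 2) <=
    h ^+ 2 * (2 * dotv e e * E + 2 * nu ^+ 2 * iint g0).
  apply: (@le_trans _ _ (iint (fun x => h ^+ 2 * (2 * dotv e e *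
     (g0 x * dotv (w (x + (i%:R * h) *: e)) (w (x + (i%:R * h) *: e)))
     + 2 * nu ^+ 2 * g0 x)))).
    apply: iint_le => [||x]; first exact: ca.
      apply: compactly_supportedZ; apply: compactly_supportedD; exact: compactly_supportedZ.
    have [Sx|/gS ->] := pselect (S x); last by rewrite !(mul0r, mulr0) addr0 mulr0.
    have gl q : 0 <= q <= h -> gradient_at u ((x + (i%:R * h) *: e) + q *: e)
        (w ((x + (i%:R * h) *: e) + q *: e)).
      move=> /andP[q0 qh]; rewrite -addrA -scalerDl.
      have [|oz _] := hS x (i%:R * h + q) Sx; last exact: gu.
      have /andP[h1 h2] := hk i.+1 (ltn_ord i); rewrite addr_ge0 ?mulr_ge0 //=.
      by apply: le_trans h2; rewrite -natr1 mulrDl mul1r lerD2l.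
    have [q /andP[q0 qh]] := mean_value h0 gl.
    have -> : x + (i%:R * h) *: e + h *: e = x + (i.+1%:R * h) *: e.
      by rewrite -addrA -scalerDl -natr1 mulrDl mul1r.
    rewrite -/(a i x) => ->.
    set p := x + (i%:R * h) *: e.
    have [op pA] := hS x _ Sx (hk i (ltnW (ltn_ord i))).
    have [oq qA] : om (tailv (p + q *: e)) /\ `|(p + q *: e) 0 ord0| <= A.
      rewrite /p -addrA -scalerDl; apply: hS => //.
      have /andP[h1 h2] := hk i.+1 (ltn_ord i); rewrite addr_ge0 ?mulr_ge0 //=.
      by apply: le_trans h2; rewrite -natr1 mulrDl mul1r lerD2l.
    have wd : `|w (p + q *: e) - w p| < nu / (d.+1%:R ^+ 2 * `|e| + 1).
      apply: hdl; [by split => //; exact: subset_closure|by split => //; exact: subset_closure|].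
      rewrite addrAC subrr add0r normrZ ger0_norm //.
      apply: (@le_lt_trans _ _ (h * (`|e| + 1))).
        by apply: ler_pM => //; rewrite lerDl.
      by rewrite -ltr_pdivlMr.
    have dd : `|dotv (w (p + q *: e)) e - dotv (w p) e| <= nu.
      rewrite -dotvNl -dotvDl; apply: le_trans (dotv_le_norm _ _) _.
      have := ltW wd; rewrite ler_pdivlMr // => wd'; apply: le_trans wd'.
      by rewrite mulrAC mulrC mulrDr mulr1 ler_wpDr.
    have CS := cauchy_schwarz (w p) e.
    rewrite exprMn mulrCA; apply: ler_wpM2l; first by rewrite sqr_ge0.
    have g0x := g00 x.
    move: dd CS g0x; rewrite ler_norml => /andP[].
    move: (dotv (w (p + _)) e) (dotv (w p) e) (dotv (w p) (w p)) (dotv e e) (g0 x).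
    move=> b c W D G d1 d2 CS G0; move: nu0 d1 d2 CS G0; clear => nu0 d1 d2 CS G0.
    have key : b ^+ 2 <= 2 * D * W + 2 * nu ^+ 2.
      apply: (@le_trans _ _ (2 * c ^+ 2 + 2 * nu ^+ 2)); last by lra.
      have s1 : (b - c) ^+ 2 <= nu ^+ 2.
        by rewrite -subr_ge0 subr_sqr mulr_ge0 //; lra.
      have s2 : 0 <= (b - 2 * c) ^+ 2 by rewrite sqr_ge0.
      by lra.
    have := ler_wpM2l G0 key; lra.
  rewrite iintZ; last by apply: compactly_supportedD; exact: compactly_supportedZ.
  rewrite iintD ?iintZ //; try exact: compactly_supportedZ.
  apply: ler_wpM2l; first exact: sqr_ge0.
  rewrite lerD2r; apply: ler_wpM2l; last exact/iw/hk/ltnW.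
  by rewrite mulr_ge0 // dotv_ge0.
have [csum isum] := iint_sum ca.
apply: (@le_trans _ _ (iint (fun x => n%:R * \sum_(i < n) (g0 x * a i x ^+ 2)))).
  apply: iint_le => [||x].
  - by have := cs_diff r 0 rr r00; under eq_fun do rewrite scale0r addr0.
  - exact: compactly_supportedZ.
  rewrite tel -mulr_sumr [leRHS]mulrCA; apply: ler_wpM2l => //; exact: (sum_sq_le n (a ^~ x)).
rewrite iintZ // isum.
apply: (@le_trans _ _ (n%:R * (n%:R * (h ^+ 2 * (2 * dotv e e * E + 2 * nu ^+ 2 * iint g0))))).
  apply: ler_wpM2l; first exact: ler0n.
  apply: le_trans (ler_sum _ (fun i _ => ai i)) _.
  by rewrite sumr_const card_ord [leRHS]mulr_natl.
have -> : n%:R * (n%:R * (h ^+ 2 * (2 * dotv e e * E + 2 * nu ^+ 2 * iint g0))) =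
   (n%:R * h) ^+ 2 * (2 * dotv e e * E + 2 * nu ^+ 2 * iint g0) by ring.
rewrite nh.
have nunu : nu ^+ 2 <= nu by rewrite expr2 ler_piMl // ltW.
have B : 2 * r ^+ 2 * iint g0 * nu ^+ 2 <= eta.
  apply: (@le_trans _ _ (C * (eta / C))); last by rewrite mulrC divfK // gt_eqF.
  apply: ler_pM; rewrite ?sqr_ge0 ?mulr_ge0 ?sqr_ge0 //; last exact: le_trans nunu nu2.
  by rewrite /C lerDl.
lra.
Qed.

End Estimates.

(** * A Nash inequality up to the C^1 boundary *)

Section Nash.
Variables (R : realType) (d : nat).
Local Notation V := 'rV[R]_d.+1.
Local Notation V' := 'rV[R]_d.
Implicit Types (x : V) (y z e : V').
Variable (om : set V').
Hypothesis om_cpt : compact (closure om).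
Hypothesis om_C1 : C1_open om.

Let om_open : open om. Proof. by have [] := om_C1. Qed.

(* Inner cone condition with axis e (and e = 0 at interior points z). *)
Definition patch z (r : R) e (sg : R) : Prop :=
  [/\ 0 < r <= 1, 0 < sg <= 1, `|e| <= 1 &
   forall y t, om y -> `|z - y| <= r -> 0 <= t <= r -> om (y + t *: e) /\
     forall y', 0 < t -> `|y' - (y + t *: e)| <= sg * t -> om y'].

Lemma patch_exists z : closure om z -> exists r e sg, patch z r e sg.
Proof.
move=> cz; have [oz|nz] := pselect (om z).
  have [r r0 hr] := iffLR (open_normP _) om_open z oz.
  have m0 : 0 < Num.min (r / 4) 1 by rewrite lt_min divr_gt0 ?ltr01.
  exists (Num.min (r / 4) 1), 0, 1; split.
  - by rewrite m0 ge_min lexx orbT.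
  - by rewrite ltr01 lexx.
  - by rewrite normr0 ler01.
  move=> y t oy; rewrite le_min => /andP[zy _]; rewrite le_min => /and3P[t0 t1 _].
  rewrite scaler0 addr0; split => // y' _; rewrite mul1r => h; apply: hr.
  have := ler_normD (z - y) (y - y'); rewrite addrA subrK (distrC y y'); lra.
have [r [rho [e [m [G ch]]]]] := chart_exists om_C1 (conj cz nz).
have [r0 m0 C1 e1 H] := ch.
(* [D] bounds the variation of [rho] per unit of sup norm. Moving by [t] along [- e] lowers [rho] by
   at least [m * t], so a ball of radius [m / D * t] around the end point stays in [om]. *)
pose D := d%:R ^+ 2 * `|G| + 1.
have D0 : 0 < D by rewrite ltr_wpDl // mulr_ge0 // exprn_ge0.
have s0 : 0 < Num.min 1 (m / D) by rewrite lt_min ltr01 divr_gt0.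
have R0 : 0 < Num.min (r / 8) 1 by rewrite lt_min divr_gt0 ?ltr01.
exists (Num.min (r / 8) 1), (- e), (Num.min 1 (m / D)); split.
- by rewrite R0 ge_min lexx orbT.
- by rewrite s0 ge_min lexx.
- by rewrite normrN.
move=> y t oy; rewrite le_min => /andP[zy _]; rewrite le_min => /and3P[t0 t1 _].
set y1 := y + t *: - e.
have te : `|t *: e| <= t by rewrite normrZ ger0_norm // ler_piMr.
have zy1 : `|z - y1| <= r / 4.
  rewrite /y1 scalerN opprD opprK addrA; apply: le_trans (ler_normD _ _) _; lra.
have E1 : y1 + t *: e = y by rewrite /y1 scalerN subrK.
have L : rho y1 + m * t <= rho y.
  by rewrite -E1; apply: (chart_line ch t0); lra.
have ry : rho y < 0.
  by have [h _ _] := H y (ltac:(lra) : `|z - y| < r); apply/h.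
have mt : 0 <= m * t by rewrite mulr_ge0 // ltW.
split; first by have [h _ _] := H y1 (ltac:(lra) : `|z - y1| < r); apply/h; lra.
move=> y' tp; rewrite minr_pMl // mul1r le_min => /andP[h1 h2].
have zy' : `|z - y'| < r.
  have := ler_normD (z - y1) (y1 - y'); rewrite addrA subrK (distrC y1 y'); lra.
have gl s : 0 <= s <= 1 -> gradient_at rho (y1 + s *: (y' - y1)) (grad rho (y1 + s *: (y' - y1))).
  move=> /andP[s0' s1]; apply: (chart_gradient ch).
  rewrite opprD addrA; apply: le_lt_trans (ler_normB _ _) _.
  rewrite normrZ ger0_norm //; have := normr_ge0 (y' - y1); nra.
have [s /andP[s0' s1]] := mean_value ler01 gl.
have -> : y1 + 1 *: (y' - y1) = y' by rewrite scale1r addrC subrK.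
rewrite mul1r => E.
have zs : `|z - (y1 + s *: (y' - y1))| < r.
  rewrite opprD addrA; apply: le_lt_trans (ler_normB _ _) _.
  rewrite normrZ ger0_norm //; have := normr_ge0 (y' - y1); nra.
have [_ _ hG] := H _ zs.
have [h _ _] := H y' zy'; apply/h.
have B : dotv (grad rho (y1 + s *: (y' - y1))) (y' - y1) <= m * t.
  apply: le_trans (ler_norm _) _; apply: le_trans (dotv_le_norm _ _) _.
  apply: (@le_trans _ _ (D * (m / D * t))); last first.
    by rewrite mulrA [D * _]mulrC divfK ?gt_eqF.
  apply: ler_pM => //; rewrite /D; apply: le_trans (_ : d%:R ^+ 2 * `|G| <= _); last by rewrite lerDl.
  by rewrite ler_wpM2l ?exprn_ge0 //; apply: le_trans hG (ler_norm _).
have : rho y' = rho y1 + dotv (grad rho (y1 + s *: (y' - y1))) (y' - y1).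
  by rewrite -E addrC subrK.
lra.
Qed.

(** The room of 1 in x_1 between the heights where [phi] is nonzero and those where [f] dominates
    [|u|] accommodates the balls of the mean value estimate, of radius at most 1. *)
Definition nash_data u w (phi : R -> R) (B : R) f : Prop :=
  [/\ neumann om u w, continuous phi, forall t, 0 <= phi t <= 1,
      forall t, B < `|t| -> phi t = 0 &
      [/\ loc om f, forall x, om (tailv x) -> 0 <= f x &
          forall x s, om (tailv x) -> phi s != 0 -> `|s - x 0 ord0| <= 1 -> `|u x| <= f x]].

(** A Nash inequality localized by a weight of the cross-section, with the scale [t] left free. [C]
    and [R0] depend neither on [u] nor on [t], and the property is additive in the weight, so it can
    be proved patch by patch. *)
Definition nash_weight (Xi : V' -> R) : Prop :=
  [/\ continuous Xi, exists M, forall y, om y -> `|Xi y| <= M &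
   exists C R0 : R, [/\ 0 < C, 0 < R0 &
     forall u w phi B f t, nash_data u w phi B f -> 0 < t <= R0 ->
     J om (fun x => phi (x 0 ord0) * Xi (tailv x) * u x ^+ 2) <=
     C * (t ^+ 2 * J om (fun x => phi (x 0 ord0) * dotv (w x) (w x)) +
          (t ^+ d.+1)^-1 * J om f ^+ 2)]].

Lemma compact_shift (K : set V') (a : V') : compact K -> compact [set y | K (y - a)].
Proof.
move=> /compact_normP[/closed_normP cK [B hB]]; apply/compact_normP; split.
  apply/closed_normP => y h; apply: cK => r r0; have [u [Ku yu]] := h r r0.
  exists (u - a); split => //.
  by rewrite opprB addrA subrK.
exists (B + `|a|) => y /hB h; have := ler_normD (y - a) a; rewrite subrK; lra.
Qed.

(** Compare [u x] with its value at [x + t e], pushed inward. The difference is paid for by the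
    energy, with factor [t ^+ 2]. At the pushed point the cone condition leaves a ball of radius
    [sg * t] in [om], so the mean value property bounds that value by [P]; the square of the pushed
    function is then at most [P] times its modulus. *)
Lemma nash_patch z r e sg : patch z r e sg ->
  nash_weight (fun y => step (2 - `|z - y| * (2 / r))).
Proof.
move=> [/andP[r0 r1] /andP[s0 s1] e1 H].
pose xi y := step (2 - `|z - y| * (2 / r)).
have cxi : continuous xi.
  move=> y; apply: (@continuous_at_compR _ _ (fun y => 2 - `|z - y| * (2 / r)) (@step R)).
    apply: continuousB; first exact: cst_continuous.
    by apply: continuousM; [exact: norm_continuous_dist|exact: cst_continuous].
  exact: step_continuous.
have xi01 y : 0 <= xi y <= 1 by rewrite step_ge0 step_le1.
have xiout y : r < `|z - y| -> xi y = 0.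
  move=> h; apply: step_le0; have : r * (2 / r) <= `|z - y| * (2 / r).
    by apply: ler_wpM2r; [rewrite ltW // divr_gt0|exact: ltW].
  have -> : r * (2 / r) = 2 by field; rewrite gt_eqF.
  lra.
split => //.
  by exists 1 => y _; have /andP[a b] := xi01 y; rewrite ger0_norm.
pose c0 := iint (@tentball R d.+1).
have c00 : 0 < c0 by exact: iint_tentball_gt0.
have sd : 0 < c0 * sg ^+ d.+1 by rewrite mulr_gt0 // exprn_gt0.
exists (4 * d%:R ^+ 2 + 2 / (c0 * sg ^+ d.+1) + 1), r.
have Cp : 0 < 4 * d%:R ^+ 2 + 2 / (c0 * sg ^+ d.+1) + 1.
  rewrite ltr_wpDl //; apply: addr_ge0; first by rewrite mulr_ge0 // exprn_ge0.
  by rewrite ltW // divr_gt0.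
split => // u w phi B f t [nw cp p01 pB [lf f0 uf]] /andP[t0 tr].
have [gu df _ wc bu] := nw.
have lphi : loc om (fun x => phi (x 0 ord0)) by exact: (loc_head om cp pB).
have bxi : box_bounded om (fun x => xi (tailv x)).
  apply: box_bounded_tail => //.
  by exists 1 => y _; have /andP[a b] := xi01 y; rewrite ger0_norm.
have bu2 : box_bounded om (fun x => u x ^+ 2) by exact: box_boundedM.
have lE : loc om (fun x => phi (x 0 ord0) * dotv (w x) (w x)).
  by apply: locM => //; exact: neumann_sq nw.
have lu : loc om (fun x => phi (x 0 ord0) * `|u x|).
  by apply: locM => //; exact: box_bounded_norm.
have lL : loc om (fun x => phi (x 0 ord0) * xi (tailv x) * u x ^+ 2).
  by apply: locM => //; exact: locM.
set E := J om (fun x => phi (x 0 ord0) * dotv (w x) (w x)); set L := J om f.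
have E0 : 0 <= E by exact: J_ge0.
have L0 : 0 <= L by exact: J_ge0.
apply: J_le => // g ag.
pose e' : V := cons_rv 0 e.
have tE x (s : R) : tailv (x + s *: e') = tailv x + s *: e by rewrite tailvD tailvZ tailv_cons.
have hE x (s : R) : (x + s *: e') 0 ord0 = x 0 ord0.
  by rewrite mxE [X in _ + X]mxE cons_rv0 mulr0 addr0.
have tN x (s : R) : tailv (x - s *: e') = tailv x - s *: e by rewrite -!scaleNr tE.
have hN x (s : R) : (x - s *: e') 0 ord0 = x 0 ord0 by rewrite -!scaleNr hE.
have [cg g01 [K [cK Ko] gK]] := ag.
pose k x := g x * xi (tailv x).
have ck x : {for x, continuous k}.
  apply: (@continuousM _ _ g (fun x => xi (tailv x))); first exact: cg.
  by apply: continuous_at_tailv; exact: cxi.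
have k01 x : 0 <= k x <= 1.
  have /andP[a b] := g01 x; have /andP[a' b'] := xi01 (tailv x).
  by rewrite /k mulr_ge0 //= mulr_ile1.
pose S' := [set y | K y /\ `|z - y| <= r].
have cS' : compact S'.
  have [clK [M hM]] := iffLR (compact_normP _) cK.
  have [clB _] := iffLR (compact_normP _) (@compact_dist_le R d z r).
  apply/compact_normP; split; first by apply: closedI.
  by exists M => y [/hM].
have kS x : ~ S' (tailv x) -> k x = 0.
  move=> nS; have [Kx|/gK gx] := pselect (K (tailv x)); last by rewrite /k gx mul0r.
  rewrite /k xiout ?mulr0 // ltNge; apply/negP => zx; exact: nS.
have S'o y (s : R) : S' y -> 0 <= s <= t -> om (y + s *: e).
  move=> [Ky zy] /andP[s0' st]; have [|h _] := H y s (Ko _ Ky) zy; last exact: h.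
  by rewrite s0' (le_trans st tr).
have ak (s : R) : 0 <= s <= t -> adm om (fun x => k (x - s *: e')).
  move=> st; split.
  - by move=> x; apply: continuous_at_shift; exact: ck.
  - by move=> x; exact: k01.
  exists [set y | S' (y - s *: e)].
    split; first exact: compact_shift.
    by move=> y /= h; have := S'o _ s h st; rewrite subrK.
  by move=> x nS; apply: kS; rewrite tN.
pose g0 x := k x * phi (x 0 ord0).
pose S := box S' B.
have g00 x : 0 <= g0 x.
  by have /andP[a _] := k01 x; have /andP[b _] := p01 (x 0 ord0); rewrite mulr_ge0.
have cg0 x : {for x, continuous g0}.
  by apply: (@continuousM _ _ k (fun x => phi (x 0 ord0))); [exact: ck|apply: continuous_at_head; exact: cp].
have g0S x : ~ S x -> g0 x = 0.
  move=> nS; have [Sx|/kS kx] := pselect (S' (tailv x)); last by rewrite /g0 kx mul0r.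
  by rewrite /g0 pB ?mulr0 // ltNge; apply/negP => xB; exact: nS.
have hS x (s : R) : S x -> 0 <= s <= t -> om (tailv (x + s *: e')) /\ `|(x + s *: e') 0 ord0| <= B.
  by move=> [xB Sx] st; rewrite tE hE; split => //; exact: S'o.
have hEE (s : R) : 0 <= s <= t -> iint (fun x => g0 (x - s *: e') * dotv (w x) (w x)) <= E.
  move=> st; have -> : (fun x => g0 (x - s *: e') * dotv (w x) (w x)) =
      fun x => k (x - s *: e') * (phi (x 0 ord0) * dotv (w x) (w x)).
    by apply/funext => x; rewrite /g0 hN mulrA.
  exact: (J_ub om_cpt (ak s st) lE).
have [csD iD] := translation_difference om_cpt nw (ltW t0) (compact_box (A := B) cS') cg0 g00 g0S hS hEE.
have tt : 0 <= t <= t by rewrite lexx ltW.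
have cH := adm_loc_cs (ak t tt) lu.
have cU : compactly_supported (fun x => g0 x * `|u (x + t *: e')|).
  have := compactly_supported_shift (t *: e') cH.
  congr compactly_supported; apply/funext => x.
  by rewrite addrK hE /g0 mulrA.
have iU : iint (fun x => g0 x * `|u (x + t *: e')|) <= L.
  apply: le_trans (J_ub om_cpt (ak t tt) lf).
  have -> : iint (fun x => g0 x * `|u (x + t *: e')|) =
     iint (fun x => k (x - t *: e') * (phi (x 0 ord0) * `|u x|)).
    rewrite -(iint_shift (t *: e') cH); congr iint; apply/funext => x.
    by rewrite addrK hE /g0 mulrA.
  apply: iint_le => [||x]; [exact: cH|exact: adm_loc_cs (ak t tt) lf|].
  have [ox|nx] := pselect (om (tailv x)); last by rewrite (adm_out (ak t tt) nx) !mul0r.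
  apply: ler_wpM2l; first exact: adm_ge0 (ak t tt).
  have /andP[a b] := p01 (x 0 ord0).
  have [p0|pn] := eqVneq (phi (x 0 ord0)) 0; first by rewrite p0 mul0r f0.
  apply: (@le_trans _ _ `|u x|); first by rewrite ler_piMl.
  by apply: (uf x _ ox pn); rewrite subrr normr0.
have st0 : 0 < sg * t by rewrite mulr_gt0.
(* The pointwise bound from [neumann_pointwise] on a ball of radius [sg * t]; it produces the factor
   [(t ^+ d.+1)^-1] when multiplied by the L^1 norm [L]. *)
pose P := L / (c0 * (sg * t) ^+ d.+1).
have Pp : 0 < c0 * (sg * t) ^+ d.+1 by rewrite mulr_gt0 // exprn_gt0.
have P0 : 0 <= P by rewrite divr_ge0 // ltW.
have up x : S x -> phi (x 0 ord0) != 0 -> `|u (x + t *: e')| <= P.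
  move=> [xB [Kx zx]] pn.
  have [|om1 om2] := H (tailv x) t (Ko _ Kx) zx; first by rewrite ltW.
  rewrite /P ler_pdivlMr // mulrA.
  have zz (v : V) : `|v - (x + t *: e')| <= sg * t -> om (tailv v).
    move=> h; apply: om2 => //; apply: le_trans h.
    by rewrite -tE -tailvB tailv_norm.
  apply: (neumann_pointwise om_cpt om_C1 nw st0) => // v hv.
  apply: (uf v _ (zz v hv) pn).
  have := coord_le_norm (v - (x + t *: e')) ord0.
  have -> : (v - (x + t *: e')) 0 ord0 = v 0 ord0 - x 0 ord0 by rewrite mxE [X in _ + X]mxE hE.
  rewrite distrC => h1; apply: le_trans h1 (le_trans hv _).
  have : t <= 1 by apply: le_trans tr r1.
  by move: s0 s1 t0; nra.
have cM := adm_loc_cs ag lL.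
have main : iint (fun x => g x * (phi (x 0 ord0) * xi (tailv x) * u x ^+ 2)) <=
   2 * iint (fun x => g0 x * (u (x + t *: e') - u x) ^+ 2) +
   2 * P * iint (fun x => g0 x * `|u (x + t *: e')|).
  rewrite -!iintZ // -iintD; try exact: compactly_supportedZ.
  apply: iint_le => [||x]; [exact: cM|apply: compactly_supportedD; exact: compactly_supportedZ|].
  have -> : g x * (phi (x 0 ord0) * xi (tailv x) * u x ^+ 2) = g0 x * u x ^+ 2.
    by rewrite /g0 /k; ring.
  have [->|gn] := eqVneq (g0 x) 0; first by rewrite !mul0r !mulr0 addr0.
  have Sx : S x by apply: contrapT => /g0S gx; rewrite gx eqxx in gn.
  have pn : phi (x 0 ord0) != 0 by apply: contraNneq gn => px; rewrite /g0 px mulr0.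
  have := up x Sx pn; have := g00 x; have := normr_ge0 (u (x + t *: e')).
  have := real_normK (num_real (u (x + t *: e'))).
  move: (g0 x) (u (x + _)) (u x) (P) => a b c p Eb b0 a0 bp.
  have : c ^+ 2 <= 2 * (b - c) ^+ 2 + 2 * (p * `|b|).
    have h1 : b ^+ 2 <= p * `|b| by rewrite -Eb expr2 ler_wpM2r.
    have h2 : 0 <= (2 * b - c) ^+ 2 by rewrite sqr_ge0.
    have : 2 * (b - c) ^+ 2 + 2 * b ^+ 2 - c ^+ 2 = (2 * b - c) ^+ 2 by ring.
    lra.
  move=> /(ler_wpM2l a0) h; apply: le_trans h _.
  by rewrite le_eqVlt; apply/orP; left; apply/eqP; ring.
apply: (le_trans main).
have ee : dotv e' e' <= d%:R ^+ 2.
  rewrite dotv_cons_tailv tailv_cons -enorm_sq; apply: ler_sqr_nneg; first exact: enorm_ge0.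
  by apply: le_trans (enorm_le_norm _) _; rewrite ler_piMr.
have b1 : 2 * iint (fun x => g0 x * (u (x + t *: e') - u x) ^+ 2) <= 4 * d%:R ^+ 2 * (t ^+ 2 * E).
  have h1 : 2 * t ^+ 2 * dotv e' e' * E <= 2 * t ^+ 2 * d%:R ^+ 2 * E.
    by apply: ler_wpM2r => //; apply: ler_wpM2l => //; rewrite mulr_ge0 // sqr_ge0.
  have h2 := le_trans iD h1.
  have -> : 4 * d%:R ^+ 2 * (t ^+ 2 * E) = 2 * (2 * t ^+ 2 * d%:R ^+ 2 * E) by ring.
  by rewrite ler_pM2l.
have b2 : 2 * P * iint (fun x => g0 x * `|u (x + t *: e')|) <=
    2 / (c0 * sg ^+ d.+1) * ((t ^+ d.+1)^-1 * L ^+ 2).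
  apply: (@le_trans _ _ (2 * P * L)); first by rewrite ler_wpM2l // mulr_ge0.
  rewrite le_eqVlt; apply/orP; left; apply/eqP; rewrite /P exprMn; field.
  by rewrite !gt_eqF ?exprn_gt0.
have p1 : 0 <= t ^+ 2 * E by rewrite mulr_ge0 // sqr_ge0.
have p2 : 0 <= (t ^+ d.+1)^-1 * L ^+ 2.
  by rewrite mulr_ge0 ?sqr_ge0 // invr_ge0 exprn_ge0 // ltW.
have q1 : 0 <= 2 / (c0 * sg ^+ d.+1) by rewrite ltW // divr_gt0.
have q2 : 0 <= 4 * d%:R ^+ 2 :> R by rewrite mulr_ge0 // exprn_ge0.
apply: le_trans (lerD b1 b2) _.
move: (t ^+ 2 * E) ((t ^+ d.+1)^-1 * L ^+ 2) (2 / (c0 * sg ^+ d.+1)) (4 * d%:R ^+ 2) p1 p2 q1 q2 => a b c q p1 p2 q1 q2.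
rewrite -subr_ge0.
have -> : (q + c + 1) * (a + b) - (q * a + c * b) = q * b + c * a + (a + b) by ring.
by rewrite !addr_ge0 // mulr_ge0.
Qed.

End Nash.

(** * Absorbing the energy: a local L^1-L^2 estimate *)

Section LocalL2.
Variables (R : realType) (d : nat).
Local Notation V := 'rV[R]_d.+1.
Local Notation V' := 'rV[R]_d.
Implicit Types (x : V) (y z e : V').
Variable (om : set V').
Hypothesis om_cpt : compact (closure om).
Hypothesis om_C1 : C1_open om.

Lemma nash_data_loc u w phi B f : nash_data om u w phi B f ->
  loc om (fun x => phi (x 0 ord0) * dotv (w x) (w x)) /\ loc om (fun x => phi (x 0 ord0) * u x ^+ 2).
Proof.
move=> [nw cp p01 pB _]; have [_ _ _ _ bu] := nw.
have lphi : loc om (fun x => phi (x 0 ord0)) by exact: (loc_head om cp pB).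
split; first by apply: locM => //; exact: neumann_sq nw.
by apply: locM => //; exact: box_boundedM.
Qed.

Lemma nash_weight0 : nash_weight om (fun=> 0).
Proof.
split; first by move=> y; exact: cst_continuous.
  by exists 0 => y _; rewrite normr0.
exists 1, 1; split => // u w phi B f t nd /andP[t0 t1].
have [lE lu] := nash_data_loc nd; have [_ _ _ _ [lf _ _]] := nd.
rewrite mul1r; apply: (@le_trans _ _ 0); last first.
  apply: addr_ge0; apply: mulr_ge0; rewrite ?sqr_ge0 ?J_ge0 //.
  by rewrite invr_ge0 exprn_ge0 // ltW.
apply: J_le => // [|g ag].
  have := locZ 0 lu; by under eq_fun do rewrite mul0r; under [X in _ -> loc _ X]eq_fun do rewrite mulr0 mul0r.
by under eq_fun do rewrite mulr0 mul0r mulr0; rewrite iint0.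
Qed.

Lemma nash_weightD X1 X2 : nash_weight om X1 -> nash_weight om X2 ->
  nash_weight om (fun y => X1 y + X2 y).
Proof.
move=> [c1 [M1 b1] [C1 [R1 [C10 R10 H1]]]] [c2 [M2 b2] [C2 [R2 [C20 R20 H2]]]]; split.
- by move=> y; apply: (@continuousD _ _ _ X1 X2); [exact: c1|exact: c2].
- exists (M1 + M2) => y oy; apply: le_trans (ler_normD _ _) _.
  by apply: lerD; [exact: b1|exact: b2].
exists (C1 + C2), (Num.min R1 R2); split; [by rewrite addr_gt0|by rewrite lt_min R10|].
move=> u w phi B f t nd; rewrite le_min => /and3P[t0 t1 t2].
have [lE lu] := nash_data_loc nd; have [_ _ _ _ [lf _ _]] := nd.
have lX (X : V' -> R) M : continuous X -> (forall y, om y -> `|X y| <= M) ->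
    loc om (fun x => phi (x 0 ord0) * X (tailv x) * u x ^+ 2).
  move=> cX bX; have := locMr (box_bounded_tail cX (ex_intro _ M bX)) lu.
  by under eq_fun do rewrite mulrCA mulrA.
have -> : (fun x => phi (x 0 ord0) * (X1 (tailv x) + X2 (tailv x)) * u x ^+ 2) =
   fun x => phi (x 0 ord0) * X1 (tailv x) * u x ^+ 2 + phi (x 0 ord0) * X2 (tailv x) * u x ^+ 2.
  by apply/funext => x; ring.
apply: le_trans (J_add om_cpt (lX _ _ c1 b1) (lX _ _ c2 b2)) _.
rewrite mulrDl; apply: lerD.
  by apply: H1 nd _; rewrite t0.
by apply: H2 nd _; rewrite t0.
Qed.

Lemma nash_global : exists C R0 : R, [/\ 0 < C, 0 < R0 &
  forall u w phi B f t, nash_data om u w phi B f -> 0 < t <= R0 ->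
  J om (fun x => phi (x 0 ord0) * u x ^+ 2) <=
  C * (t ^+ 2 * J om (fun x => phi (x 0 ord0) * dotv (w x) (w x)) +
       (t ^+ d.+1)^-1 * J om f ^+ 2)].
Proof.
have /choice[rad hrad] : forall z, exists r : R, closure om z -> exists e sg, patch om z r e sg.
  move=> z; have [cz|ncz] := pselect (closure om z); last by exists 0.
  by have [r [e [sg p]]] := patch_exists om_C1 cz; exists r => _; exists e, sg.
have rad0 z : closure om z -> 0 < rad z / 2.
  by move=> /hrad[e [sg [/andP[r0 _] _ _ _]]]; rewrite divr_gt0.
have [s sb cov] := compact_finite_cover om_cpt rad0.
pose xi z y := step (2 - `|z - y| * (2 / rad z)).
pose Xi (s : seq V') y := \sum_(z <- s) xi z y.
have NW : nash_weight om (Xi s).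
  elim: s sb {cov} => [|z s IH] sb.
    have -> : Xi [::] = fun=> 0 by apply/funext => y; rewrite /Xi big_nil.
    exact: nash_weight0.
  have -> : Xi (z :: s) = fun y => xi z y + Xi s y.
    by apply/funext => y; rewrite /Xi big_cons.
  apply: nash_weightD; last by apply: IH => v vs; apply: sb; rewrite inE vs orbT.
  have [e [sg p]] := hrad z (sb z (mem_head _ _)).
  exact (nash_patch om_cpt om_C1 p).
have Xi1 y : om y -> 1 <= Xi s y.
  move=> oy; have [z zs zy] := cov y (subset_closure oy).
  rewrite /Xi (big_rem z) //=.
  have r0 := rad0 z (sb z zs).
  have -> : xi z y = 1.
    apply: step_ge1; have : `|z - y| * (2 / rad z) <= rad z / 2 * (2 / rad z).
      by apply: ler_wpM2r; [rewrite ltW // divr_gt0 //; lra|exact: ltW].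
    have -> : rad z / 2 * (2 / rad z) = 1 by field; rewrite gt_eqF //; lra.
    lra.
  by rewrite lerDl; apply: sumr_ge0 => v _; exact: step_ge0.
have [cX [M bX] [C [R0 [C0 R00 H]]]] := NW.
exists C, R0; split => // u w phi B f t nd tR.
apply: le_trans (H _ _ _ _ _ _ nd tR); have [lE lu] := nash_data_loc nd.
apply: J_mono => // [|x ox].
  have := locMr (box_bounded_tail cX (ex_intro _ M bX)) lu.
  by under eq_fun do rewrite mulrCA mulrA.
have [_ _ p01 _ _] := nd; have /andP[p0 _] := p01 (x 0 ord0).
rewrite ler_wpM2r ?sqr_ge0 // ler_peMr // Xi1 //.
Qed.

Lemma half_pow_small (M eta : R) : 0 <= M -> 0 < eta -> exists n, (2^-1) ^+ n * M <= eta.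
Proof.
move=> M0 e0; exists (Num.truncn (M / eta)).+1; set n := (Num.truncn (M / eta)).+1.
have h : M / eta < n%:R by exact: truncnS_gt.
rewrite exprVn mulrC ler_pdivrMr ?exprn_gt0 //.
rewrite ltr_pdivrMr // in h; apply: le_trans (ltW h) _.
rewrite mulrC ler_pM2l // -natrX ler_nat; exact: ltnW (ltn_expl _ _).
Qed.

(* Caccioppoli turns the gradient term of the Nash inequality into the L^2 norm
   on a larger slab; iterating over growing slabs absorbs it. *)
Lemma local_L2 : exists (phi : R -> R) (C : R),
  [/\ continuous phi, forall t, 0 <= phi t <= 1, forall t, `|t| <= 3 -> phi t = 1,
      forall t, 4 < `|t| -> phi t = 0 & 0 < C /\
   forall u w f, neumann om u w -> loc om f -> (forall x, om (tailv x) -> 0 <= f x) ->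
     (forall x, om (tailv x) -> `|x 0 ord0| <= 5 -> `|u x| <= f x) ->
     J om (fun x => phi (x 0 ord0) * u x ^+ 2) <= C * J om f ^+ 2].
Proof.
have [C [R0 [C0 R00 NG]]] := nash_global.
(* The k-th cutoff is 1 up to [4 - h k] and vanishes from [4 - h k.+1] on, so its derivative lives
   where the next cutoff is 1. *)
pose h (k : nat) : R := (2^-1) ^+ k.
have h0 k : 0 < h k by rewrite exprn_gt0.
have h1 k : h k <= 1 by rewrite exprn_ile1 // invf_le1 // ler1n.
have hS k : h k.+1 = h k / 2 by rewrite /h exprSr.
have s0 k : 0 <= 4 - h k by have := h1 k; lra.
have /choice[phi hphi] : forall k, exists phi : R -> R, exists dphi : R -> R,
  [/\ forall t, is_derive t (1 : R) phi (dphi t), continuous dphi,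
      forall t, 0 <= phi t <= 1,
      forall t, `|t| <= 4 - h k -> phi t = 1 &
      (forall t, (4 - h k) + h k.+1 <= `|t| -> phi t = 0 /\ dphi t = 0) /\
      (forall t, `|dphi t| <= 4 / h k.+1)].
  by move=> k; exact: cutoff1 (s0 k) (h0 k.+1).
have {}hphi k := hphi k.
have /choice[dphi {}hphi] : forall k, exists dphi : R -> R,
  [/\ forall t, is_derive t (1 : R) (phi k) (dphi t), continuous dphi,
      forall t, 0 <= phi k t <= 1,
      forall t, `|t| <= 4 - h k -> phi k t = 1 &
      (forall t, (4 - h k) + h k.+1 <= `|t| -> phi k t = 0 /\ dphi t = 0) /\
      (forall t, `|dphi t| <= 4 / h k.+1)] by exact: hphi.
have cphi k : continuous (phi k).
  have [D _ _ _ _] := hphi k.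
  by move=> t; apply: differentiable_continuous; apply/derivable1_diffP; have [] := D t.
have c2 k : continuous (fun t => phi k t ^+ 2).
  by move=> t; apply: continuousM; exact: cphi.
have p01 k t : 0 <= phi k t ^+ 2 <= 1.
  have [_ _ H _ _] := hphi k; have /andP[a b] := H t.
  by rewrite exprn_ge0 //= exprn_ile1.
have p4 k t : 4 < `|t| -> phi k t = 0 /\ dphi k t = 0.
  have [_ _ _ _ [H _]] := hphi k => t4; apply: H.
  by rewrite hS; have := h0 k; lra.
have p42 k t : 4 < `|t| -> phi k t ^+ 2 = 0 by move=> /(p4 k)[-> _]; rewrite expr0n.
pose N := d.+1.
(* Caccioppoli gives 4 and the slope bound squared gives [(4 / h k.+1) ^+ 2 = 64 / h k ^+ 2]; at the
   scale [t = ep * h k] the powers of [h k] cancel and 256 [ep ^+ 2] remains. *)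
have [D [D0 DE]] : exists D : R, 0 < D /\ D = 4 * 4 * 4 * 4.
  by exists (4 * 4 * 4 * 4); split => //; rewrite !mulr_gt0.
(* Makes the absorption factor [th = C * D * ep ^+ 2] at most [2^-1 ^+ N.+1]: it has to beat the
   growth [2 ^+ N] per step of the L^1 term and still leave a factor 1/2. *)
pose e2 := (2^-1) ^+ N.+1 / (C * D) : R.
have e20 : 0 < e2 by rewrite divr_gt0 ?exprn_gt0 // mulr_gt0.
pose ep := Num.min (Num.min R0 1) e2.
have ep0 : 0 < ep by rewrite !lt_min R00 ltr01.
have [epR ep1 epe] : [/\ ep <= R0, ep <= 1 & ep <= e2].
  by rewrite /ep !ge_min !lexx !orbT.
pose th := C * D * ep ^+ 2.
have th0 : 0 <= th by rewrite mulr_ge0 ?sqr_ge0 // mulr_ge0 // ltW.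
have thB : th <= (2^-1) ^+ N.+1.
  apply: (@le_trans _ _ (C * D * e2)); last first.
    by rewrite /e2 mulrC divfK // mulf_neq0 // gt_eqF.
  rewrite ler_pM2l ?mulr_gt0 //; apply: le_trans epe.
  by rewrite expr2 ler_piMl // ltW.
exists (fun t => phi 0%N t ^+ 2), (2 * (C * (ep ^+ N)^-1) + 1); split => //.
- move=> t t3; have [_ _ _ H _] := hphi 0%N; rewrite H ?expr1n //.
  by rewrite /h expr0; lra.
- by move=> t; exact: p42.
have epN : 0 < ep ^+ N by rewrite exprn_gt0.
have Cc : 0 < C * (ep ^+ N)^-1 by rewrite mulr_gt0 // invr_gt0.
split; first by lra.
move=> u w f nw lf f0 uf; set L := J om f.
have [_ _ _ _ bu] := nw.
have bu2 : box_bounded om (fun x => u x ^+ 2) by exact: box_boundedM.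
have lS k : loc om (fun x => phi k (x 0 ord0) ^+ 2 * u x ^+ 2).
  by apply: locM => //; apply: (@loc_head _ _ om (fun t => phi k t ^+ 2) 4 (c2 k) (@p42 k)).
pose S k := J om (fun x => phi k (x 0 ord0) ^+ 2 * u x ^+ 2).
have L0 : 0 <= L by exact: J_ge0.
pose a := C * (ep ^+ N)^-1 * L ^+ 2.
have a0 : 0 <= a by rewrite mulr_ge0 ?sqr_ge0 // ltW.
have rec k : S k <= th * S k.+1 + a * (2 ^+ N) ^+ k.
  have nd : nash_data om u w (fun t => phi k t ^+ 2) 4 f.
    split; [exact: nw|exact: c2|exact: p01|exact: p42|].
    split => // x s ox ps sx; apply: uf => //.
    have s4 : `|s| <= 4 by rewrite leNgt; apply: contra ps => t4; rewrite /= p42.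
    have := lerB_dist (x 0 ord0) s; rewrite distrC; lra.
  have tk : 0 < ep * h k <= R0.
    rewrite mulr_gt0 //=; apply: le_trans epR; rewrite ler_piMr //; exact: ltW.
  have [Dk cD _ one [_ bd]] := hphi k.
  have cac := caccioppoli om_cpt om_C1 nw Dk cD (_ : 0 <= 4) (@p4 k).
  have {}cac := cac ltac:(by []).
  have dS : J om (fun x => dphi k (x 0 ord0) ^+ 2 * u x ^+ 2) <= (4 / h k.+1) ^+ 2 * S k.+1.
    have ldS : loc om (fun x => dphi k (x 0 ord0) ^+ 2 * u x ^+ 2).
      apply: locM => //; apply: (@loc_head _ _ om (fun t => dphi k t ^+ 2) 4).
        by move=> t; apply: continuousM; exact: cD.
      by move=> t /(p4 k)[_ ->]; rewrite expr0n.
    have c4 : 0 <= (4 / h k.+1) ^+ 2 :> R by exact: sqr_ge0.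
    have jz := J_Z om_cpt c4 (lS k.+1); apply: le_trans jz.
    apply: J_mono => // [|x ox]; first exact: locZ.
    rewrite [leRHS]mulrA ler_wpM2r ?sqr_ge0 //.
    have [xk|xk] := leP `|x 0 ord0| (4 - h k.+1).
      have [_ _ _ one' _] := hphi k.+1; rewrite one' // expr1n mulr1.
      rewrite -real_normK ?num_real //; apply: ler_sqr_nneg => //.
    have [_ _ _ _ [z _]] := hphi k.
    have [|_ ->] := z (x 0 ord0); first by rewrite hS in xk *; lra.
    by rewrite expr0n mulr_ge0 // sqr_ge0.
  apply: le_trans (NG _ _ _ _ _ _ nd tk) _.
  rewrite mulrDr; apply: lerD.
    rewrite /th; apply: (@le_trans _ _ (C * ((ep * h k) ^+ 2 * (4 * ((4 / h k.+1) ^+ 2 * S k.+1))))).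
      apply: ler_wpM2l; first exact: ltW.
      apply: ler_wpM2l; first exact: sqr_ge0.
      by apply: le_trans cac _; rewrite ler_pM2l.
    rewrite le_eqVlt; apply/orP; left; apply/eqP; rewrite DE hS; field.
    by rewrite gt_eqF.
  rewrite /a exprMn le_eqVlt; apply/orP; left; apply/eqP; rewrite -/L -/N.
  have -> : h k ^+ N = ((2 ^+ N) ^+ k)^-1 by rewrite /h -exprM mulnC exprM exprVn exprVn.
  rewrite invfM invrK; ring.
(* The L^1 terms form a series dominated by [a] times powers of 1/2, with partial sum
   [2 * a * (1 - h n)]. *)
have iter n : S 0%N <= th ^+ n * S n + 2 * a * (1 - h n).
  elim: n => [|n IH]; first by rewrite expr0 mul1r /h expr0 subrr mulr0 addr0.
  apply: le_trans IH _.
  have S1 := ler_wpM2l (exprn_ge0 n th0) (rec n).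
  have h3 : th ^+ n * (2 ^+ N) ^+ n <= h n.
    have N0 : 0 <= (2 : R) ^+ N by rewrite exprn_ge0.
    have N1 : th * 2 ^+ N <= 2^-1.
      apply: le_trans (ler_wpM2r N0 thB) _.
      by rewrite [_ ^+ N.+1]exprS exprVn mulfVK // expf_neq0.
    rewrite -exprMn; apply: lerXn2r => //; rewrite ?nnegrE.
      by apply: mulr_ge0.
    by rewrite invr_ge0.
  have h4 : th ^+ n * (a * (2 ^+ N) ^+ n) <= a * h n.
    by rewrite mulrCA ler_wpM2l.
  rewrite mulrDr [th ^+ n * (th * _)]mulrA -exprSr in S1.
  rewrite hS; move: S1 h4; move: (th ^+ n * S n) (th ^+ n.+1 * S n.+1) (th ^+ n * _) (h n) => q1 q2 q3 q4.
  by move=> S1 h4; lra.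
(* An a priori bound on all [S k], from one fixed larger cutoff; it depends on [u] but disappears in
   the limit, being multiplied by [th ^+ n]. *)
have [X [cX X01 X1 X0]] := @head_cutoff R 4 ltac:(by []).
have lM : loc om (fun x => X (x 0 ord0) * u x ^+ 2).
  by apply: locM => //; apply: (@loc_head _ _ om X 5) => // t t5; apply: X0; lra.
pose M := J om (fun x => X (x 0 ord0) * u x ^+ 2).
have SM k : S k <= M.
  apply: J_mono => // x ox; rewrite ler_wpM2r ?sqr_ge0 //.
  have [x4|x4] := leP `|x 0 ord0| 4; first by rewrite X1 //; have /andP[] := p01 k (x 0 ord0).
  by rewrite p42 //; have /andP[] := X01 (x 0 ord0).
have M0 : 0 <= M by exact: J_ge0.
rewrite mulrDl mul1r; apply: (@le_trans _ _ (2 * a)); last first.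
  by rewrite /a mulrA lerDl sqr_ge0.
apply/ler_addgt0Pr => eta eta0; have [n hn] := half_pow_small M0 eta0.
have th2 : th ^+ n <= (2^-1) ^+ n.
  apply: lerXn2r; rewrite ?nnegrE // ?invr_ge0 //.
  by apply: le_trans thB _; rewrite exprS ler_piMr ?invr_ge0 //; exact: (h1 N).
have t1 : th ^+ n * S n <= eta.
  apply: le_trans hn; apply: ler_pM => //; [exact: exprn_ge0|exact: J_ge0].
have t2 : 2 * a * (1 - h n) <= 2 * a.
  have a20 : 0 <= 2 * a by rewrite mulr_ge0.
  by rewrite ler_piMr // gerBl; exact: ltW.
by apply: le_trans (iter n) _; rewrite addrC lerD.
Qed.

End LocalL2.

(** * Growth along the axis *)

Section Splines.
Variable R : realType.
Implicit Types s t : R.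

(* B-splines of mesh 6, up to normalization. *)
Definition tri t := pos (t + 6) - 2 * pos t + pos (t - 6).
Definition tri2 t :=
  (pos (t + 6) ^+ 2 - 3 * pos t ^+ 2 + 3 * pos (t - 6) ^+ 2 - pos (t - 12) ^+ 2) / 2.
Definition tri3 t := (pos (t + 6) ^+ 3 - 4 * pos t ^+ 3 + 6 * pos (t - 6) ^+ 3
  - 4 * pos (t - 12) ^+ 3 + pos (t - 18) ^+ 3) / 6.

Lemma is_derive_pos3 t : is_derive t (1 : R) (fun t => pos t ^+ 3) (3 * pos t ^+ 2).
Proof.
have D := is_deriveM (is_derive_id t (1 : R)) (is_derive_pos2 t).
have -> : (fun t => pos t ^+ 3) = (id : R -> R) * (fun t => pos t ^+ 2).
  apply/funext => x; rewrite /GRing.mul /= exprS /pos.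
  by case: (leP x 0) => // x0; rewrite expr0n /= mul0r mulr0.
apply: is_derive_eq D _; rewrite /GRing.scale /= /pos.
by case: (leP t 0) => t0; ring.
Qed.

Lemma is_derive_shift (f : R -> R) (c t d : R) :
  is_derive (t + c) (1 : R) f d -> is_derive t (1 : R) (fun s => f (s + c)) d.
Proof.
move=> h; have := @is_derive_affine R f 1 c t d; rewrite !mul1r => /(_ h).
by under eq_fun do rewrite mul1r.
Qed.

Lemma is_derive_tri2 t : is_derive t (1 : R) tri2 (tri t - tri (t - 6)).
Proof.
have k c := is_derive_shift (is_derive_pos2 (t + c)).
have D := is_deriveZ (2^-1) (is_deriveB (is_deriveD (is_deriveB (k 6)
  (is_deriveZ 3 (is_derive_pos2 t))) (is_deriveZ 3 (k (-6)))) (k (-12))).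
have -> : tri2 = 2^-1 \*: ((fun s => pos (s + 6) ^+ 2) - 3 \*: (fun s => pos s ^+ 2) +
    3 \*: (fun s => pos (s + -6) ^+ 2) - (fun s => pos (s + -12) ^+ 2)).
  by apply/funext => s; rewrite /tri2 mulrC.
apply: is_derive_eq D _; rewrite /GRing.scale /= /tri.
have -> : t - 6 + 6 = t by ring.
have -> : t - 6 - 6 = t - 12 by ring.
by field.
Qed.

Lemma is_derive_tri3 t : is_derive t (1 : R) tri3 (tri2 t - tri2 (t - 6)).
Proof.
have k c := is_derive_shift (is_derive_pos3 (t + c)).
have D := is_deriveZ (6^-1) (is_deriveD (is_deriveB (is_deriveD (is_deriveB (k 6)
  (is_deriveZ 4 (is_derive_pos3 t))) (is_deriveZ 6 (k (-6)))) (is_deriveZ 4 (k (-12)))) (k (-18))).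
have -> : tri3 = 6^-1 \*: ((fun s => pos (s + 6) ^+ 3) - 4 \*: (fun s => pos s ^+ 3) +
    6 \*: (fun s => pos (s + -6) ^+ 3) - 4 \*: (fun s => pos (s + -12) ^+ 3) +
    (fun s => pos (s + -18) ^+ 3)).
  by apply/funext => s; rewrite /tri3 mulrC.
apply: is_derive_eq D _; rewrite /GRing.scale /= /tri2.
have -> : t - 6 + 6 = t by ring.
have -> : t - 6 - 6 = t - 12 by ring.
have -> : t - 6 - 12 = t - 18 by ring.
by field.
Qed.

Lemma posE t : 0 <= t -> pos t = t.
Proof. by move=> t0; rewrite /pos max_l. Qed.

Lemma pos0 t : t <= 0 -> pos t = 0.
Proof. by move=> t0; rewrite /pos max_r. Qed.

Lemma tri_out t : 6 < `|t| -> tri t = 0.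
Proof.
rewrite lter_normr => /orP[h|h]; rewrite /tri.
  by rewrite !posE; lra.
by rewrite !pos0; lra.
Qed.

Lemma tri2_out t : 12 < `|t| -> tri2 t = 0.
Proof.
rewrite lter_normr => /orP[h|h]; rewrite /tri2.
  by rewrite !posE; [field|lra..].
by rewrite !pos0; [field|lra..].
Qed.

Lemma tri3_out t : 18 < `|t| -> tri3 t = 0.
Proof.
rewrite lter_normr => /orP[h|h]; rewrite /tri3.
  by rewrite !posE; [field|lra..].
by rewrite !pos0; [field|lra..].
Qed.

Lemma tri_ge0 t : 0 <= tri t.
Proof.
rewrite /tri /pos; case: (leP (t + 6) 0); case: (leP t 0); case: (leP (t - 6) 0); lra.
Qed.

Lemma tri_ge1 t : `|t| <= 5 -> 1 <= tri t.
Proof.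
rewrite ler_norml => /andP[t1 t2].
rewrite /tri /pos; case: (leP (t + 6) 0); case: (leP t 0); case: (leP (t - 6) 0); lra.
Qed.

Lemma is_derive_continuous (f df : R -> R) :
  (forall t, is_derive t (1 : R) f (df t)) -> continuous f.
Proof.
by move=> D t; apply: differentiable_continuous; apply/derivable1_diffP; have [] := D t.
Qed.

Lemma tri_continuous : continuous tri.
Proof.
apply: (@lipschitz_continuous _ _ 4) => s t; rewrite /tri.
have h1 := pos_lip (s + 6) (t + 6); have h2 := pos_lip s t; have h3 := pos_lip (s - 6) (t - 6).
have E (c : R) : s + c - (t + c) = s - t by ring.
rewrite !E in h1 h3; rewrite !ler_norml in h1 h2 h3 *.
by move/andP: h1 => [? ?]; move/andP: h2 => [? ?]; move/andP: h3 => [? ?]; apply/andP; split; lra.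
Qed.

Lemma tri3_bounded : exists2 M, 0 < M & forall t, `|tri3 t| <= M.
Proof.
have ct := is_derive_continuous is_derive_tri3.
have [B [_ hB]] := compact_bounded (continuous_compact (continuous_subspaceT ct) (@segment_compact R (-18) 18)).
exists (`|B| + 1) => [|t]; first by rewrite ltr_wpDl.
have [t18|/tri3_out ->] := leP `|t| 18; last by rewrite normr0 addr_ge0.
apply: (hB (`|B| + 1)); first by rewrite (le_lt_trans (ler_norm B)) // ltrDl.
by exists t => //=; rewrite in_itv /= -ler_norml.
Qed.

(** [a] stands for slab averages and [q] for fluxes. The flux drifts by at most [e] per step, hence
    by at most 1 in total, so the averages grow at bounded rate. The maximum covers both directions
    of travel: towards minus infinity the increment is the flux at the later index. *)
Lemma discrete_growth (a q : nat -> R) (Q A0 e : R) n :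
  `|q 0%N| <= Q -> `|a 0%N| <= A0 -> 0 <= e -> n%:R * e <= 1 ->
  (forall k, (k < n)%N -> `|q k.+1 - q k| <= e) ->
  (forall k, (k < n)%N -> `|a k.+1 - a k| <= Num.max `|q k| `|q k.+1|) ->
  `|a n| <= A0 + n%:R * (Q + 1).
Proof.
move=> q0 a0 e0 ne hq ha.
have hQ k : (k <= n)%N -> `|q k| <= Q + k%:R * e.
  elim: k => [|k IH] kn; first by rewrite mul0r addr0.
  have -> : q k.+1 = q k + (q k.+1 - q k) by rewrite addrC subrK.
  apply: le_trans (ler_normD _ _) _; have := hq k kn; have := IH (ltnW kn).
  by rewrite -natr1 mulrDl mul1r; lra.
have hQ1 k : (k <= n)%N -> `|q k| <= Q + 1.
  move=> kn; apply: le_trans (hQ k kn) _; rewrite lerD2l; apply: le_trans ne.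
  by rewrite ler_wpM2r // ler_nat.
suff H k : (k <= n)%N -> `|a k| <= A0 + k%:R * (Q + 1) by exact: H.
elim: k => [|k IH] kn; first by rewrite mul0r addr0.
have -> : a k.+1 = a k + (a k.+1 - a k) by rewrite addrC subrK.
apply: le_trans (ler_normD _ _) _; have := IH (ltnW kn).
have : `|a k.+1 - a k| <= Q + 1.
  by apply: le_trans (ha k kn) _; rewrite ge_max !hQ1 // ltnW.
by rewrite -natr1 mulrDl mul1r; lra.
Qed.

End Splines.

(** * Operations on Neumann potentials and testing along the axis *)

Section Growth.
Variables (R : realType) (d : nat).
Local Notation V := 'rV[R]_d.+1.
Local Notation V' := 'rV[R]_d.
Implicit Types (x : V) (y z e : V').
Variable (om : set V').
Hypothesis om_cpt : compact (closure om).
Hypothesis om_C1 : C1_open om.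

Lemma neumannZ c u w : neumann om u w -> neumann om (fun x => c * u x) (fun x => c *: w x).
Proof.
move=> [gu [D hD] wt wc bu]; split.
- by move=> x ox; apply: gradient_atZ; exact: gu.
- exists (fun i x => c *: D i x) => x ox; have [h1 h2] := hD x ox; split.
    move=> i; have [g cD] := h1 i; split.
      have := gradient_atZ c g; congr (gradient_at _ _ _).
      by apply/funext => z; rewrite mxE.
    by apply: continuous_at_scale => //; exact: cst_continuous.
  transitivity (c * \sum_i D i x 0 i); last by rewrite h2 mulr0.
  by rewrite mulr_sumr; apply: eq_bigr => i _; rewrite mxE.
- by move=> x r rho ox ld; rewrite tailvZ dotvZl (wt _ _ _ ox ld) mulr0.
- apply/within_normP => x cx eps e0; have c0 : 0 < `|c| + 1 by rewrite ltr_wpDl.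
  have [|r r0 h] := iffLR (within_normP _ _) wc x cx (eps / (`|c| + 1)).
    by rewrite divr_gt0.
  exists r => // y cy xy; rewrite -scalerBr normrZ.
  have := h y cy xy; rewrite ltr_pdivlMr // mulrC; apply: le_lt_trans.
  by rewrite ler_wpM2r // lerDl.
- by apply: box_boundedM => //; exact: box_bounded_cst.
Qed.

Lemma neumannB u1 w1 u2 w2 : neumann om u1 w1 -> neumann om u2 w2 ->
  neumann om (fun x => u1 x - u2 x) (fun x => w1 x - w2 x).
Proof.
move=> [gu1 [D1 hD1] wt1 wc1 bu1] [gu2 [D2 hD2] wt2 wc2 bu2]; split.
- by move=> x ox; apply: gradient_atB; [exact: gu1|exact: gu2].
- exists (fun i x => D1 i x - D2 i x) => x ox.
  have [h1 h2] := hD1 x ox; have [k1 k2] := hD2 x ox; split.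
    move=> i; have [g cD] := h1 i; have [g' cD'] := k1 i; split.
      have := gradient_atB g g'; congr (gradient_at _ _ _).
      by apply/funext => z; rewrite !mxE.
    by apply: (@continuousB _ _ _ (D1 i) (D2 i)).
  transitivity (\sum_i D1 i x 0 i - \sum_i D2 i x 0 i); last by rewrite h2 k2 subr0.
  by rewrite -sumrB; apply: eq_bigr => i _; rewrite !mxE.
- by move=> x r rho ox ld; rewrite tailvB dotvDl dotvNl (wt1 _ _ _ ox ld) (wt2 _ _ _ ox ld) subr0.
- apply/within_normP => x cx eps e0; have e2 : 0 < eps / 2 by rewrite divr_gt0.
  have [r1 r10 k1] := iffLR (within_normP _ _) wc1 x cx _ e2.
  have [r2 r20 k2] := iffLR (within_normP _ _) wc2 x cx _ e2.
  exists (Num.min r1 r2); first by rewrite lt_min r10.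
  move=> y cy; rewrite lt_min => /andP[xy1 xy2].
  have := k1 y cy xy1; have := k2 y cy xy2.
  have := ler_normB (w1 x - w1 y) (w2 x - w2 y).
  have -> : w1 x - w1 y - (w2 x - w2 y) = w1 x - w2 x - (w1 y - w2 y).
    by apply/rowP => i; rewrite !mxE; ring.
  lra.
- by apply: box_boundedD => //; exact: box_boundedN.
Qed.

Lemma neumann_shift1 u w s : neumann om u w ->
  neumann om (fun x => u (x + cons_rv s 0)) (fun x => w (x + cons_rv s 0)).
Proof.
have tE x : tailv (x + cons_rv s 0) = tailv x by rewrite tailvD tailv_cons addr0.
have gs (f : V -> R) x g : gradient_at f (x + cons_rv s 0) g ->
    gradient_at (fun x => f (x + cons_rv s 0)) x g.
  move=> /gradient_atP h; apply/gradient_atP => e e0; have [r r0 H] := h e e0.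
  by exists r => // k kr; rewrite [x + k + _]addrAC; exact: H.
move=> [gu [D hD] wt wc bu]; split.
- by move=> x ox; apply: gs; apply: gu; rewrite tE.
- exists (fun i x => D i (x + cons_rv s 0)) => x ox.
  have [|h1 h2] := hD (x + cons_rv s 0); first by rewrite /cylinder /= tE.
  split; last exact: h2.
  move=> i; have [g cD] := h1 i; split; last exact: continuous_at_shift cD.
  exact: (gs (fun y : V => w y 0 i)).
- by move=> x r rho; rewrite -(tE x) => ox ld; exact: wt ox ld.
- have cE x : closure (cylinder (N := d.+1) om) x -> closure (cylinder (N := d.+1) om) (x + cons_rv s 0).
    by move=> /closure_cylinder cx; apply/closure_cylinder; rewrite tE.
  apply/within_normP => x cx e e0.
  have [r r0 h] := iffLR (within_normP _ _) wc _ (cE x cx) e e0.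
  exists r => // y cy xy; apply: h; first exact: cE.
  by rewrite opprD addrACA subrr addr0.
- exact: box_bounded_shift1.
Qed.

Definition cross_cutoff (K : set V') (h : V' -> R) (gh : V' -> V') : Prop :=
  [/\ compact K, K `<=` om, forall y, ~ K y -> h y = 0 /\ gh y = 0,
    forall y, om y -> gradient_at h y (gh y) /\ {for y, continuous gh} &
    forall y, 0 <= h y <= 1].

Lemma cross_cutoff_adm K h gh : cross_cutoff K h gh -> adm om (fun x => h (tailv x)).
Proof.
move=> [cK Ko h0 hg h01]; apply: (adm_tail cK Ko) => [y /h0[]//|y /hg[/gradient_at_continuous]|] //.
Qed.

(** The cutoff [h] does not depend on x_1, so integration by parts along the axis is exact, with no
    term in [gh]. *)
Lemma head_ibp u w K h gh (B b : R -> R) (A : R) : neumann om u w -> cross_cutoff K h gh ->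
  (forall t, is_derive t (1 : R) B (b t)) -> continuous b ->
  (forall t, A < `|t| -> B t = 0 /\ b t = 0) ->
  iint (fun x => h (tailv x) * (u x * b (x 0 ord0))) =
  - iint (fun x => h (tailv x) * (w x 0 ord0 * B (x 0 ord0))).
Proof.
move=> nw cc DB cb out; have ah := cross_cutoff_adm cc; have [gu _ _ _ bu] := nw.
have [cK Ko h0 hg _] := cc.
have cB := is_derive_continuous DB.
have B0 t : A < `|t| -> B t = 0 by move=> /out[].
have b0 t : A < `|t| -> b t = 0 by move=> /out[].
have lB := loc_head om cB B0; have lb := loc_head om cb b0.
have c1 := adm_loc_cs ah (locMr bu lb).
have c2 := adm_loc_cs ah (locMr (neumann_coord om_cpt ord0 nw) lB).
apply/eqP; rewrite -subr_eq0 opprK -iintD //; apply/eqP.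
apply: (iint_directional_derivative (e := cons_rv 1 0) (adm_loc_cs ah (locMr bu lB)) (compactly_supportedD c1 c2)) => x.
have cbx := compact_box (A := A) cK; have [clb _] := iffLR (compact_normP _) cbx.
have [bx|nx] := pselect (box K A x); last first.
  have z v : ~ box K A v -> h (tailv v) = 0 \/ A < `|v 0 ord0|.
    move=> nv; have [Kv|/h0[-> _]] := pselect (K (tailv v)); last by left.
    by right; rewrite ltNge; apply/negP => vA; apply: nv.
  exists 0; last first.
    by rewrite dotv0l; have [->|/out[-> ->]] := z x nx; rewrite ?mul0r ?mulr0 ?addr0 ?mulr0.
  apply: (gradient_at_ext0 clb) nx => v /z[->|/B0 ->]; by rewrite ?mul0r ?mulr0.
have ox : om (tailv x) by case: bx => _ /Ko.
have [g1 _] := hg _ ox; eexists.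
  apply: gradient_atM (gradient_at_tailv g1) _.
  by apply: gradient_atM (gu x ox) (gradient_at_head (DB _)).
rewrite dotvDl !dotvZl dotvDl !dotvZl !dotv_consr !cons_rv0; ring.
Qed.

(** Testing div w = 0 with h(x') B(x_1) leaves only the term in the derivative of [h] along [w],
    which [F] controls. *)
Lemma head_flux u w K h gh (B b : R -> R) (A M : R) (F : V -> R) :
  neumann om u w -> cross_cutoff K h gh ->
  (forall t, is_derive t (1 : R) B (b t)) -> continuous b ->
  (forall t, A < `|t| -> B t = 0 /\ b t = 0) -> (forall t, `|B t| <= M) ->
  compactly_supported F -> (forall x, 0 <= F x) ->
  (forall x, `|x 0 ord0| <= A -> om (tailv x) -> `|dotv (tailv (w x)) (gh (tailv x))| <= F x) ->
  `|iint (fun x => h (tailv x) * (w x 0 ord0 * b (x 0 ord0)))| <= M * iint F.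
Proof.
move=> nw [cK Ko h0 hg _] DB cb out BM cF F0 HF.
have M0 : 0 <= M by apply: le_trans (BM 0).
have [gu df _ _ _] := nw; have cB := is_derive_continuous DB.
have cbx := compact_box (A := A) cK.
have Bo : box K A `<=` cylinder (N := d.+1) om by move=> x [_ /Ko].
have out' x : ~ box K A x -> (h (tailv x) = 0 /\ cons_rv 0 (gh (tailv x)) = 0) \/
    (B (x 0 ord0) = 0 /\ cons_rv (b (x 0 ord0)) (0 : V') = 0).
  move=> nb; have [Kx|/h0[-> ->]] := pselect (K (tailv x)); last by left; rewrite cons_rv00.
  right; have [|-> ->] := out (x 0 ord0); last by rewrite cons_rv00.
  by rewrite ltNge; apply/negP => xA; apply: nb.
have gh_ x : om (tailv x) -> gradient_at (fun x => h (tailv x)) x (cons_rv 0 (gh (tailv x))) /\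
    {for x, continuous (fun x => cons_rv 0 (gh (tailv x)))}.
  move=> ox; have [g1 g2] := hg _ ox; split; first exact: gradient_at_tailv.
  by apply: (@continuous_at_cons0 _ _ _ (fun x : V => gh (tailv x))); exact: continuous_at_tailv.
have gB x : om (tailv x) -> gradient_at (fun x : V => B (x 0 ord0)) x (cons_rv (b (x 0 ord0)) 0) /\
    {for x, continuous (fun x : V => cons_rv (b (x 0 ord0)) (0 : V'))}.
  move=> ox; split; first exact: gradient_at_head.
  apply: (@continuous_at_consr _ _ _ (fun x : V => b (x 0 ord0))).
  by apply: (@continuous_at_head _ _ _ b); exact: cb.
have [W1 W2 WE] := weak_form cbx Bo out' gh_ gB df.
have E : (fun x => h (tailv x) * (w x 0 ord0 * b (x 0 ord0))) =
    (fun x => h (tailv x) * dotv (w x) (cons_rv (b (x 0 ord0)) 0)).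
  by apply/funext => x; rewrite dotv_consr [b _ * _]mulrC.
rewrite E WE normrN -iintZ //; apply: iint_norm_le => //; first exact: compactly_supportedZ.
move=> x; have [ox|nx] := pselect (om (tailv x)); last first.
  have nK : ~ K (tailv x) by move=> /Ko.
  by have [_ ->] := h0 _ nK; rewrite cons_rv00 dotv0r mulr0 normr0 mulr_ge0.
have [xA|xA] := leP `|x 0 ord0| A; last first.
  by have [-> _] := out _ xA; rewrite mul0r normr0 mulr_ge0.
by rewrite normrM dotv_cons_tailv; apply: ler_pM => //; exact: HF.
Qed.

End Growth.

(** * Linear growth of slab averages under a one-sided bound *)

Section OneSided.
Variables (R : realType) (d : nat).
Local Notation V := 'rV[R]_d.+1.
Local Notation V' := 'rV[R]_d.
Implicit Types (x : V) (y z e : V').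
Variable (om : set V').
Hypothesis om_cpt : compact (closure om).
Hypothesis om_C1 : C1_open om.

Lemma tri_sub_continuous s : continuous (fun t : R => tri (t - s)).
Proof.
move=> t; apply: (@continuous_comp _ _ _ (fun t : R => t - s) (@tri R)); last exact: tri_continuous.
by apply: continuousB; [exact: cvg_id|exact: cst_continuous].
Qed.

Lemma tri_sub_out (s t : R) : `|s| + 6 < `|t| -> tri (t - s) = 0.
Proof. by move=> h; apply: tri_out; have := lerB_dist t s; lra. Qed.

Lemma loc_tri s : loc om (fun x => tri (x 0 ord0 - s)).
Proof.
apply: (@loc_head _ _ om (fun t => tri (t - s)) (`|s| + 6)); first exact: tri_sub_continuous.
by move=> t; exact: tri_sub_out.
Qed.

Section Cutoff.
Variables (u : V -> R) (w : V -> V) (K : set V') (h : V' -> R) (gh : V' -> V') (F : V -> R) (A M3 : R).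
Hypotheses (nw : neumann om u w) (cc : cross_cutoff om K h gh).
Hypotheses (M3P : forall t : R, `|tri3 t| <= M3) (cF : compactly_supported F) (F0 : forall x, 0 <= F x).
Hypothesis HF : forall x, `|x 0 ord0| <= A -> om (tailv x) -> `|dotv (tailv (w x)) (gh (tailv x))| <= F x.

Let a s := iint (fun x => h (tailv x) * (u x * tri (x 0 ord0 - s))).
Let q s := iint (fun x => h (tailv x) * (w x 0 ord0 * tri2 (x 0 ord0 - s))).

Let D2 s t : is_derive t (1 : R) (fun t => tri2 (t - s)) (tri (t - s) - tri (t - (s + 6))).
Proof.
have -> : t - (s + 6) = t - s - 6 by ring.
apply: (@is_derive_shift _ (@tri2 R) (- s)); exact: is_derive_tri2.
Qed.

Let D3 s t : is_derive t (1 : R) (fun t => tri3 (t - s)) (tri2 (t - s) - tri2 (t - (s + 6))).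
Proof.
have -> : t - (s + 6) = t - s - 6 by ring.
apply: (@is_derive_shift _ (@tri3 R) (- s)); exact: is_derive_tri3.
Qed.

Let out2 (s t : R) : `|s| + 12 < `|t| -> tri2 (t - s) = 0.
Proof. by move=> ht; apply: tri2_out; have := lerB_dist t s; lra. Qed.

Let out3 (s t : R) : `|s| + 18 < `|t| -> tri3 (t - s) = 0.
Proof. by move=> ht; apply: tri3_out; have := lerB_dist t s; lra. Qed.

Let l2 s : loc om (fun x => tri2 (x 0 ord0 - s)).
Proof.
apply: (@loc_head _ _ om (fun t => tri2 (t - s)) (`|s| + 12)); last by move=> t; exact: out2.
exact: is_derive_continuous (D2 s).
Qed.

Let tri_step_continuous s : continuous (fun t : R => tri (t - s) - tri (t - (s + 6))).
Proof. by move=> t; apply: (@continuousB _ _ _ (fun t : R => tri (t - s))); exact: tri_sub_continuous. Qed.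

Let tri2_step_continuous s : continuous (fun t : R => tri2 (t - s) - tri2 (t - (s + 6))).
Proof.
by move=> t; apply: (@continuousB _ _ _ (fun t : R => tri2 (t - s)));
  [apply: (is_derive_continuous (D2 s))|apply: (is_derive_continuous (D2 (s + 6)))].
Qed.

(** The derivative of [tri2] is the difference of two translates of [tri] at distance 6, so the
    increment of the averages is an axial integration by parts. *)
Lemma average_step s : a (s + 6) - a s = q s.
Proof.
have ah := cross_cutoff_adm cc; have [_ _ _ _ bu] := nw.
have out t : `|s| + 18 < `|t| -> tri2 (t - s) = 0 /\ tri (t - s) - tri (t - (s + 6)) = 0.
  move=> ht; rewrite out2 ?tri_sub_out ?subrr //; try lra.
  by have := ler_normD s 6; rewrite (normr_nat R 6); lra.
have := head_ibp om_cpt nw cc (D2 s) (@tri_step_continuous s) out.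
have -> : (fun x => h (tailv x) * (u x * (tri (x 0 ord0 - s) - tri (x 0 ord0 - (s + 6))))) =
  fun x => h (tailv x) * (u x * tri (x 0 ord0 - s)) - h (tailv x) * (u x * tri (x 0 ord0 - (s + 6))).
  by apply/funext => x; ring.
rewrite iintB; try by apply: adm_loc_cs ah (locMr bu (loc_tri _)).
by rewrite -/(a s) -/(a (s + 6)) -/(q s); lra.
Qed.

(** The same relation one spline higher, between [tri3] and [tri2], expresses the flux increment by
    [head_flux]. The margin 24 exceeds the reach 18 of the supports involved. *)
Lemma flux_step s : `|s| + 24 <= A -> `|q (s + 6) - q s| <= M3 * iint F.
Proof.
move=> sA; have ah := cross_cutoff_adm cc.
have out t : A < `|t| -> tri3 (t - s) = 0 /\ tri2 (t - s) - tri2 (t - (s + 6)) = 0.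
  move=> ht; rewrite out3 ?out2 ?subrr //; try lra.
  by have := ler_normD s 6; rewrite (normr_nat R 6); lra.
have := head_flux nw cc (D3 s) (@tri2_step_continuous s) out (fun t => M3P (t - s)) cF F0 HF.
have -> : (fun x => h (tailv x) * (w x 0 ord0 * (tri2 (x 0 ord0 - s) - tri2 (x 0 ord0 - (s + 6))))) =
  fun x => h (tailv x) * (w x 0 ord0 * tri2 (x 0 ord0 - s)) -
           h (tailv x) * (w x 0 ord0 * tri2 (x 0 ord0 - (s + 6))).
  by apply/funext => x; ring.
rewrite iintB; try by apply: adm_loc_cs ah (locMr (neumann_coord om_cpt ord0 nw) (l2 _)).
by rewrite distrC.
Qed.

(* The second difference of the slab averages of u is a flux through the lateral
   boundary of the cutoff, hence negligible. *)
Lemma average_growth n sg : sg = 1 \/ sg = -1 -> n%:R * 6 + 30 <= A -> n%:R * (M3 * iint F) <= 1 ->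
  `|a (sg * (6 * n%:R))| <=
   J om (fun x => `|u x * tri (x 0 ord0)|) +
   n%:R * (J om (fun x => `|w x 0 ord0 * tri2 (x 0 ord0)|) + 1 + M3 * iint F).
Proof.
move=> hsg nA ne; have ah := cross_cutoff_adm cc; have [_ _ _ _ bu] := nw.
have M0 : 0 <= M3 * iint F by rewrite mulr_ge0 ?iint_ge0 // (le_trans _ (M3P 0)).
have bJ f : loc om f -> `|iint (fun x => h (tailv x) * f x)| <= J om (fun x => `|f x|).
  move=> lf; apply: le_trans (J_ub om_cpt ah (loc_norm lf)).
  apply: iint_norm_le; [exact: adm_loc_cs ah lf|exact: adm_loc_cs ah (loc_norm lf)|].
  by move=> x; rewrite normrM ger0_norm //; exact: (adm_ge0 _ ah).
set Q := J om (fun x => `|w x 0 ord0 * tri2 (x 0 ord0)|).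
have q0 : `|q 0| <= Q.
  apply: le_trans (bJ _ (locMr (neumann_coord om_cpt ord0 nw) (l2 0))) _.
  by under eq_fun do rewrite subr0.
have a0 : `|a 0| <= J om (fun x => `|u x * tri (x 0 ord0)|).
  apply: le_trans (bJ _ (locMr bu (loc_tri 0))) _.
  by under eq_fun do rewrite subr0.
have sn (k : nat) : (k < n)%N -> `|6 * k.+1%:R| <= n%:R * 6 :> R /\ `|6 * k%:R| <= n%:R * 6 :> R.
  by move=> kn; rewrite !normrM !normr_nat mulrC [6 * _]mulrC !ler_wpM2r ?ler_nat // ltnW.
have S6 (k : nat) : 6 * k.+1%:R = 6 * k%:R + 6 :> R by rewrite -[k.+1%:R]natr1; ring.
pose e := M3 * iint F.
apply: le_trans (@discrete_growth _ (fun k => a (sg * (6 * k%:R))) (fun k => q (sg * (6 * k%:R)))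
  (Q + e) (J om (fun x => `|u x * tri (x 0 ord0)|)) e n _ _ M0 ne _ _) _.
- by rewrite !mulr0; apply: le_trans q0 _; rewrite lerDl.
- by rewrite !mulr0.
- move=> k kn /=; have [s1 s2] := sn k kn; case: hsg => ->.
    by rewrite !mul1r S6; apply: flux_step; lra.
  rewrite !mulN1r; have -> : - (6 * k%:R) = - (6 * k.+1%:R) + 6 :> R by rewrite S6; ring.
  by rewrite distrC; apply: flux_step; rewrite normrN; lra.
- move=> k kn /=; rewrite le_max; case: hsg => ->.
    by rewrite !mul1r S6 average_step lexx.
  rewrite !mulN1r; have -> : - (6 * k%:R) = - (6 * k.+1%:R) + 6 :> R by rewrite S6; ring.
  by rewrite distrC average_step lexx orbT.
by rewrite lerD2l ler_wpM2l // addrAC.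
Qed.

End Cutoff.

(** Where u >= - M one has |u| <= u + 2 M, so the L^1 norm is bounded by the signed average, which
    [average_growth] controls. The cutoff depends on [n], the constant does not. *)
Lemma one_sided_growth u w M : neumann om u w -> 0 <= M -> exists2 C, 0 <= C &
  forall n sg, sg = 1 \/ sg = -1 ->
  (forall x, om (tailv x) -> `|x 0 ord0 - sg * (6 * n%:R)| <= 6 -> - M <= u x) ->
  J om (fun x => tri (x 0 ord0 - sg * (6 * n%:R)) * `|u x|) <= C * (n%:R + 1).
Proof.
move=> nw M0; have [_ _ wtan wcont bu] := nw; have [M3 M30 M3P] := tri3_bounded R.
have l0 : loc om (fun x => tri (x 0 ord0)).
  by have := loc_tri 0; under eq_fun do rewrite subr0.
have lw : loc om (fun x => tri2 (x 0 ord0)).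
  apply: (@loc_head _ _ om (@tri2 R) 12 (is_derive_continuous (@is_derive_tri2 R))).
  by move=> t; exact: tri2_out.
set A0 := J om (fun x => `|u x * tri (x 0 ord0)|).
set Q := J om (fun x => `|w x 0 ord0 * tri2 (x 0 ord0)|).
set T := J om (fun x => tri (x 0 ord0)).
have A00 : 0 <= A0 by apply: J_ge0 => //; apply: loc_norm; exact: locMr.
have Q0 : 0 <= Q by apply: J_ge0 => //; apply: loc_norm; apply: locMr lw; exact: (neumann_coord om_cpt ord0 nw).
have T0 : 0 <= T by exact: J_ge0.
exists (A0 + Q + 2 + 2 * M * T + 1) => [|n sg hsg lb].
  by rewrite !addr_ge0 // mulr_ge0 // mulr_ge0.
set s := sg * (6 * n%:R); rewrite -/s in lb.
have bM : box_bounded om (fun x => u x + 2 * M).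
  by apply: box_boundedD => //; exact: box_bounded_cst.
have lP : loc om (fun x => (u x + 2 * M) * tri (x 0 ord0 - s)) by apply: locMr => //; exact: loc_tri.
have [MP MP0 hMP] := loc_bounded lP.
have P0 x : om (tailv x) -> 0 <= (u x + 2 * M) * tri (x 0 ord0 - s).
  move=> ox; have [x6|x6] := leP `|x 0 ord0 - s| 6; last by rewrite tri_out // mulr0.
  by apply: mulr_ge0; [have := lb x ox x6; lra|exact: tri_ge0].
pose A := n%:R * 6 + 30 : R.
have n0 : 0 <= n%:R :> R by [].
have A00' : 0 <= A by rewrite /A; lra.
(* The inverse of this number is the budget for the integral of [F]. It makes at most 1 each of the
   flux error over [n] steps, the flux error of one step, and the loss from replacing [g] by [h]. *)
have Dn : 0 < (n%:R + 1) * (M3 + MP + 1) by rewrite mulr_gt0 //; lra.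
have [K [h [gh [F [[cK Ko] h0 hg h01 [cF F0 iF FE]]]]]] :=
  cutoff_cylinder om_cpt om_C1 wtan wcont A00' (divr_gt0 ltr01 Dn).
have cc : cross_cutoff om K h gh by split.
have ah := cross_cutoff_adm cc.
have iF' : iint F * ((n%:R + 1) * (M3 + MP + 1)) <= 1 by rewrite -ler_pdivlMr.
have iF0 := iint_ge0 cF F0.
have e1 : n%:R * (M3 * iint F) <= 1.
  apply: le_trans iF'; rewrite mulrA mulrC ler_wpM2l //; apply: ler_pM; lra.
have e2 : M3 * iint F <= 1.
  apply: le_trans iF'; rewrite mulrC ler_wpM2l //.
  have : 1 * M3 <= (n%:R + 1) * (M3 + MP + 1) by apply: ler_pM; lra.
  lra.
have e3 : MP * iint F <= 1.
  apply: le_trans iF'; rewrite mulrC ler_wpM2l //.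
  have : 1 * MP <= (n%:R + 1) * (M3 + MP + 1) by apply: ler_pM; lra.
  lra.
have HF x : `|x 0 ord0| <= A -> om (tailv x) -> `|dotv (tailv (w x)) (gh (tailv x))| <= F x.
  by move=> xA ox; have [_] := FE x xA ox.
have gr := average_growth nw cc M3P cF F0 HF hsg (lexx _) e1.
rewrite -/s -/A0 -/Q in gr.
have lT := loc_tri s.
have bnu : box_bounded om (fun x => `|u x|) by exact: box_bounded_norm.
apply: (J_le om_cpt) => [|g ag]; first exact: locM lT bnu.
have c1 := adm_loc_cs ah lP.
have c2 := adm_loc_cs ah (locMr bu lT).
have c3 := adm_loc_cs ah lT.
apply: (@le_trans _ _ (iint (fun x => h (tailv x) * ((u x + 2 * M) * tri (x 0 ord0 - s)) + MP * F x))).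
  apply: iint_le => [||x].
  - exact: adm_loc_cs ag (locM lT bnu).
  - by apply: compactly_supportedD => //; exact: compactly_supportedZ.
  have F0x := F0 x; have h0x := adm_ge0 x ah.
  have [ox|nx] := pselect (om (tailv x)); last first.
    rewrite (adm_out ag nx) (adm_out (g := fun x => h (tailv x)) ah nx) !mul0r add0r.
    by rewrite mulr_ge0.
  have Px := P0 x ox.
  have le1 : g x * (tri (x 0 ord0 - s) * `|u x|) <= (u x + 2 * M) * tri (x 0 ord0 - s).
    apply: (@le_trans _ _ (tri (x 0 ord0 - s) * `|u x|)).
      rewrite ler_piMl ?(adm_le1 _ ag) // mulr_ge0 //; exact: tri_ge0.
    have [x6|x6] := leP `|x 0 ord0 - s| 6; last by rewrite tri_out // mul0r mulr0.
    rewrite mulrC ler_wpM2r ?tri_ge0 //; have := lb x ox x6.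
    by rewrite ler_norml => lbx; apply/andP; split; lra.
  apply: le_trans le1 _.
  have [xA|xA] := leP `|x 0 ord0| A; last first.
    rewrite tri_sub_out ?mulr0 ?add0r ?mulr_ge0 //; apply: le_lt_trans xA.
    rewrite /s /A normrM; have -> : `|sg| = 1 by case: hsg => ->; rewrite ?normrN normr1.
    by rewrite mul1r ger0_norm ?mulr_ge0 //; lra.
  have [k1 _] := FE x xA ox; have bP := hMP x ox; rewrite ger0_norm // in bP.
  move: Px bP; move: ((u x + 2 * M) * tri (x 0 ord0 - s)) => P Px bP.
  have : (1 - h (tailv x)) * P <= F x * MP.
    by apply: ler_pM => //; have /andP[] := h01 (tailv x); lra.
  by rewrite mulrBl; lra.
rewrite iintD //; last exact: compactly_supportedZ.
rewrite iintZ //.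
have -> : (fun x => h (tailv x) * ((u x + 2 * M) * tri (x 0 ord0 - s))) =
  fun x => h (tailv x) * (u x * tri (x 0 ord0 - s)) + 2 * M * (h (tailv x) * tri (x 0 ord0 - s)).
  by apply/funext => x; ring.
rewrite iintD //; last exact: compactly_supportedZ.
rewrite iintZ //.
have jT : iint (fun x => h (tailv x) * tri (x 0 ord0 - s)) <= T.
  apply: le_trans (J_ub om_cpt ah lT) _.
  apply: le_trans (J_shift1 om_cpt (- s) l0).
  by under [X in _ <= J _ X]eq_fun do rewrite mxE cons_rv0.
have := ler_wpM2l (_ : 0 <= 2 * M) jT; rewrite mulr_ge0 // => /(_ isT) jT'.
have := le_trans (ler_norm _) gr => gr'.
have n1 : 0 <= n%:R * A0 + n%:R * (1 - M3 * iint F) + n%:R * (2 * M * T) + n%:R.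
  by rewrite !addr_ge0 // mulr_ge0 // ?subr_ge0 // mulr_ge0 // mulr_ge0.
move: n1 gr' jT'; rewrite mulrBr !mulrDr !mulrDl.
move: (iint (fun x => h _ * (u x * _))) (iint (fun x => h _ * tri _)) => i1 i2.
rewrite !mulr1 !mul1r [_ * n%:R]mulrC [Q * n%:R]mulrC [_ * T * n%:R]mulrC; lra.
Qed.

End OneSided.

(** * Liouville theorem *)

Section Liouville.
Variables (R : realType) (d : nat).
Local Notation V := 'rV[R]_d.+1.
Local Notation V' := 'rV[R]_d.
Implicit Types (x : V) (y z e : V').
Variable (om : set V').
Hypothesis om_cpt : compact (closure om).
Hypothesis om_C1 : C1_open om.

Definition head_weight (X : R -> R) (A : R) : Prop :=
  [/\ continuous X, forall t, 0 <= X t <= 1 & forall t, A < `|t| -> X t = 0].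

Lemma head_weight_exists (A : R) : 0 <= A -> exists2 X, head_weight X (A + 1) &
  forall t, `|t| <= A -> X t = 1.
Proof.
move=> /head_cutoff[X [cX X01 X1 X0]]; exists X => //; split => // t tA.
by apply: X0; exact: ltW.
Qed.

Lemma loc_weight X A u : head_weight X A -> box_bounded om u ->
  loc om (fun x => X (x 0 ord0) * u x).
Proof. by move=> [cX _ X0] bu; apply: locM => //; exact: (loc_head om cX X0). Qed.

Lemma box_bounded_sq u : box_bounded om u -> box_bounded om (fun x => u x ^+ 2).
Proof. by move=> bu; exact: box_boundedM. Qed.

Lemma dotv_self_ge0 (x : V) : 0 <= dotv x x. Proof. exact: dotv_ge0. Qed.

(** Caccioppoli with a cutoff equal to 1 up to [L] and vanishing beyond [2 * L], of slope at most
    [4 / L]; hence 64 = 4 * 4 ^ 2. *)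
Lemma energy_le u w (L A : R) X Y : neumann om u w -> 0 < L -> head_weight Y L -> head_weight X A ->
  (forall t, `|t| <= 2 * L -> X t = 1) ->
  J om (fun x => Y (x 0 ord0) * dotv (w x) (w x)) <= 64 / L ^+ 2 * J om (fun x => X (x 0 ord0) * u x ^+ 2).
Proof.
move=> nw L0 hY hX X1; have [_ _ _ _ bu] := nw; have bu2 := box_bounded_sq bu.
have bw := neumann_sq om_cpt nw.
have [p [dp [D cD p01 p1 [p0 bD]]]] := cutoff1 (ltW L0) L0.
have out (t : R) : 2 * L < `|t| -> p t = 0 /\ dp t = 0.
  by move=> h; apply: p0; lra.
have L20 : 0 <= 2 * L by lra.
have cac := caccioppoli om_cpt om_C1 nw D cD L20 out.
have cp := is_derive_continuous D.
have lp : loc om (fun x => p (x 0 ord0) ^+ 2 * dotv (w x) (w x)).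
  apply: locM => //; apply: (@loc_head _ _ om (fun t => p t ^+ 2) (2 * L)).
    by move=> t; apply: continuousM; exact: cp.
  by move=> t /out[-> _]; rewrite expr0n.
have ld : loc om (fun x => dp (x 0 ord0) ^+ 2 * u x ^+ 2).
  apply: locM => //; apply: (@loc_head _ _ om (fun t => dp t ^+ 2) (2 * L)).
    by move=> t; apply: continuousM; exact: cD.
  by move=> t /out[_ ->]; rewrite expr0n.
have lX := loc_weight hX bu2; have lY := loc_weight hY bw.
have [_ X01 _] := hX; have [_ Y01 Y0] := hY.
have s1 : J om (fun x => Y (x 0 ord0) * dotv (w x) (w x)) <=
    J om (fun x => p (x 0 ord0) ^+ 2 * dotv (w x) (w x)).
  apply: (J_mono om_cpt lY lp) => x ox; rewrite ler_wpM2r ?dotv_self_ge0 //.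
  have [xL|/Y0 ->] := leP `|x 0 ord0| L; last exact: sqr_ge0.
  by rewrite p1 // expr1n; have /andP[] := Y01 (x 0 ord0).
have k0 : 0 <= 16 / L ^+ 2 by rewrite divr_ge0 // sqr_ge0.
have s2 : J om (fun x => dp (x 0 ord0) ^+ 2 * u x ^+ 2) <=
    16 / L ^+ 2 * J om (fun x => X (x 0 ord0) * u x ^+ 2).
  apply: le_trans (J_Z om_cpt k0 lX).
  apply: (J_mono om_cpt ld (locZ _ lX)) => x ox; rewrite mulrA ler_wpM2r ?sqr_ge0 //.
  have [xL|/out[_ ->]] := leP `|x 0 ord0| (2 * L).
    rewrite X1 // mulr1; have := ler_sqr_nneg (normr_ge0 _) (bD (x 0 ord0)).
    by rewrite real_normK ?num_real // expr_div_n; have -> : 4 ^+ 2 = 16 :> R by ring.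
  by rewrite expr0n /= mulr_ge0 //; have /andP[] := X01 (x 0 ord0).
apply: le_trans s1 (le_trans cac _).
apply: le_trans (ler_wpM2l _ s2) _ => //.
by rewrite le_eqVlt; apply/orP; left; apply/eqP; field; rewrite gt_eqF.
Qed.

(* The Caccioppoli inequality on slabs of length n, with n tending to infinity. *)
Lemma vanishing_gradient u w K x : neumann om u w ->
  (forall n X, (0 < n)%N -> head_weight X (2 * n%:R + 1) ->
     J om (fun x => X (x 0 ord0) * u x ^+ 2) <= K * n%:R) ->
  om (tailv x) -> w x = 0.
Proof.
move=> nw H ox; have bw := neumann_sq om_cpt nw.
have [Y hY Y1] := head_weight_exists (normr_ge0 (x 0 ord0)).
have lY := loc_weight hY bw; have [cY Y01 Y0] := hY.
pose n0 := (Num.truncn (`|x 0 ord0| + 1)).+1.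
have n0x : `|x 0 ord0| + 1 < n0%:R by exact: truncnS_gt.
have key n : (n0 <= n)%N -> J om (fun x => Y (x 0 ord0) * dotv (w x) (w x)) * n%:R <= 64 * K.
  move=> nn; have n_gt0 : (0 < n)%N by exact: leq_trans nn.
  have nR : 0 < n%:R :> R by rewrite ltr0n.
  have hYn : head_weight Y n%:R.
    split => // t tn; apply: Y0; apply: le_lt_trans tn.
    by apply: le_trans (ltW n0x) _; rewrite ler_nat.
  have n2 : 0 <= 2 * n%:R :> R by rewrite mulr_ge0.
  have [X hX X1] := head_weight_exists n2.
  have e := energy_le nw nR hYn hX X1.
  have := H n X n_gt0 hX.
  move: e; move: (J om _) (J om _) => j1 j2 e hj.
  apply: (@le_trans _ _ (64 / n%:R ^+ 2 * (K * n%:R) * n%:R)).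
    rewrite ler_wpM2r ?(ltW nR) //; apply: le_trans e _.
    by rewrite ler_wpM2l // divr_ge0 // sqr_ge0.
  rewrite le_eqVlt; apply/orP; left; apply/eqP; field.
  by rewrite gt_eqF.
have J0 : J om (fun x => Y (x 0 ord0) * dotv (w x) (w x)) <= 0.
  rewrite leNgt; apply/negP => Jp.
  pose m := (Num.truncn (64 * K / J om (fun x => Y (x 0 ord0) * dotv (w x) (w x)))).+1.
  have := key (maxn n0 m) (leq_maxl _ _).
  have : 64 * K / J om (fun x => Y (x 0 ord0) * dotv (w x) (w x)) < (maxn n0 m)%:R.
    by apply: (@lt_le_trans _ _ m%:R); [exact: truncnS_gt|rewrite ler_nat leq_maxr].
  by rewrite ltr_pdivrMr // [(maxn n0 m)%:R * _]mulrC => h1 h2; have := lt_le_trans h1 h2; rewrite ltxx.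
have Yw0 (v : V) : om (tailv v) -> 0 <= Y (v 0 ord0) * dotv (w v) (w v).
  by move=> _; apply: mulr_ge0; [have /andP[] := Y01 (v 0 ord0)|exact: dotv_self_ge0].
have := J_eq0 om_cpt om_C1 lY Yw0 J0 ox; rewrite Y1 // mul1r => /eqP.
by rewrite dotv_eq0 => /eqP.
Qed.

Lemma difference_le u w (r A B : R) X Y : neumann om u w -> 0 <= r <= 1 -> 0 <= A ->
  head_weight X A -> head_weight Y B -> (forall t, `|t| <= A + 1 -> Y t = 1) ->
  J om (fun x => X (x 0 ord0) * (u (x + cons_rv r 0) - u x) ^+ 2) <=
  2 * J om (fun x => Y (x 0 ord0) * dotv (w x) (w x)).
Proof.
move=> nw /andP[r0 r1] A0 hX hY Y1; have [_ _ _ _ bu] := nw; have bw := neumann_sq om_cpt nw.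
have bd : box_bounded om (fun x => u (x + cons_rv r 0) - u x).
  by apply: box_boundedD; [exact: box_bounded_shift1|exact: box_boundedN].
have bd2 := box_bounded_sq bd.
have lX := loc_weight hX bd2; have lY := loc_weight hY bw.
have [cX X01 X0] := hX; have [cY Y01 Y0] := hY.
apply: (J_le om_cpt lX) => g ag; have [cg g01 [K [cK Ko] g0]] := ag.
have tE x t : x + t *: cons_rv 1 0 = x + cons_rv t 0 by rewrite cons_rvZ mulr1 scaler0.
have c0 : continuous (fun x => g x * X (x 0 ord0)).
  move=> x; apply: continuousM; first exact: cg.
  by apply: continuous_at_head; exact: cX.
have p0 x : 0 <= g x * X (x 0 ord0).
  by apply: mulr_ge0; [have /andP[] := g01 x|have /andP[] := X01 (x 0 ord0)].
have z0 x : ~ box K A x -> g x * X (x 0 ord0) = 0.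
  move=> nb; have [Kx|/g0 ->] := pselect (K (tailv x)); last by rewrite mul0r.
  by rewrite X0 ?mulr0 // ltNge; apply/negP => xA; apply: nb.
have S0 x t : box K A x -> 0 <= t <= r ->
    om (tailv (x + t *: cons_rv 1 0)) /\ `|(x + t *: cons_rv 1 0) 0 ord0| <= A + r.
  move=> [xA Kx] /andP[t0 tr]; rewrite tE tailvD tailv_cons addr0 mxE cons_rv0; split; first exact: Ko.
  by apply: le_trans (ler_normD _ _) _; rewrite (ger0_norm t0); lra.
have E0 t : 0 <= t <= r -> iint (fun v : V => g (v - t *: cons_rv 1 0) * X ((v - t *: cons_rv 1 0) 0 ord0) *
    dotv (w v) (w v)) <= J om (fun x => Y (x 0 ord0) * dotv (w x) (w x)).
  move=> /andP[t0 tr].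
  have agt := adm_shift1 (- t) ag.
  have vE (v : V) : v - t *: cons_rv 1 0 = v + cons_rv (- t) 0 by rewrite -scaleNr tE.
  have lXt : loc om (fun x => X (x 0 ord0 - t) * dotv (w x) (w x)).
    apply: locM => //; apply: (@loc_head _ _ om (fun s => X (s - t)) (A + r)).
      move=> s; apply: (@continuous_comp _ _ _ (fun s : R => s - t) X); last exact: cX.
      by apply: continuousB; [exact: cvg_id|exact: cst_continuous].
    by move=> s sA; apply: X0; have := lerB_dist s t; rewrite (ger0_norm t0); lra.
  have -> : (fun v => g (v - t *: cons_rv 1 0) * X ((v - t *: cons_rv 1 0) 0 ord0) * dotv (w v) (w v)) =
     fun v => g (v + cons_rv (- t) 0) * (X (v 0 ord0 - t) * dotv (w v) (w v)).
    by apply/funext => v; rewrite vE mxE cons_rv0 mulrA.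
  apply: le_trans (J_ub om_cpt agt lXt) _.
  apply: (J_mono om_cpt lXt lY) => x ox; rewrite ler_wpM2r ?dotv_self_ge0 //.
  have [xA|xA] := leP `|x 0 ord0 - t| A; last by rewrite X0 //; have /andP[] := Y01 (x 0 ord0).
  rewrite Y1; first by have /andP[] := X01 (x 0 ord0 - t).
  by have := lerB_dist (x 0 ord0) t; rewrite (ger0_norm t0); lra.
have [_ +] := translation_difference om_cpt nw r0 (compact_box (A := A) cK) c0 p0 z0 S0 E0.
have -> : (fun x => g x * X (x 0 ord0) * (u (x + r *: cons_rv 1 0) - u x) ^+ 2) =
   fun x => g x * (X (x 0 ord0) * (u (x + cons_rv r 0) - u x) ^+ 2).
  by apply/funext => x; rewrite tE mulrA.
move=> h; apply: le_trans h _; have Jn : 0 <= J om (fun x => Y (x 0 ord0) * dotv (w x) (w x)).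
  by exact: J_ge0.
rewrite dotv_consr mul1r cons_rv0 mulr1 ler_wpM2r // ler_piMr // expr2.
by rewrite mulr_ile1.
Qed.

Section Covering.
Variables (phi : R -> R) (U : V -> R) (b : R).
Hypotheses (phi_c : continuous phi) (phi01 : forall t, 0 <= phi t <= 1).
Hypotheses (phi1 : forall t, `|t| <= 3 -> phi t = 1) (phi0 : forall t, 4 < `|t| -> phi t = 0).
Hypotheses (bU : box_bounded om U) (U0 : forall x, om (tailv x) -> 0 <= U x).

Lemma loc_phi_shift s : loc om (fun x => phi (x 0 ord0 - s)).
Proof.
apply: (@loc_head _ _ om (fun t => phi (t - s)) (4 + `|s|)).
  move=> t; apply: (@continuous_comp _ _ _ (fun t : R => t - s) phi); last exact: phi_c.
  by apply: continuousB; [exact: cvg_id|exact: cst_continuous].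
by move=> t ht; apply: phi0; have := lerB_dist t s; lra.
Qed.

(** Intervals of radius 3 centred at the multiples of 6 leave no gap. The central one is counted
    twice, which only increases an upper bound. *)
Let S m t := \sum_(n < m.+1) (phi (t - 6 * n%:R) + phi (t + 6 * n%:R)).

Let S_ge1 m t : `|t| <= 6 * m%:R + 3 -> 1 <= S m t.
Proof.
have S0 k : 0 <= S k t.
  by apply: sumr_ge0 => n _; apply: addr_ge0; have /andP[] := phi01 (t - 6 * n%:R); have /andP[] := phi01 (t + 6 * n%:R).
elim: m => [|m IH].
  rewrite /S big_ord1 mulr0 subr0 addr0 add0r => t3; rewrite phi1 //.
  by rewrite lerDl.
have SE : S m.+1 t = S m t + (phi (t - 6 * m.+1%:R) + phi (t + 6 * m.+1%:R)) by rewrite /S big_ord_recr.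
have /andP[p1 _] := phi01 (t - 6 * m.+1%:R); have /andP[p2 _] := phi01 (t + 6 * m.+1%:R).
have mS : m.+1%:R = m%:R + 1 :> R by rewrite -natr1.
have [h _|h1 h2] := leP `|t| (6 * m%:R + 3); first by have := IH h; rewrite SE; lra.
have Sm := S0 m; rewrite SE; have [t0|t0] := leP 0 t.
  rewrite ger0_norm // in h1 h2; rewrite (phi1 (t := t - _)); first lra.
  by rewrite ler_norml; apply/andP; split; rewrite mS in h2 *; lra.
rewrite ltr0_norm // in h1 h2; rewrite (phi1 (t := t + 6 * _)); first lra.
by rewrite ler_norml; apply/andP; split; rewrite mS in h2 *; lra.
Qed.

Let S_J m : 0 <= b -> (forall n sg, (n <= m)%N -> sg = 1 \/ sg = -1 ->
    J om (fun x => phi (x 0 ord0 - sg * (6 * n%:R)) * U x) <= b) ->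
  loc om (fun x => S m (x 0 ord0) * U x) /\ J om (fun x => S m (x 0 ord0) * U x) <= 2 * m.+1%:R * b.
Proof.
move=> b0; have ll s : loc om (fun x => phi (x 0 ord0 - s) * U x).
  by apply: locM => //; exact: loc_phi_shift.
have pair n : (forall sg, sg = 1 \/ sg = -1 -> J om (fun x => phi (x 0 ord0 - sg * (6 * n%:R)) * U x) <= b) ->
    loc om (fun x => (phi (x 0 ord0 - 6 * n%:R) + phi (x 0 ord0 + 6 * n%:R)) * U x) /\
    J om (fun x => (phi (x 0 ord0 - 6 * n%:R) + phi (x 0 ord0 + 6 * n%:R)) * U x) <= 2 * b.
  move=> h; have -> : (fun x => (phi (x 0 ord0 - 6 * n%:R) + phi (x 0 ord0 + 6 * n%:R)) * U x) =
    fun x => phi (x 0 ord0 - 1 * (6 * n%:R)) * U x + phi (x 0 ord0 - -1 * (6 * n%:R)) * U x.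
    by apply/funext => x; rewrite mul1r mulN1r opprK mulrDl.
  split; first by apply: locD; exact: ll.
  apply: le_trans (J_add om_cpt (ll _) (ll _)) _.
  have := h 1 (or_introl erefl); have := h (-1) (or_intror erefl).
  by move: (J om _) (J om _) => j1 j2; lra.
elim: m => [|m IH] h.
  have [l1 l2] := pair 0%N (fun sg hs => h 0%N sg (leqnn _) hs).
  have -> : (fun x => S 0 (x 0 ord0) * U x) =
    fun x => (phi (x 0 ord0 - 6 * 0%:R) + phi (x 0 ord0 + 6 * 0%:R)) * U x.
    by apply/funext => x; rewrite /S big_ord1.
  by split => //; rewrite mulr1.
have [l1 l2] := pair m.+1 (fun sg hs => h m.+1 sg (leqnn _) hs).
have [l3 l4] := IH (fun n sg hn hs => h n sg (leqW hn) hs).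
have -> : (fun x => S m.+1 (x 0 ord0) * U x) = fun x => S m (x 0 ord0) * U x +
  (phi (x 0 ord0 - 6 * m.+1%:R) + phi (x 0 ord0 + 6 * m.+1%:R)) * U x.
  by apply/funext => x; rewrite /S big_ord_recr /= mulrDl.
split; first exact: locD.
apply: le_trans (J_add om_cpt l3 l1) _.
have -> : 2 * m.+2%:R * b = 2 * m.+1%:R * b + 2 * b :> R by rewrite -[m.+2%:R]natr1; ring.
exact: lerD.
Qed.

Lemma J_cover m X : 0 <= b -> (forall n sg, (n <= m)%N -> sg = 1 \/ sg = -1 ->
    J om (fun x => phi (x 0 ord0 - sg * (6 * n%:R)) * U x) <= b) ->
  head_weight X (6 * m%:R + 3) -> J om (fun x => X (x 0 ord0) * U x) <= 2 * m.+1%:R * b.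
Proof.
move=> b0 h hX; have [l1 l2] := S_J b0 h; apply: le_trans l2.
have lX := loc_weight hX bU; have [_ X01 X0] := hX.
apply: (J_mono om_cpt lX l1) => x ox; rewrite ler_wpM2r ?U0 //.
have [xm|/X0 ->] := leP `|x 0 ord0| (6 * m%:R + 3).
  by apply: le_trans (S_ge1 xm); have /andP[] := X01 (x 0 ord0).
apply: sumr_ge0 => n _; apply: addr_ge0.
  by have /andP[] := phi01 (x 0 ord0 - 6 * n%:R).
by have /andP[] := phi01 (x 0 ord0 + 6 * n%:R).
Qed.

End Covering.

End Liouville.

(** * Constancy from a vanishing gradient *)

Section Constancy.
Variable R : realType.

Lemma connected_locally_constant n (A : set 'rV[R]_n) (f : 'rV[R]_n -> R) :
  open A -> connected A ->
  (forall x, A x -> exists2 r : R, 0 < r & forall y, `|x - y| < r -> f y = f x) ->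
  forall x y, A x -> A y -> f x = f y.
Proof.
move=> /open_normP oA cA lc x y Ax Ay.
pose B := [set z | A z /\ f z = f x].
have oB : open B.
  apply/open_normP => z [Az fz]; have [r r0 h] := lc z Az; have [s s0 k] := oA z Az.
  exists (Num.min r s); first by rewrite lt_min r0.
  by move=> u; rewrite lt_min => /andP[zr zs]; split; [exact: k|rewrite h].
have oC : open [set z | A z /\ f z != f x].
  apply/open_normP => z [Az fz]; have [r r0 h] := lc z Az; have [s s0 k] := oA z Az.
  exists (Num.min r s); first by rewrite lt_min r0.
  by move=> u; rewrite lt_min => /andP[zr zs]; split; [exact: k|rewrite h].
have BA : B = A.
  apply: cA; first by exists x.
    by exists B => //; rewrite eqEsubset; split => [z [Az fz]|z [_ //]]; split.
  exists (~` [set z | A z /\ f z != f x]); first exact: open_closedC.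
  rewrite eqEsubset; split => [z [Az fz]|z [Az nz]]; split => //.
    by move=> [_]; rewrite fz eqxx.
  by apply: contrapT => h; apply: nz; split => //; apply/eqP.
have : B y by rewrite BA.
by move=> [_ ->].
Qed.

Lemma zero_gradient_locally_constant n (U : set 'rV[R]_n) (f : 'rV[R]_n -> R) x :
  open U -> (forall y, U y -> gradient_at f y 0) -> U x ->
  exists2 r : R, 0 < r & forall y, `|x - y| < r -> f y = f x.
Proof.
move=> /open_normP oU g Ux; have [r r0 h] := oU x Ux; exists r => // y xy.
have [|s _] := @mean_value _ _ f x (y - x) (fun=> 0) 1 ler01.
  move=> s /andP[s0 s1]; apply: g; apply: h.
  rewrite opprD addrA subrr sub0r normrN normrZ ger0_norm //.
  by apply: le_lt_trans xy; rewrite distrC ler_piMl.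
by rewrite dotv0l mulr0 scale1r addrCA subrr addr0 => /eqP; rewrite subr_eq0 => /eqP.
Qed.

Variable d : nat.
Local Notation V := 'rV[R]_d.+1.
Local Notation V' := 'rV[R]_d.
Variable (om : set V').

Lemma axis_constant (f : V -> R) (w : V -> V) y t : om y ->
  (forall x : V, om (tailv x) -> gradient_at f x (w x) /\ w x 0 ord0 = 0) ->
  f (cons_rv t y) = f (cons_rv 0 y).
Proof.
move=> oy h.
have E (a s : R) : cons_rv a y + s *: cons_rv 1 0 = cons_rv (a + s) y.
  by rewrite cons_rvZ mulr1 scaler0 cons_rvD addr0.
have key (a s : R) : 0 <= s -> f (cons_rv (a + s) y) = f (cons_rv a y).
  move=> s0; have [|r _] := @mean_value _ _ f (cons_rv a y) (cons_rv 1 0) w s s0.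
    by move=> r _; have [] := h (cons_rv a y + r *: cons_rv 1 0); rewrite ?E ?tailv_cons.
  rewrite dotv_consr mul1r; have [|_ ->] := h (cons_rv a y + r *: cons_rv 1 0).
    by rewrite E tailv_cons.
  by rewrite mulr0 E => /eqP; rewrite subr_eq0 => /eqP.
have [t0|t0] := leP 0 t; first by rewrite -(key 0 t t0) add0r.
by rewrite -(key t (- t)) ?subrr // oppr_ge0 ltW.
Qed.

(** Along the axis the lines are whole, so the mean value theorem applies globally; this reduces the
    claim to the section x_1 = 0, where connectedness of [om] is used. *)
Lemma cylinder_constant (f : V -> R) : open om -> connected om ->
  (forall x : V, om (tailv x) -> gradient_at f x 0) ->
  forall x z : V, om (tailv x) -> om (tailv z) -> f x = f z.
Proof.
move=> oo co g x z ox oz.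
have ax (v : V) : om (tailv v) -> f v = f (cons_rv 0 (tailv v)).
  move=> ov; rewrite -{1}(cons_rv_tailv v); apply: (axis_constant (w := fun=> 0)) => // u ou.
  by split; [exact: g|rewrite mxE].
rewrite (ax x) // (ax z) //; apply: (connected_locally_constant (A := om) (f := fun y => f (cons_rv 0 y))) => //.
move=> y oy; have [|r r0 h] := @zero_gradient_locally_constant _ (cylinder (N := d.+1) om) f (cons_rv 0 y) (open_cylinder oo) g.
  by rewrite /cylinder /= tailv_cons.
exists r => // u yu; apply: h; rewrite cons_rvB subrr cons_rv_norm normr0 gt_max r0.
exact: yu.
Qed.

End Constancy.

(** * Axial invariance and the Liouville theorem *)

Section Rigidity.
Variables (R : realType) (d : nat).
Local Notation V := 'rV[R]_d.+1.
Local Notation V' := 'rV[R]_d.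
Implicit Types (x : V) (y z e : V').
Variable (om : set V').
Hypothesis om_cpt : compact (closure om).
Hypothesis om_C1 : C1_open om.

Lemma J_loc_shift s f : loc om f -> J om (fun x => f (x + cons_rv s 0)) = J om f.
Proof.
move=> lf; apply/le_anti; rewrite J_shift1 //=.
have := J_shift1 om_cpt (- s) (loc_shift1 s lf).
by under [X in J om X <= _]eq_fun do rewrite -addrA cons_rvD addNr addr0 cons_rv00 addr0.
Qed.

Lemma head_weight_le X (A B : R) : A <= B -> head_weight X A -> head_weight X B.
Proof. by move=> AB [cX X01 X0]; split => // t tB; apply: X0; exact: le_lt_trans tB. Qed.

Variables (psi : V -> R) (v : V -> V).
Hypothesis nv : neumann om psi v.

Lemma L2_growth M : 0 <= M ->
  (forall x, om (tailv x) -> 0 <= x 0 ord0 -> - M <= psi x) ->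
  (forall x, om (tailv x) -> x 0 ord0 <= 0 -> psi x <= M) ->
  exists phi : R -> R, [/\ continuous phi, forall t, 0 <= phi t <= 1,
    forall t, `|t| <= 3 -> phi t = 1, forall t, 4 < `|t| -> phi t = 0 &
    exists2 C, 0 <= C & forall n sg, sg = 1 \/ sg = -1 ->
      J om (fun x => phi (x 0 ord0 - sg * (6 * n%:R)) * psi x ^+ 2) <= C * (n%:R + 1) ^+ 2].
Proof.
move=> M0 lower upper; have [phi [C0 [cphi p01 p1 p0 [C00 HL]]]] := local_L2 om_cpt om_C1.
exists phi; split => //.
have [C1 C10 H1] := one_sided_growth om_cpt om_C1 nv M0.
have [C2 C20 H2] := one_sided_growth om_cpt om_C1 (neumannZ (-1) nv) M0.
have [_ _ _ _ bpsi] := nv.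
have lp s : loc om (fun x => phi (x 0 ord0 - s) * psi x ^+ 2).
  by apply: locM; [exact: loc_phi_shift|exact: box_bounded_sq].
have lt s : loc om (fun x => tri (x 0 ord0 - s) * `|psi x|).
  by apply: locM; [exact: loc_tri|exact: box_bounded_norm].
pose C3 := J om (fun x => phi (x 0 ord0 - 0) * psi x ^+ 2).
have C30 : 0 <= C3.
  apply: J_ge0 => //; exact: lp.
have red s : J om (fun x => phi (x 0 ord0 - s) * psi x ^+ 2) <=
    C0 * J om (fun x => tri (x 0 ord0 - s) * `|psi x|) ^+ 2.
  have e (x : V) : (x + cons_rv s 0) 0 ord0 - s = x 0 ord0 by rewrite mxE cons_rv0 addrK.
  rewrite -(J_loc_shift s (lp s)) -(J_loc_shift s (lt s)).
  under [X in J om X <= _]eq_fun do rewrite e.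
  under [X in _ * J om X ^+ 2]eq_fun do rewrite e.
  apply: HL (neumann_shift1 s nv) _ _ _.
  - have := loc_shift1 s (lt s); by under eq_fun do rewrite e.
  - by move=> x ox; apply: mulr_ge0 => //; exact: tri_ge0.
  - by move=> x ox x5; rewrite ler_peMl //; exact: tri_ge1.
have mono n sg Ci : 0 <= Ci ->
    J om (fun x => tri (x 0 ord0 - sg * (6 * n%:R)) * `|psi x|) <= Ci * (n%:R + 1) ->
    J om (fun x => phi (x 0 ord0 - sg * (6 * n%:R)) * psi x ^+ 2) <= C0 * Ci ^+ 2 * (n%:R + 1) ^+ 2.
  move=> Ci0 h; apply: le_trans (red _) _; rewrite -mulrA -exprMn ler_wpM2l ?(ltW C00) //.
  apply: ler_sqr_nneg => //; apply: J_ge0 => //; exact: lt.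
have c1 : 0 <= C0 * C1 ^+ 2 by rewrite mulr_ge0 ?sqr_ge0 // ltW.
have c2 : 0 <= C0 * C2 ^+ 2 by rewrite mulr_ge0 ?sqr_ge0 // ltW.
exists (C0 * C1 ^+ 2 + C0 * C2 ^+ 2 + C3) => [|n sg hsg]; first by rewrite !addr_ge0.
have n1 : 0 <= (n%:R + 1) ^+ 2 :> R by exact: sqr_ge0.
(* The slab around x_1 = 0 meets both halves, so neither one-sided bound holds on all of it; its
   norm is the fixed constant [C3]. For [n >= 1] the slab of half-width 6 around [6 * n] lies in one
   half. *)
case: n n1 => [|n] n1.
  rewrite mulr0 mulr0 add0r expr1n mulr1 -/C3; lra.
have n6 : 6 <= 6 * n.+1%:R :> R by rewrite ler_peMr // ler1n.
case: hsg => ->.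
  apply: (@le_trans _ _ (C0 * C1 ^+ 2 * (n.+1%:R + 1) ^+ 2)); last first.
    by rewrite ler_wpM2r //; lra.
  apply: mono => //; apply: H1; first by left.
  move=> x ox; rewrite mul1r ler_norml => /andP[x1 _]; apply: lower => //; lra.
apply: (@le_trans _ _ (C0 * C2 ^+ 2 * (n.+1%:R + 1) ^+ 2)); last first.
  by rewrite ler_wpM2r //; lra.
apply: mono => //.
have := H2 n.+1 (-1) (or_intror erefl).
under [X in J om X <= _]eq_fun do rewrite (mulN1r (psi _)) normrN; apply.
move=> x ox; rewrite !mulN1r opprK ler_norml => /andP[_ x1]; rewrite lerN2; apply: upper => //; lra.
Qed.

Lemma energy_growth M : 0 <= M ->
  (forall x, om (tailv x) -> 0 <= x 0 ord0 -> - M <= psi x) ->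
  (forall x, om (tailv x) -> x 0 ord0 <= 0 -> psi x <= M) ->
  exists2 C, 0 <= C & forall n Y, (0 < n)%N -> head_weight Y n%:R ->
    J om (fun x => Y (x 0 ord0) * dotv (v x) (v x)) <= C * n%:R.
Proof.
move=> M0 lower upper; have [phi [cphi p01 p1 p0 [C C0 H]]] := L2_growth M0 lower upper.
have [_ _ _ _ bpsi] := nv.
exists (64 * (16 * C)) => [|n Y n0 hY]; first by rewrite mulr_ge0 ?mulr_ge0.
have nR : 0 < n%:R :> R by rewrite ltr0n.
have n1 : 1 <= n%:R :> R by rewrite ler1n.
have n20 : 0 <= 2 * n%:R :> R by lra.
have [X hX X1] := head_weight_exists n20.
apply: le_trans (energy_le om_cpt om_C1 nv nR hY hX X1) _.
have hX' : head_weight X (6 * n%:R + 3) by apply: head_weight_le hX; lra.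
have b0 : 0 <= C * (n%:R + 1) ^+ 2 by rewrite mulr_ge0 // sqr_ge0.
have := @J_cover _ _ _ om_cpt phi (fun x => psi x ^+ 2) (C * (n%:R + 1) ^+ 2) cphi p01 p1 p0
  (box_bounded_sq bpsi) (fun x _ => sqr_ge0 _) n X b0 _ hX'.
have hb k sg : (k <= n)%N -> sg = 1 \/ sg = -1 ->
    J om (fun x => phi (x 0 ord0 - sg * (6 * k%:R)) * psi x ^+ 2) <= C * (n%:R + 1) ^+ 2.
  move=> kn hsg; apply: le_trans (H k sg hsg) _; rewrite ler_wpM2l //.
  by apply: ler_sqr_nneg; [rewrite addr_ge0|rewrite lerD2r ler_nat].
move=> /(_ hb) h.
(* The sum over the slabs is [2 * C * (n + 1) ^+ 3], and [n + 1 <= 2 * n]. *)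
have e : 2 * n.+1%:R * (C * (n%:R + 1) ^+ 2) <= 16 * C * n%:R ^+ 3.
  rewrite -[n.+1%:R]natr1.
  have -> : 2 * (n%:R + 1) * (C * (n%:R + 1) ^+ 2) = 2 * C * (n%:R + 1) ^+ 3 :> R by ring.
  apply: (@le_trans _ _ (2 * C * (2 * n%:R) ^+ 3)).
    rewrite ler_wpM2l ?mulr_ge0 // lerXn2r ?nnegrE ?addr_ge0 //; lra.
  by rewrite exprMn le_eqVlt; apply/orP; left; apply/eqP; ring.
have k0 : 0 <= 64 / n%:R ^+ 2 :> R by rewrite divr_ge0 // sqr_ge0.
apply: le_trans (ler_wpM2l k0 (le_trans h e)) _.
by rewrite le_eqVlt; apply/orP; left; apply/eqP; field; rewrite gt_eqF.
Qed.

Lemma axial_invariance M : 0 <= M ->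
  (forall x, om (tailv x) -> 0 <= x 0 ord0 -> - M <= psi x) ->
  (forall x, om (tailv x) -> x 0 ord0 <= 0 -> psi x <= M) ->
  forall (r : R) x, 0 <= r <= 1 -> om (tailv x) -> v (x + cons_rv r 0) = v x.
Proof.
move=> M0 lower upper; have [C C0 H] := energy_growth M0 lower upper.
move=> r x r01 ox; apply/eqP; rewrite -subr_eq0; apply/eqP.
(* The factor 2 of [difference_le] times an energy on heights up to [2 * n + 3 <= 5 * n]. *)
apply: (vanishing_gradient om_cpt om_C1 (K := 10 * C) (neumannB (neumann_shift1 r nv) nv)) ox.
move=> n X n0 hX; have n1 : 1 <= n%:R :> R by rewrite ler1n.
have A0 : 0 <= 2 * n%:R + 1 :> R by lra.
have [|Y hY Y1] := @head_weight_exists R (2 * n%:R + 1 + 1); first lra.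
apply: le_trans (difference_le om_cpt nv r01 A0 hX hY Y1) _.
have hY' : head_weight Y (5 * n)%:R by apply: head_weight_le hY; rewrite natrM; lra.
have := H (5 * n)%N Y; rewrite muln_gt0 n0 => /(_ isT hY').
by rewrite natrM; move: (J om _) => j; lra.
Qed.

Lemma neumann_axial (a : R) : neumann om (fun x => a * x 0 ord0) (fun=> cons_rv a 0).
Proof.
split.
- move=> x _; have := gradient_atZ a (gradient_at_coord ord0 x).
  have -> // : a *: evec R ord0 = cons_rv a 0 :> V.
  apply/rowP => j; rewrite [LHS]mxE [X in _ * X]mxE eqxx /=.
  case: (fintype.unliftP ord0 j) => [k|] ->; rewrite ?cons_rvS ?cons_rv0 ?mulr1 //.
  by rewrite [RHS]mxE mulr0.
- exists (fun _ _ => 0) => x ox; split => [i|]; last by rewrite big1 // => i _; rewrite mxE.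
  by split; [exact: gradient_at_cst|exact: cst_continuous].
- by move=> x r rho _ _; rewrite tailv_cons dotv0l.
- by apply: continuous_subspaceT => x; exact: cst_continuous.
- apply: (@box_bounded_head _ _ om (fun t => a * t)) => t.
  by apply: continuousM; [exact: cst_continuous|exact: cvg_id].
Qed.

Lemma liouville M : connected om -> 0 <= M ->
  (forall x, om (tailv x) -> 0 <= x 0 ord0 -> - M <= psi x) ->
  (forall x, om (tailv x) -> x 0 ord0 <= 0 -> psi x <= M) ->
  exists a : R, forall x, om (tailv x) -> v x = cons_rv a 0.
Proof.
move=> co M0 lower upper; have inv := axial_invariance M0 lower upper.
have [oo _] := om_C1.
have [[y0 oy0]|] := pselect (exists y, om y); last first.
  by move=> no; exists 0 => x ox; exfalso; apply: no; exists (tailv x).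
have [gpsi _ _ _ bpsi] := nv.
(* As [v] does not change along the axis, the unit increment of [psi] equals v_1. The gradient of
   that increment is [v (x + e_1) - v x = 0], so v_1 is constant. *)
have slope x : om (tailv x) -> psi (x + cons_rv 1 0) - psi x = v x 0 ord0.
  move=> ox.
  have E (s : R) : x + s *: cons_rv 1 0 = x + cons_rv s 0 by rewrite cons_rvZ mulr1 scaler0.
  have [|s s01] := @mean_value _ _ psi x (cons_rv 1 0) v 1 ler01.
    by move=> s _; apply: gpsi; rewrite E tailvD tailv_cons addr0.
  by rewrite !E inv // dotv_consr !mul1r.
pose a := v (cons_rv 0 y0) 0 ord0.
have v1 x : om (tailv x) -> v x 0 ord0 = a.
  move=> ox; rewrite /a -!slope ?tailv_cons //.
  apply: (@cylinder_constant _ _ om (fun x => psi (x + cons_rv 1 0) - psi x)) => //.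
  - move=> z oz; have [g _ _ _ _] := neumannB (neumann_shift1 1 nv) nv.
    by have := g z oz; rewrite inv ?subrr // ler01 lexx.
  - by rewrite tailv_cons.
exists a => x ox; apply/eqP; rewrite -subr_eq0; apply/eqP.
have nu := neumannB nv (neumann_axial a); have [gu _ _ _ bu] := nu.
have [B0 hB0] := bu.2 0; pose B := `|B0|.
(* The axial derivative of [psi - a x_1] is now zero, so its bound on the section x_1 = 0 holds on
   the whole cylinder. *)
have uB (z : V) : om (tailv z) -> `|psi z - a * z 0 ord0| <= B.
  move=> oz; apply: (@le_trans _ _ B0); last exact: ler_norm.
  rewrite -{1 2}(cons_rv_tailv z).
  rewrite (@axis_constant _ _ om (fun x => psi x - a * x 0 ord0) (fun x => v x - cons_rv a 0)) //.
    by apply: hB0; rewrite ?tailv_cons // cons_rv0 normr0.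
  move=> u ou; split; first exact: gu.
  by rewrite [LHS]mxE [X in _ + X]mxE cons_rv0 v1 // subrr.
have [phi cp p1] := @head_weight_exists R 3 (ler0n _ _).
have [cphi p01 p0] := cp.
have p0' (t : R) : 4 < `|t| -> phi t = 0 by move=> h; apply: p0; lra.
have lphi : loc om (fun x => phi (x 0 ord0)) by exact: loc_head p0'.
have Jp : 0 <= J om (fun x => phi (x 0 ord0)).
  by apply: J_ge0.
pose b := B ^+ 2 * J om (fun x => phi (x 0 ord0)).
have b0 : 0 <= b by rewrite mulr_ge0 // sqr_ge0.
have bu2 := box_bounded_sq bu.
apply: (vanishing_gradient om_cpt om_C1 (K := 4 * b) nu) ox.
move=> n X n0 hX; have n1 : 1 <= n%:R :> R by rewrite ler1n.
have hX' : head_weight X (6 * n%:R + 3) by apply: head_weight_le hX; lra.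
have hb k sg : (k <= n)%N -> sg = 1 \/ sg = -1 ->
    J om (fun x => phi (x 0 ord0 - sg * (6 * k%:R)) * (psi x - a * x 0 ord0) ^+ 2) <= b.
  move=> _ _; set s := sg * _.
  have ls := loc_phi_shift om cphi p0' s.
  apply: (@le_trans _ _ (J om (fun x => B ^+ 2 * phi (x 0 ord0 - s)))).
    apply: (J_mono om_cpt (locM ls bu2) (locZ _ ls)) => z oz.
    rewrite mulrC ler_wpM2r //; first by have /andP[] := p01 (z 0 ord0 - s).
    by rewrite -real_normK ?num_real //; apply: ler_sqr_nneg => //; exact: uB.
  apply: le_trans (J_Z om_cpt (sqr_ge0 B) ls) _; rewrite ler_wpM2l ?sqr_ge0 //.
  apply: le_trans (J_shift1 om_cpt (- s) lphi).
  by under [X in _ <= J _ X]eq_fun do rewrite mxE cons_rv0.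
apply: le_trans (J_cover om_cpt cphi p01 p1 p0' bu2 (fun x _ => sqr_ge0 _) b0 hb hX') _.
rewrite -[n.+1%:R]natr1; have : b * 1 <= b * n%:R by rewrite ler_wpM2l.
lra.
Qed.

End Rigidity.

(** * Ascent of the potential *)

Section Ascent.
Variables (R : realType) (d : nat).
Local Notation V := 'rV[R]_d.+1.
Local Notation V' := 'rV[R]_d.
Implicit Types (x z e : V).
Variable (om : set V').
Hypothesis om_cpt : compact (closure om).
Hypothesis om_C1 : C1_open om.
Variables (psi : V -> R) (v : V -> V) (c : R).
Hypothesis nv : neumann om psi v.
Hypotheses (c0 : 0 < c) (hc : forall x, closure om (tailv x) -> c <= enorm (v x)).

Let om_open : open om. Proof. by have [] := om_C1. Qed.
(** With e = |v z| >= c, an ascent direction satisfies v.V0 >= e^2 / 2 near [z] while |V0| <= 2 e: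
    the slope per unit length is at least e / 4. *)
Let kap := c / 4.
Let kap0 : 0 < kap. Proof. by rewrite divr_gt0. Qed.

(** At a boundary point [v z] is tangent and following it could leave the domain. Subtracting a
    small multiple of [grad rho] bends the direction inward, and by tangency this does not change
    the product with [v z]. *)
Lemma inward_direction z : closure om (tailv z) -> exists V0 : V,
  [/\ dotv (v z) V0 = enorm (v z) ^+ 2, `|V0| <= 2 * enorm (v z) &
   exists2 r : R, 0 < r & forall x s, om (tailv x) -> `|z - x| < r -> 0 <= s -> s * `|V0| < r ->
     om (tailv (x + s *: V0))].
Proof.
move=> cz; have e0 : 0 < enorm (v z) by apply: lt_le_trans (hc cz).
set e := enorm (v z) in e0 *.
have [oz|nz] := pselect (om (tailv z)).
  exists (v z); split; first by rewrite /e enorm_sq.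
    by apply: le_trans (norm_le_enorm _) _; rewrite -/e; lra.
  have [r r0 h] := iffLR (open_normP _) (open_cylinder om_open) z oz.
  exists (r / 2); first by rewrite divr_gt0.
  move=> x s ox zx s0 sV; apply: h; rewrite opprD addrA.
  apply: le_lt_trans (ler_normB _ _) _; rewrite normrZ (ger0_norm s0); lra.
have [_ /(_ (tailv z) (conj cz nz))[r0 [rho ld]]] := om_C1.
have [_ _ wt _ _] := nv; have tz := wt z r0 rho (conj cz nz) ld.
have [r00 [C1 [g0 hom]]] := ld; set g := grad rho (tailv z) in g0 tz.
have gg : 0 < dotv g g by rewrite dotv_gt0.
pose eta := e / (`|g| + 1).
have g1 : 0 < `|g| + 1 by rewrite ltr_wpDl.
have eta0 : 0 < eta by rewrite divr_gt0.
pose V0 := v z - eta *: cons_rv 0 g.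
have tV : tailv V0 = tailv (v z) - eta *: g by rewrite tailvB tailvZ tailv_cons.
exists V0; split.
- by rewrite /V0 dotvDr dotvNr dotvZr dotv_cons_tailv tz mulr0 subr0 enorm_sq.
- apply: le_trans (ler_normB _ _) _; have := norm_le_enorm (v z); rewrite -/e.
  have : `|eta *: cons_rv 0 g| <= e.
    rewrite normrZ cons_rv_norm normr0 (ger0_norm (ltW eta0)).
    have -> : Num.max 0 `|g| = `|g| by rewrite max_r.
    by rewrite /eta -mulrA ler_piMr ?(ltW e0) // mulrC ler_pdivrMr // mul1r lerDl.
  lra.
have gV : dotv g (tailv V0) < 0.
  by rewrite tV dotvC dotvDl dotvNl dotvZl tz add0r oppr_lt0 mulr_gt0.
have zz : ball (tailv z) r0 (tailv z) by exact: ballxx.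
have cg := C1_on_grad_continuous C1 zz.
have gV0 : 0 < - dotv g (tailv V0) by rewrite oppr_gt0.
have /cvg_ballP/(_ _ gV0)[r2 r20 h2] : {for tailv z, continuous (fun y => dotv (grad rho y) (tailv V0))}.
  apply: (@continuous_at_dotv _ _ _ (grad rho) (fun=> tailv V0)); [exact: cg|exact: cst_continuous].
exists (Num.min r0 r2 / 2); first by rewrite divr_gt0 // lt_min r00.
move=> x s ox zx s0 sV; set m := Num.min r0 r2 in zx sV.
have near t : 0 <= t <= s -> `|tailv z - (tailv x + t *: tailv V0)| < m.
  move=> /andP[t0 ts]; rewrite opprD addrA; apply: le_lt_trans (ler_normB _ _) _.
  rewrite -tailvB normrZ (ger0_norm t0).
  have : t * `|tailv V0| <= s * `|V0| by apply: ler_pM => //; exact: tailv_norm.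
  by have := tailv_norm (z - x); lra.
have mr t : 0 <= t <= s -> `|tailv z - (tailv x + t *: tailv V0)| < r0 /\
    `|tailv z - (tailv x + t *: tailv V0)| < r2.
  by move=> /near; rewrite /m lt_min => /andP[].
have [|t ts E] := @mean_value _ _ rho (tailv x) (tailv V0) (grad rho) s s0.
  by move=> t /mr[t1 _]; apply: C1_on_gradient C1 _; exact/ball_normP.
have [t1 t2] := mr t ts; have := h2 _ t2; rewrite -/g => h3.
have gt : dotv (grad rho (tailv x + t *: tailv V0)) (tailv V0) <= 0.
  by move: h3; rewrite ltr_norml => /andP[h3 _]; lra.
have xr : ball (tailv z) r0 (tailv x).
  apply/ball_normP; have [|q _] := mr 0; first by rewrite lexx.
  by rewrite scale0r addr0 in q.
have sr : ball (tailv z) r0 (tailv x + s *: tailv V0).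
  by apply/ball_normP; have [|q _] := mr s; rewrite ?s0 ?lexx.
rewrite tailvD tailvZ; apply: (iffRL (hom _ sr)).
have := iffLR (hom _ xr) ox.
have : s * dotv (grad rho (tailv x + t *: tailv V0)) (tailv V0) <= 0.
  by rewrite mulr_ge0_le0.
by rewrite -E; lra.
Qed.

(** A triple of centre, radius and step vector. From any point of the domain near the centre the
    whole segment stays inside and [psi] increases at rate at least [kap] per unit length. Such
    steps replace the flow of [v]. *)
Definition ascent (b : V * R * V) : Prop :=
  [/\ 0 < b.1.2, 0 < `|b.2|, `|b.2| <= 1 & forall x s, om (tailv x) -> `|b.1.1 - x| < b.1.2 ->
   0 <= s <= 1 -> om (tailv (x + s *: b.2)) /\ kap * `|b.2| <= dotv (v (x + s *: b.2)) b.2].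

Lemma ascent_exists z : closure om (tailv z) -> exists r W, ascent (z, r, W).
Proof.
move=> cz; have [V0 [vV V2 [r1 r10 H1]]] := inward_direction cz.
have e0 : 0 < enorm (v z) by apply: lt_le_trans (hc cz).
have ce := hc cz; set e := enorm (v z) in e0 ce vV V2.
have V00 : 0 < `|V0|.
  rewrite normr_gt0; apply/eqP => V00; move: vV; rewrite V00 dotvC dotv0l => /esym/eqP.
  by rewrite expf_eq0 /= gt_eqF.
pose n2 := (d.+1)%:R ^+ 2 : R.
have n20 : 0 <= n2 by rewrite sqr_ge0.
pose ep := e ^+ 2 / 2 / (n2 * (2 * e) + 1).
have Dn : 0 < n2 * (2 * e) + 1 by rewrite ltr_wpDl // mulr_ge0 // mulr_ge0 // ltW.
have ep0 : 0 < ep by rewrite !divr_gt0 // exprn_gt0.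
have [_ _ _ wc _] := nv.
have [r3 r30 H3] := iffLR (within_normP _ _) wc z (iffRL (closure_cylinder om z) cz) ep ep0.
pose r := Num.min r1 r3 / 2.
have m0 : 0 < Num.min r1 r3 by rewrite lt_min r10.
have r0 : 0 < r by rewrite divr_gt0.
have [rr1 rr3] : r <= r1 / 2 /\ r <= r3 / 2.
  have : Num.min r1 r3 <= r1 by rewrite ge_min lexx.
  have : Num.min r1 r3 <= r3 by rewrite ge_min lexx orbT.
  by rewrite /r; lra.
(* Scales the direction so that the step has length at most 1 and remains within [r / 2], hence in
   the neighbourhood where [v] varies little. *)
pose tau := Num.min 1 (r / 2) / `|V0|.
have t0 : 0 < tau by rewrite divr_gt0 // lt_min ltr01 divr_gt0.
have tV : tau * `|V0| = Num.min 1 (r / 2) by rewrite divfK // gt_eqF.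
have [tV1 tVr] : tau * `|V0| <= 1 /\ tau * `|V0| <= r / 2.
  by rewrite tV !ge_min !lexx orbT.
exists r, (tau *: V0); split => //=.
- by rewrite normrZ (ger0_norm (ltW t0)) mulr_gt0.
- by rewrite normrZ (ger0_norm (ltW t0)).
move=> x s ox zx /andP[s0 s1]; rewrite scalerA normrZ (ger0_norm (ltW t0)).
have st0 : 0 <= s * tau by rewrite mulr_ge0 // ltW.
have sV : s * tau * `|V0| <= r / 2.
  by apply: le_trans tVr; rewrite ler_wpM2r // ler_piMl // ltW.
have oxs : om (tailv (x + (s * tau) *: V0)) by apply: H1 => //; lra.
split => //.
have near : `|z - (x + (s * tau) *: V0)| < r3.
  rewrite opprD addrA; apply: le_lt_trans (ler_normB _ _) _; rewrite normrZ (ger0_norm st0); lra.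
have vd := H3 _ (iffRL (closure_cylinder om _) (subset_closure oxs)) near.
set y := x + (s * tau) *: V0 in near vd *.
have dd : `|dotv (v z - v y) V0| <= e ^+ 2 / 2.
  apply: le_trans (dotv_le_norm _ _) _.
  apply: (@le_trans _ _ (n2 * ep * (2 * e))).
    apply: ler_pM => //.
    by rewrite ler_wpM2l // ltW.
  rewrite mulrAC -[n2 * (2 * e)]addr0 /ep mulrCA ler_piMr //.
    by rewrite divr_ge0 // sqr_ge0.
  rewrite addr0 ler_pdivrMr // mul1r; lra.
rewrite dotvZr mulrCA ler_wpM2l ?(ltW t0) //.
have kV : kap * `|V0| <= e / 4 * (2 * e) by apply: ler_pM => //; [exact: ltW|rewrite ler_pM2r].
apply: le_trans kV _.
have : dotv (v y) V0 = e ^+ 2 - dotv (v z - v y) V0 by rewrite dotvDl dotvNl vV; ring.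
move: dd; rewrite ler_norml => /andP[_]; have -> : e / 4 * (2 * e) = e ^+ 2 / 2 by field.
lra.
Qed.

(** Full step within half the radius and no step beyond the radius, with a continuous transition:
    the step becomes a continuous map of the whole space, on which the openness of the basins
    rests. *)
Definition ascent_weight (b : V * R * V) x : R := step (2 - `|b.1.1 - x| * (2 / b.1.2)).
Definition ascent_step (b : V * R * V) x : V := x + ascent_weight b x *: b.2.

Lemma ascent_weight01 b x : 0 <= ascent_weight b x <= 1.
Proof. by rewrite step_ge0 step_le1. Qed.

Lemma ascent_weight_in b x : ascent b -> `|b.1.1 - x| <= b.1.2 / 2 -> ascent_weight b x = 1.
Proof.
move=> [r0 _ _ _] h; apply: step_ge1.
have : `|b.1.1 - x| * (2 / b.1.2) <= b.1.2 / 2 * (2 / b.1.2).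
  by rewrite ler_wpM2r // divr_ge0 // ltW.
have -> : b.1.2 / 2 * (2 / b.1.2) = 1 by field; rewrite gt_eqF.
lra.
Qed.

Lemma ascent_weight_out b x : ascent b -> b.1.2 <= `|b.1.1 - x| -> ascent_weight b x = 0.
Proof.
move=> [r0 _ _ _] h; apply: step_le0.
have : b.1.2 * (2 / b.1.2) <= `|b.1.1 - x| * (2 / b.1.2).
  by rewrite ler_wpM2r // divr_ge0 // ltW.
have -> : b.1.2 * (2 / b.1.2) = 2 by field; rewrite gt_eqF.
lra.
Qed.

Lemma ascent_step_continuous b : continuous (ascent_step b).
Proof.
move=> x; apply: (@continuousD _ _ _ (fun y : V => y) (fun y => ascent_weight b y *: b.2)); first exact: cvg_id.
apply: continuous_at_scale; last exact: cst_continuous.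
apply: (@continuous_at_compR _ _ (fun y : V => 2 - `|b.1.1 - y| * (2 / b.1.2)) (@step R)).
  apply: continuousB; first exact: cst_continuous.
  by apply: continuousM; [exact: norm_continuous_dist|exact: cst_continuous].
exact: step_continuous.
Qed.

Lemma ascent_segment b x s : ascent b -> om (tailv x) -> 0 <= s <= ascent_weight b x ->
  om (tailv (x + s *: b.2)) /\ kap * (s * `|b.2|) <= psi (x + s *: b.2) - psi x.
Proof.
move=> ab ox /andP[s0 sw]; have [r0 _ _ H] := ab; have [gpsi _ _ _ _] := nv.
have [zx|zx] := ltP `|b.1.1 - x| b.1.2; last first.
  rewrite (ascent_weight_out ab zx) in sw; have -> : s = 0 by apply/le_anti; rewrite sw.
  by rewrite scale0r addr0 mul0r mulr0 subrr.
have s1 : s <= 1 by apply: le_trans sw _; have /andP[] := ascent_weight01 b x.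
have hs t : 0 <= t <= s -> 0 <= t <= 1 by move=> /andP[-> ts] /=; exact: le_trans ts s1.
split; first by have [] := H x s ox zx (hs s _); rewrite ?s0 ?lexx.
have [|t ts ->] := @mean_value _ _ psi x b.2 v s s0.
  by move=> t ts; apply: gpsi; have [] := H x t ox zx (hs t ts).
by rewrite mulrCA ler_wpM2l //; have [] := H x t ox zx (hs t ts).
Qed.

Lemma ascent_step_gain b x : ascent b -> om (tailv x) ->
  om (tailv (ascent_step b x)) /\ kap * `|ascent_step b x - x| <= psi (ascent_step b x) - psi x.
Proof.
move=> ab ox; have /andP[w0 w1] := ascent_weight01 b x.
have [|h1 h2] := @ascent_segment b x (ascent_weight b x) ab ox; first by rewrite w0 lexx.
by split => //; rewrite /ascent_step addrAC subrr add0r normrZ ger0_norm.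
Qed.

Definition ascent_pass (L : seq (V * R * V)) x := foldl (fun y b => ascent_step b y) x L.

Lemma ascent_pass_continuous L : continuous (ascent_pass L).
Proof.
elim: L => [|b L IH] x; first exact: cvg_id.
apply: (@continuous_comp _ _ _ (ascent_step b) (ascent_pass L)); last exact: IH.
exact: ascent_step_continuous.
Qed.

Lemma ascent_pass_gain L x : (forall b, b \in L -> ascent b) -> om (tailv x) ->
  om (tailv (ascent_pass L x)) /\ kap * `|ascent_pass L x - x| <= psi (ascent_pass L x) - psi x.
Proof.
elim: L x => [|b L IH] x h ox; first by rewrite /= !subrr normr0 mulr0.
have [q1 g1] := ascent_step_gain (h b (mem_head _ _)) ox.
have [|q2 g2] := IH (ascent_step b x) _ q1; first by move=> a aL; apply: h; rewrite inE aL orbT.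
split => //=; have -> : ascent_pass L (ascent_step b x) - x =
  (ascent_pass L (ascent_step b x) - ascent_step b x) + (ascent_step b x - x) by rewrite addrA subrK.
have := ler_wpM2l (ltW kap0) (ler_normD (ascent_pass L (ascent_step b x) - ascent_step b x) (ascent_step b x - x)).
by rewrite mulrDr; lra.
Qed.

(** Every displacement is paid for by a gain of [psi]. If the whole pass gains little, the point has
    moved little when the turn of [b] comes, so it is still within half the radius and makes the
    full step. *)
Lemma ascent_pass_hit L b x : (forall b, b \in L -> ascent b) -> b \in L -> om (tailv x) ->
  kap * `|b.1.1 - x| + (psi (ascent_pass L x) - psi x) <= kap * (b.1.2 / 2) ->
  kap * `|b.2| <= psi (ascent_pass L x) - psi x.
Proof.
elim: L x => [//|a L IH] x h; rewrite inE => bL ox /=.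
have aa := h a (mem_head _ _); have [q1 g1] := ascent_step_gain aa ox.
have hL b' : b' \in L -> ascent b' by move=> b'L; apply: h; rewrite inE b'L orbT.
have [q2 g2] := ascent_pass_gain hL q1.
have k1 : 0 <= kap * `|ascent_step a x - x| by rewrite mulr_ge0 // ltW.
have k2 : 0 <= kap * `|ascent_pass L (ascent_step a x) - ascent_step a x| by rewrite mulr_ge0 // ltW.
move=> hb; case/orP: bL => [/eqP ba|bL].
  have xr : `|b.1.1 - x| <= b.1.2 / 2 by rewrite -(ler_pM2l kap0); lra.
  have /andP[w0 w1] := ascent_weight01 a x.
  have [|_] := @ascent_segment a x (ascent_weight a x) aa ox; first by rewrite w0 lexx.
  rewrite -/(ascent_step a x) -ba (ascent_weight_in _ xr) ?ba // mul1r; lra.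
have tri : kap * `|b.1.1 - ascent_step a x| <= kap * `|b.1.1 - x| + kap * `|ascent_step a x - x|.
  rewrite -mulrDr ler_pM2l //; have -> : b.1.1 - ascent_step a x = (b.1.1 - x) - (ascent_step a x - x).
    by rewrite opprB addrA subrK.
  exact: ler_normB.
have := IH _ hL bL q1; lra.
Qed.

(** The lists increase with [n], so a trajectory confined to bounded heights keeps meeting all the
    steps of one fixed cover. Covering with a quarter of the radius leaves another quarter of slack
    for [ascent_pass_hit]. *)
Lemma ascent_cover : exists L : nat -> seq (V * R * V),
  [/\ forall n b, b \in L n -> ascent b, forall n m b, (n <= m)%N -> b \in L n -> b \in L m &
   forall n x, om (tailv x) -> `|x 0 ord0| <= n%:R ->
     exists2 b, b \in L n & `|b.1.1 - x| <= b.1.2 / 4].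
Proof.
have /choice[D hD] : forall z, exists D : R * V, closure om (tailv z) -> ascent (z, D.1, D.2).
  move=> z; have [cz|] := pselect (closure om (tailv z)); last by exists (0, 0).
  by have [r [W h]] := ascent_exists cz; exists (r, W).
have rad z : closure om (tailv z) -> 0 < (D z).1 / 4.
  by move=> /hD[r0 _ _ _]; rewrite divr_gt0.
have /choice[s hs] : forall n : nat, exists s : seq V, (forall z, z \in s -> closure om (tailv z)) /\
    forall x, om (tailv x) -> `|x 0 ord0| <= n%:R -> exists2 z, z \in s & `|z - x| < (D z).1 / 4.
  move=> n; have [|s s1 s2] := @compact_finite_cover _ _ _ (fun z => (D z).1 / 4) (compact_box (A := n%:R) om_cpt).
    by move=> z [_ cz]; exact: rad.
  exists s; split => [z /s1[]//|x ox xn]; apply: s2; split => //; exact: subset_closure.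
pose tag z : V * R * V := (z, (D z).1, (D z).2).
pose L := fix L n := if n is n'.+1 then map tag (s n) ++ L n' else map tag (s 0%N).
have sL n b : b \in map tag (s n) -> b \in L n.
  by case: n => [//|n] /= bs; rewrite mem_cat bs.
have stepL n b : b \in L n -> b \in L n.+1 by move=> bL; rewrite /= mem_cat bL orbT.
exists L; split.
- have tagP n b : b \in map tag (s n) -> ascent b.
    by move=> /mapP[z zs ->]; apply: hD; have [h _] := hs n; exact: h.
  by elim=> [|n IH] b /=; [exact: tagP|rewrite mem_cat => /orP[/(tagP n.+1)|/IH]].
- move=> n m b; elim: m => [|m IH]; first by rewrite leqn0 => /eqP ->.
  by rewrite leq_eqVlt => /orP[/eqP -> //|/IH h bn]; apply: stepL; exact: h.
- move=> n x ox xn; have [_ h] := hs n; have [z zs zx] := h x ox xn.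
  by exists (tag z); [apply: sL; exact: map_f|exact: ltW].
Qed.

Section Orbit.
Variable L : nat -> seq (V * R * V).
Hypothesis L_asc : forall n b, b \in L n -> ascent b.
Hypothesis L_mono : forall n m b, (n <= m)%N -> b \in L n -> b \in L m.
Hypothesis L_cover : forall n x, om (tailv x) -> `|x 0 ord0| <= n%:R ->
  exists2 b, b \in L n & `|b.1.1 - x| <= b.1.2 / 4.

Fixpoint orbit n x := if n is n'.+1 then ascent_pass (L n') (orbit n' x) else x.

Lemma orbit_continuous n : continuous (orbit n).
Proof.
elim: n => [|n IH] x; first exact: cvg_id.
apply: (@continuous_comp _ _ _ (orbit n) (ascent_pass (L n))); first exact: IH.
exact: ascent_pass_continuous.
Qed.

Lemma orbit_gain n x : om (tailv x) ->
  om (tailv (orbit n x)) /\ kap * `|orbit n x - x| <= psi (orbit n x) - psi x.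
Proof.
move=> ox; elim: n => [|n [q1 g1]] /=; first by rewrite !subrr normr0 mulr0.
have [q2 g2] := ascent_pass_gain (@L_asc n) q1; split => //.
have -> : ascent_pass (L n) (orbit n x) - x = (ascent_pass (L n) (orbit n x) - orbit n x) + (orbit n x - x).
  by rewrite addrA subrK.
have := ler_wpM2l (ltW kap0) (ler_normD (ascent_pass (L n) (orbit n x) - orbit n x) (orbit n x - x)).
by rewrite mulrDr; lra.
Qed.

(** If [psi] stayed below [S] along the orbit, the displacement bound would confine it to heights at
    most [n0]. Each later pass then gains at least the minimum [e] over the finite list [L n0]: a
    gain below a quarter radius times [kap] forces a full step, itself worth [kap] times its
    length. *)
Lemma orbit_unbounded x S : om (tailv x) -> exists n, S < psi (orbit n x).
Proof.
move=> ox; apply: contrapT => /forallNP nS.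
have hS n : psi (orbit n x) <= S by rewrite leNgt; apply/negP; exact: nS.
pose A := `|x 0 ord0| + (S - psi x) / kap.
pose n0 := (Num.truncn A).+1.
have An0 : A <= n0%:R by apply: ltW; exact: truncnS_gt.
have inbox n : `|orbit n x 0 ord0| <= n0%:R.
  apply: le_trans An0; have [_ g] := orbit_gain n ox.
  have h1 : `|orbit n x - x| <= (S - psi x) / kap.
    by rewrite ler_pdivlMr // mulrC; apply: le_trans g _; rewrite lerD2r.
  have h2 := coord_le_norm (orbit n x - x) ord0; rewrite !mxE in h2.
  have := lerB_dist (orbit n x 0 ord0) (x 0 ord0); rewrite /A; lra.
have [|e e0 he] := @pos_lower_bound R _ (L n0) (fun b => Num.min (kap * (b.1.2 / 4)) (kap * `|b.2|)).
  by move=> b /L_asc[r0 V0 _ _]; rewrite lt_min !mulr_gt0 // divr_gt0.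
have inc k : e <= psi (orbit (n0 + k).+1 x) - psi (orbit (n0 + k) x).
  have [q1 _] := orbit_gain (n0 + k) ox.
  have [b bL zx] := L_cover q1 (inbox (n0 + k)%N).
  have bL' := L_mono (leq_addr k n0) bL.
  have := he b bL; rewrite le_min => /andP[e1 e2].
  rewrite leNgt; apply/negP => small.
  have := @ascent_pass_hit (L (n0 + k)%N) b (orbit (n0 + k) x) (@L_asc _) bL' q1.
  rewrite -/(orbit (n0 + k).+1 x) => hit.
  have : kap * `|b.1.1 - orbit (n0 + k) x| <= kap * (b.1.2 / 4) by rewrite ler_pM2l.
  have E : kap * (b.1.2 / 2) = kap * (b.1.2 / 4) + kap * (b.1.2 / 4) by field.
  by move=> h3; have := hit ltac:(rewrite E; lra); lra.
have lin k : psi (orbit n0 x) + k%:R * e <= psi (orbit (n0 + k) x).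
  elim: k => [|k IH]; first by rewrite mul0r addr0 addn0.
  by rewrite addnS; have := inc k; rewrite -natr1 mulrDl mul1r; lra.
pose k := (Num.truncn ((S - psi (orbit n0 x)) / e)).+1.
have : (S - psi (orbit n0 x)) / e < k%:R by exact: truncnS_gt.
by rewrite ltr_pdivrMr //; have := lin k; have := hS (n0 + k)%N; lra.
Qed.

(* An ascending segment above the level of psi on the section {x_1 = 0}
   cannot cross that section. *)
Lemma ascent_step_side b x sg M : ascent b -> om (tailv x) ->
  (forall z, om (tailv z) -> z 0 ord0 = 0 -> psi z <= M) ->
  M < psi x -> 0 < sg * x 0 ord0 -> 0 < sg * ascent_step b x 0 ord0.
Proof.
move=> ab ox hM Mx x0; rewrite ltNge; apply/negP => y0.
set w := ascent_weight b x; have /andP[w0 w1] := ascent_weight01 b x.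
have E s : (x + s *: b.2) 0 ord0 = x 0 ord0 + s * b.2 0 ord0 by rewrite !mxE.
move: y0; rewrite E -/w => y0.
have V0 : 0 < - (sg * b.2 0 ord0).
  rewrite ltNge; apply/negP => h.
  have : 0 <= w * (sg * b.2 0 ord0) by rewrite mulr_ge0 //; lra.
  by rewrite mulrDr mulrCA in y0; lra.
(* The parameter at which the segment would cross x_1 = 0; there [psi] exceeds [M], contrary to
   [hM]. *)
pose s := sg * x 0 ord0 / - (sg * b.2 0 ord0).
have s0 : 0 <= s by rewrite divr_ge0 // ltW.
have sw : s <= w.
  rewrite ler_pdivrMr // mulrN; rewrite mulrDr mulrCA in y0; lra.
have [|q1 g1] := @ascent_segment b x s ab ox; first by rewrite s0.
have sg0 : sg != 0 by apply/eqP => sg0; rewrite sg0 mul0r oppr0 ltxx in V0.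
have b0 : b.2 0 ord0 != 0 by apply/eqP => b0; rewrite b0 mulr0 oppr0 ltxx in V0.
have z0 : (x + s *: b.2) 0 ord0 = 0.
  by rewrite E /s; field; rewrite sg0 b0.
have := hM _ q1 z0; have : 0 <= kap * (s * `|b.2|) by rewrite mulr_ge0 ?(ltW kap0) // mulr_ge0.
lra.
Qed.

Lemma ascent_pass_side (B : seq (V * R * V)) x sg M : (forall b, b \in B -> ascent b) -> om (tailv x) ->
  (forall z, om (tailv z) -> z 0 ord0 = 0 -> psi z <= M) ->
  M < psi x -> 0 < sg * x 0 ord0 -> 0 < sg * ascent_pass B x 0 ord0.
Proof.
elim: B x => [//|b B IH] x h ox hM Mx x0 /=.
have ab := h b (mem_head _ _); have [q1 g1] := ascent_step_gain ab ox.
apply: IH => //.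
- by move=> a aB; apply: h; rewrite inE aB orbT.
- have : 0 <= kap * `|ascent_step b x - x| by rewrite mulr_ge0 // ltW.
  lra.
exact: ascent_step_side ab ox hM Mx x0.
Qed.

Lemma orbit_monotone x n k : om (tailv x) -> psi (orbit n x) <= psi (orbit (n + k) x).
Proof.
move=> ox; elim: k => [|k IH]; first by rewrite addn0.
rewrite addnS /=; apply: le_trans IH _; have [q1 _] := orbit_gain (n + k) ox.
have [_ g2] := ascent_pass_gain (@L_asc (n + k)%N) q1.
have : 0 <= kap * `|ascent_pass (L (n + k)%N) (orbit (n + k) x) - orbit (n + k) x| by rewrite mulr_ge0 // ltW.
lra.
Qed.

Lemma orbit_side x n k sg M : om (tailv x) ->
  (forall z, om (tailv z) -> z 0 ord0 = 0 -> psi z <= M) ->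
  M < psi (orbit n x) -> 0 < sg * orbit n x 0 ord0 ->
  0 < sg * orbit (n + k) x 0 ord0.
Proof.
move=> ox hM Mx x0; elim: k => [|k IH]; first by rewrite addn0.
rewrite addnS /=; have [q1 _] := orbit_gain (n + k) ox.
apply: (ascent_pass_side (@L_asc _) q1 hM _ IH).
exact: lt_le_trans Mx (orbit_monotone n k ox).
Qed.

(** The end reached is witnessed at one finite time, a condition stable under perturbation of [x].
    By [orbit_side] it persists once met, provided [M] bounds [psi] on the section x_1 = 0. *)
Definition basin M sg x : Prop := exists n, M < psi (orbit n x) /\ 0 < sg * orbit n x 0 ord0.

Lemma basin_cover M x : om (tailv x) ->
  (forall z, om (tailv z) -> z 0 ord0 = 0 -> psi z <= M) -> basin M 1 x \/ basin M (-1) x.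
Proof.
move=> ox hM; have [n hn] := orbit_unbounded M ox; have [q1 _] := orbit_gain n ox.
have [x0|x0|x0] := ltgtP (orbit n x 0 ord0) 0.
- by right; exists n; rewrite mulN1r oppr_gt0.
- by left; exists n; rewrite mul1r.
- by have := hM _ q1 x0; rewrite leNgt hn.
Qed.

Lemma basin_disjoint M x : om (tailv x) ->
  (forall z, om (tailv z) -> z 0 ord0 = 0 -> psi z <= M) -> basin M 1 x -> basin M (-1) x -> False.
Proof.
move=> ox hM [n [n1 n2]] [m [m1 m2]].
have := orbit_side m ox hM n1 n2; have := orbit_side n ox hM m1 m2.
by rewrite addnC mul1r mulN1r; lra.
Qed.

Lemma basin_open M sg x : om (tailv x) -> basin M sg x ->
  exists2 r : R, 0 < r & forall y, `|x - y| < r -> om (tailv y) /\ basin M sg y.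
Proof.
move=> ox [n [n1 n2]]; have [q1 _] := orbit_gain n ox; have [gpsi _ _ _ _] := nv.
have cpsi := gradient_at_continuous (gpsi _ q1).
have [q q0 hq] := iffLR (open_normP _) (open_cylinder om_open) x ox.
have e1 : 0 < psi (orbit n x) - M by rewrite subr_gt0.
have [r1 r10 h1] := iffLR (cvg_ballP _ _ _) cpsi _ e1.
have [r2 r20 h2] : exists2 r2 : R, 0 < r2 & forall y, `|orbit n x - y| < r2 -> 0 < sg * y 0 ord0.
  have sg0 : 0 < `|sg| by rewrite normr_gt0; apply/eqP => sg0; rewrite sg0 mul0r ltxx in n2.
  exists (sg * orbit n x 0 ord0 / `|sg|) => [|y]; first by rewrite divr_gt0.
  rewrite ltr_pdivlMr // => h.
  have : `|orbit n x 0 ord0 - y 0 ord0| * `|sg| < sg * orbit n x 0 ord0.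
    by apply: le_lt_trans h; rewrite ler_wpM2r //; have := coord_le_norm (orbit n x - y) ord0; rewrite !mxE.
  by rewrite mulrC -normrM ltr_norml mulrBr => /andP[_]; lra.
have m0 : 0 < Num.min r1 r2 by rewrite lt_min r10.
have [r r0 hr] := iffLR (cvg_ballP _ _ _) (@orbit_continuous n x) _ m0.
exists (Num.min q r); first by rewrite lt_min q0.
move=> y; rewrite lt_min => /andP[yq yr]; split; first exact: hq.
have := hr y yr; rewrite lt_min => /andP[y1 y2]; exists n; split; last exact: h2.
by have := h1 _ y1; rewrite ltr_norml => /andP[_]; lra.
Qed.

End Orbit.

(* The basins of the two ends of the cylinder are open, disjoint and cover it, so
   one of them is empty. *)
Lemma upper_bound_one_side : connected om -> exists2 M, 0 <= M &
  (forall x, om (tailv x) -> x 0 ord0 <= 0 -> psi x <= M) \/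
  (forall x, om (tailv x) -> 0 <= x 0 ord0 -> psi x <= M).
Proof.
move=> co; have [L [La Lm Lc]] := ascent_cover; have [_ _ _ _ [_ bu]] := nv.
have [B hB] := bu 0; pose M := `|B|.
have hM z : om (tailv z) -> z 0 ord0 = 0 -> psi z <= M.
  move=> oz z0; apply: le_trans (ler_norm _) (le_trans (hB z oz _) (ler_norm _)).
  by rewrite z0 normr0.
exists M; first exact: normr_ge0.
(* The indicator of one basin is locally constant because both basins are open, hence constant on
   the cylinder. *)
pose f x : R := if `[< basin L M 1 x >] then 1 else 0.
have fc x z : om (tailv x) -> om (tailv z) -> f x = f z.
  apply: cylinder_constant => // {}x ox.
  suff [r r0 h] : exists2 r : R, 0 < r & forall y, `|x - y| < r -> f x = f y.
    by apply: gradient_at_near (gradient_at_cst (f x) x); apply/nbhs_normP; exists r.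
  have [b1|b1] := pselect (basin L M 1 x).
    have [r r0 h] := basin_open La ox b1; exists r => // y /h[_ b2].
    by rewrite /f !asboolT.
  have [//|b2] := basin_cover La Lm Lc ox hM.
  have [r r0 h] := basin_open La ox b2; exists r => // y /h[oy b3].
  by rewrite /f !asboolF // => b4; exact: (basin_disjoint La oy hM b4 b3).
have above x sg : om (tailv x) -> M < psi x -> 0 <= sg * x 0 ord0 -> sg != 0 -> basin L M sg x.
  move=> ox Mx; rewrite le_eqVlt => /orP[/eqP/esym/eqP e|h] sg0; last by exists 0%N.
  by move: e; rewrite mulf_eq0 (negPf sg0) /= => /eqP/(hM x ox); rewrite leNgt Mx.
have [[y [oy by1]]|nb] := pselect (exists y : V, om (tailv y) /\ basin L M 1 y).
  left => x ox x0; rewrite leNgt; apply/negP => Mx.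
  have b2 : basin L M (-1) x by apply: above => //; rewrite ?mulN1r ?oppr_ge0 // oppr_eq0 oner_eq0.
  have := fc x y ox oy; rewrite /f (asboolT by1) asboolF; last first.
    by move=> b1; exact: (basin_disjoint La ox hM b1 b2).
  by move/eqP; rewrite eq_sym oner_eq0.
right => x ox x0; rewrite leNgt; apply/negP => Mx; apply: nb; exists x; split => //.
by apply: above; rewrite ?mul1r ?oner_eq0.
Qed.

(* An orbit started far away in a half cylinder where psi is bounded stays there. *)
Lemma unbounded_half sg M : om !=set0 -> sg = 1 \/ sg = -1 ->
  exists2 x : V, om (tailv x) & 0 <= sg * x 0 ord0 /\ M < `|psi x|.
Proof.
move=> [y0 oy0] hsg; apply: contrapT => nx.
have hM x : om (tailv x) -> 0 <= sg * x 0 ord0 -> `|psi x| <= M.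
  by move=> ox x0; rewrite leNgt; apply/negP => h; apply: nx; exists x.
have sgn : `|sg| = 1 by case: hsg => ->; rewrite ?normrN normr1.
have sg2 : sg * sg = 1 by case: hsg => ->; rewrite ?mulrNN mulr1.
have [L [La Lm Lc]] := ascent_cover.
have M0 : 0 <= M.
  by apply: le_trans (normr_ge0 _) (hM (cons_rv 0 y0) _ _); rewrite ?tailv_cons // cons_rv0 mulr0.
(* If [|psi| <= M] on this half, an orbit can gain at most [2 * M], hence move by at most
   [2 * M / kap], and stays at height at least 1. As one step has length at most 1, it cannot leave
   the half before the bound is applied again. *)
pose x0 := cons_rv (sg * (2 * M / kap + 1)) y0 : V.
have T0 : 0 <= 2 * M / kap by rewrite divr_ge0 ?mulr_ge0 // ltW.
have x0E : sg * x0 0 ord0 = 2 * M / kap + 1 by rewrite cons_rv0 mulrA sg2 mul1r.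
have ox0 : om (tailv x0) by rewrite tailv_cons.
pose inv x := [/\ om (tailv x), 1 <= sg * x 0 ord0 & kap * `|x - x0| <= psi x - psi x0].
have inv_step b x : ascent b -> inv x -> inv (ascent_step b x).
  move=> ab [ox x1 gx]; have [q1 g1] := ascent_step_gain ab ox.
  have gy : kap * `|ascent_step b x - x0| <= psi (ascent_step b x) - psi x0.
    have -> : ascent_step b x - x0 = (ascent_step b x - x) + (x - x0) by rewrite addrA subrK.
    have := ler_wpM2l (ltW kap0) (ler_normD (ascent_step b x - x) (x - x0)).
    by rewrite mulrDr; lra.
  split => //.
  have cd (a b' : V) : `|sg * a 0 ord0 - sg * b' 0 ord0| <= `|a - b'|.
    by rewrite -mulrBr normrM sgn mul1r; have := coord_le_norm (a - b') ord0; rewrite !mxE.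
  have st : `|ascent_step b x - x| <= 1.
    have [_ _ V1 _] := ab; have /andP[w0 w1] := ascent_weight01 b x.
    by rewrite /ascent_step addrAC subrr add0r normrZ ger0_norm // mulr_ile1.
  have yside : 0 <= sg * ascent_step b x 0 ord0.
    have := le_trans (cd (ascent_step b x) x) st; rewrite ler_norml => /andP[]; lra.
  have b1 := hM _ q1 yside.
  have b2 : `|psi x0| <= M by apply: hM => //; rewrite x0E; lra.
  have gl : `|ascent_step b x - x0| <= 2 * M / kap.
    rewrite ler_pdivlMr // mulrC; apply: le_trans gy _.
    by move: b1 b2; rewrite !ler_norml => /andP[_ b1] /andP[b2 _]; lra.
  have := le_trans (cd (ascent_step b x) x0) gl; rewrite x0E ler_norml => /andP[]; lra.
have inv_pass B x : (forall b, b \in B -> ascent b) -> inv x -> inv (ascent_pass B x).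
  elim: B x => [//|b B IH] x h ix /=; apply: IH.
    by move=> a aB; apply: h; rewrite inE aB orbT.
  by apply: inv_step => //; apply: h; rewrite mem_head.
have inv_orbit n : inv (orbit L n x0).
  elim: n => [|n IH] /=; last by apply: inv_pass => //; exact: La.
  by split => //; [rewrite x0E; lra|rewrite !subrr normr0 mulr0].
have [n hn] := orbit_unbounded La Lm Lc M ox0.
have [q1 x1 _] := inv_orbit n; have := hM _ q1 (le_trans ler01 x1).
by rewrite ler_norml => /andP[_]; lra.
Qed.

End Ascent.

(** * The pressure *)

Section TestFunctions.
Variables (R : realType) (n : nat).
Local Notation V := 'rV[R]_n.
Implicit Types (U K : set V) (f phi : V -> R) (x y z : V).

Lemma C1_on_of_gradient U f (g : V -> V) : open U ->
  (forall x, U x -> gradient_at f x (g x) /\ {for x, continuous g}) -> C1_on U f.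
Proof.
move=> /open_normP oU h x Ux; have [g1 c1] := h x Ux; split; first by case: g1.
move=> i; have ci := continuous_at_coord (i := i) c1; apply/cvg_ballP => e e0.
have [r r0 hr] := iffLR (cvg_ballP _ _ _) ci e e0; have [q q0 hq] := oU x Ux.
exists (Num.min r q); first by rewrite lt_min r0.
move=> y; rewrite lt_min => /andP[yr yq]; have [g2 _] := h y (hq y yq).
by rewrite (gradient_at_partial i g1) (gradient_at_partial i g2); exact: hr.
Qed.

(** The third power of [pos] is C^2, exactly the regularity that [test_fun] demands. *)
Definition bump x r y : R := pos (r ^+ 2 - dotv (y - x) (y - x)) ^+ 3.

Lemma bump_ge0 x r y : 0 <= bump x r y.
Proof. by rewrite exprn_ge0 // pos_ge0. Qed.

Lemma bump_out x r y : 0 <= r -> r < `|x - y| -> bump x r y = 0.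
Proof.
move=> r0 ry; rewrite /bump pos0 ?expr0n // subr_le0 -enorm_sq.
apply: ler_sqr_nneg => //; apply: le_trans (ltW ry) _.
by rewrite distrC; exact: norm_le_enorm.
Qed.

Lemma bump_center x r : 0 < r -> 0 < bump x r x.
Proof.
by move=> r0; rewrite /bump subrr dotv0l subr0 posE ?exprn_gt0 // exprn_ge0 // ltW.
Qed.

Lemma bump_C2 x r : C2_on setT (bump x r).
Proof.
pose q y := r ^+ 2 - dotv (y - x) (y - x).
have gq y : gradient_at q y (0 - 2 *: (y - x)).
  by apply: gradient_atB; [exact: gradient_at_cst|exact: gradient_at_sqdist].
have cq y : {for y, continuous q} by exact: gradient_at_continuous (gq y).
have cgq : continuous (fun y => 0 - 2 *: (y - x)).
  move=> y; apply: (@continuousB _ _ _ (fun=> 0) (fun y : V => 2 *: (y - x))); first exact: cst_continuous.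
  apply: (@continuous_at_scale _ _ _ (fun=> 2) (fun y : V => y - x)); first exact: cst_continuous.
  apply: (@continuousB _ _ _ (fun y : V => y) (fun=> x)); [exact: cvg_id|exact: cst_continuous].
have cpq y : {for y, continuous (fun y => pos (q y))}.
  by apply: (@continuous_at_compR _ _ q); [exact: cq|exact: pos_continuous].
have g1 y : gradient_at (bump x r) y ((3 * pos (q y) ^+ 2) *: (0 - 2 *: (y - x))).
  exact: (gradient_at_comp (is_derive_pos3 _) (gq y)).
have pE i : partial i (bump x r) = fun y => 3 * pos (q y) ^+ 2 * (-2 * (y 0 i - x 0 i)).
  apply/funext => y; rewrite (gradient_at_partial i (g1 y)) !mxE; ring.
have c1 : continuous (fun y => 3 * pos (q y) ^+ 2).
  move=> y; apply: (@continuousM _ _ (fun=> 3) (fun y => pos (q y) ^+ 2)); first exact: cst_continuous.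
  by apply: (@continuousM _ _ (fun y => pos (q y)) (fun y => pos (q y))); exact: cpq.
have cl i : continuous (fun y : V => -2 * (y 0 i - x 0 i)).
  move=> y; apply: (@continuousM _ _ (fun=> -2) (fun y : V => y 0 i - x 0 i)); first exact: cst_continuous.
  apply: (@continuousB _ _ _ (fun y : V => y 0 i) (fun=> x 0 i)); last exact: cst_continuous.
  by apply: (continuous_at_coord (f := fun y : V => y)); exact: cvg_id.
split.
  apply: (C1_on_of_gradient openT) => y _; split; first exact: g1.
  by apply: (continuous_at_scale (a := fun y => 3 * pos (q y) ^+ 2)); [exact: c1|exact: cgq].
move=> i; rewrite pE.
have g2 y : gradient_at (fun y => 3 * pos (q y) ^+ 2) y (3 *: ((2 * pos (q y)) *: (0 - 2 *: (y - x)))).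
  exact: (gradient_atZ 3 (gradient_at_comp (is_derive_pos2 _) (gq y))).
have g3 y : gradient_at (fun y : V => -2 * (y 0 i - x 0 i)) y (-2 *: (evec R i - 0)).
  by apply: gradient_atZ; apply: gradient_atB; [exact: gradient_at_coord|exact: gradient_at_cst].
apply: (C1_on_of_gradient openT) => y _; split; first exact: (gradient_atM (g2 y) (g3 y)).
apply: (@continuousD _ _ _ (fun y : V => (3 * pos (q y) ^+ 2) *: (-2 *: (evec R i - 0)))
  (fun y : V => (-2 * (y 0 i - x 0 i)) *: (3 *: ((2 * pos (q y)) *: (0 - 2 *: (y - x)))))).
  by apply: (continuous_at_scale (a := fun y => 3 * pos (q y) ^+ 2)); [exact: c1|exact: cst_continuous].
apply: (continuous_at_scale (a := fun y : V => -2 * (y 0 i - x 0 i))); first exact: cl.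
apply: (continuous_at_scale (a := fun=> 3)); first exact: cst_continuous.
apply: (continuous_at_scale (a := fun y => 2 * pos (q y))); last exact: cgq.
by apply: (@continuousM _ _ (fun=> 2) (fun y => pos (q y))); [exact: cst_continuous|exact: cpq].
Qed.

Lemma bump_test U x r : 0 <= r -> (forall y, `|x - y| <= r -> U y) -> test_fun U (bump x r).
Proof.
move=> r0 h; split; first exact: bump_C2.
exists [set y | `|x - y| <= r]; split; first exact: compact_dist_le.
by split => // y /= /negP; rewrite -ltNge; exact: bump_out.
Qed.

Lemma test_fun_eq0 U f x : open U -> (forall y, U y -> {for y, continuous f}) ->
  (forall phi, test_fun U phi -> iint (fun y => f y * phi y) = 0) -> U x -> f x = 0.
Proof.
move=> oU; have nonpos (g : V -> R) y : (forall y, U y -> {for y, continuous g}) ->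
    (forall phi, test_fun U phi -> iint (fun y => g y * phi y) = 0) -> U y -> g y <= 0.
  move=> cg hg Uy; rewrite leNgt; apply/negP => gy.
  have [r r0 hr] := iffLR (open_normP _) oU y Uy.
  have [q q0 hq] := iffLR (cvg_ballP _ _ _) (cg y Uy) _ gy.
  pose m := Num.min r q / 2; have m0 : 0 < m by rewrite divr_gt0 // lt_min r0.
  have near z : `|y - z| <= m -> `|y - z| < r /\ `|y - z| < q.
    have m1 : 0 < Num.min r q by rewrite lt_min r0.
    have : m < Num.min r q by rewrite /m; lra.
    by move=> h1 h2; have := le_lt_trans h2 h1; rewrite lt_min => /andP.
  have mU z : `|y - z| <= m -> U z by move=> /near[h _]; exact: hr.
  have gpos z : `|y - z| <= m -> 0 < g z.
    by move=> /near[_ /hq]; rewrite ltr_norml => /andP[_]; lra.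
  have tb := bump_test (ltW m0) mU; have := hg _ tb.
  have [[cb _] _] := tb.
  have out z : ~ `|y - z| <= m -> bump y m z = 0.
    by move=> /negP; rewrite -ltNge => h; apply: bump_out => //; exact: ltW.
  have cs : compactly_supported (fun z => g z * bump y m z).
    apply: (compactly_supported_ext0 (@compact_dist_le R n y m) mU) => z.
      by move=> /out ->; rewrite mulr0.
    move=> Uz; apply: (@continuousM _ _ g (bump y m)); first exact: cg.
    by have [df _] := cb z I; exact: differentiable_continuous.
  have : 0 < iint (fun z => g z * bump y m z).
    apply: (iint_gt0 (x := y)) => //; last by rewrite mulr_gt0 // bump_center.
    move=> z; have [h|/out ->] := pselect (`|y - z| <= m); last by rewrite mulr0.
    by rewrite mulr_ge0 ?bump_ge0 // ltW // gpos.
  by move=> h1 h2; rewrite h2 ltxx in h1.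
move=> cf hf Ux; apply/le_anti; rewrite nonpos //=.
rewrite -oppr_le0; apply: (nonpos (fun y => - f y)) => // [y Uy|phi tphi].
  by apply: (@continuousN _ _ _ f); exact: cf.
have E : (fun y => - f y * phi y) = fun y => - (f y * phi y) by apply/funext => y; rewrite mulNr.
have [[cb _] [K [cK [KU p0]]]] := tphi.
rewrite E iintN ?hf ?oppr0 //.
apply: (compactly_supported_ext0 cK KU) => y; first by move=> /p0 ->; rewrite mulr0.
move=> Uy; apply: (@continuousM _ _ f phi); first exact: cf.
by have [df _] := cb y I; exact: differentiable_continuous.
Qed.

(** Once [v] is constant, this removes the viscous term from the weak equation. *)
Lemma iint_laplacian K phi : C2_on setT phi -> compact K -> (forall x, ~ K x -> phi x = 0) ->
  [/\ compactly_supported (laplacian phi), iint (laplacian phi) = 0 &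
      forall x, ~ K x -> laplacian phi x = 0].
Proof.
move=> [c1 c2] cK p0; have [clK _] := iffLR (compact_normP _) cK.
have d0 i x : ~ K x -> partial i phi x = 0.
  by move=> nK; rewrite (gradient_at_partial i (gradient_at_ext0 clK p0 nK)) mxE.
have dd0 i x : ~ K x -> partial i (partial i phi) x = 0.
  by move=> nK; rewrite (gradient_at_partial i (gradient_at_ext0 clK (d0 i) nK)) mxE.
have cs1 i : compactly_supported (partial i phi).
  by apply: (compactly_supported_ext0 cK (@subsetT _ K) (d0 i)) => x _; have [_] := c1 x I; apply.
have cs2 i : compactly_supported (partial i (partial i phi)).
  by apply: (compactly_supported_ext0 cK (@subsetT _ K) (dd0 i)) => x _; have [_] := c2 i x I; apply.
have i0 i : iint (partial i (partial i phi)) = 0.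
  apply: (iint_directional_derivative (e := evec R i) (cs1 i) (cs2 i)) => x.
  exists (grad (partial i phi) x); first exact: C1_on_gradient (c2 i) I.
  by rewrite dotv_evecr mxE.
have [s1 s2] := iint_sum cs2; split => //.
  by rewrite /laplacian s2 big1.
by move=> x nK; rewrite /laplacian big1 // => i _; exact: dd0.
Qed.

End TestFunctions.

(** * From the slip condition and the equations to the conclusion *)

Section Main.
Variables (R : realType) (d : nat).
Local Notation V := 'rV[R]_d.+1.
Local Notation V' := 'rV[R]_d.
Variable (om : set V').
Hypothesis om_cpt : compact (closure om).
Hypothesis om_C1 : C1_open om.

Lemma potential_flow_axial (psi : V -> R) (v : V -> V) (c : R) : connected om ->
  neumann om psi v -> 0 < c -> (forall x : V, closure om (tailv x) -> c <= enorm (v x)) ->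
  exists a : R, forall x : V, om (tailv x) -> v x = cons_rv a 0.
Proof.
move=> co nv c0 hc.
have [om0|no] := pselect (om !=set0); last first.
  by exists 0 => x ox; exfalso; apply: no; exists (tailv x).
have nv' := neumannZ (-1) nv.
have hc' (x : V) : closure om (tailv x) -> c <= enorm (-1 *: v x).
  by move=> /hc; rewrite /enorm dotvZl dotvZr mulN1r mulN1r opprK.
have [M1 M10 H1] := upper_bound_one_side om_cpt om_C1 nv c0 hc co.
have [M2 M20 H2] := upper_bound_one_side om_cpt om_C1 nv' c0 hc' co.
have M12 : 0 <= M1 + M2 by rewrite addr_ge0.
(* The first and last cases bound [psi] on both sides in the same half, against [unbounded_half];
   the middle ones are the two orientations of the Liouville theorem. *)
case: H1 => H1; case: H2 => H2.
- have [x ox [x0 Mx]] := unbounded_half om_cpt om_C1 nv c0 hc (sg := -1) (M1 + M2) om0 (or_intror erefl).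
  have x0' : x 0 ord0 <= 0 by rewrite mulN1r oppr_ge0 in x0.
  by exfalso; have := H1 x ox x0'; have := H2 x ox x0'; move: Mx; rewrite mulN1r lter_normr => /orP[]; lra.
- apply: (liouville om_cpt om_C1 nv co M12) => x ox x0.
    by have := H2 x ox x0; rewrite mulN1r; lra.
  by have := H1 x ox x0; lra.
- have [||a ha] := liouville om_cpt om_C1 nv' co M12.
  + by move=> x ox x0; have := H1 x ox x0; rewrite mulN1r; lra.
  + by move=> x ox x0; have := H2 x ox x0; lra.
  exists (- a) => x /ha h; have -> : v x = - (-1 *: v x) by rewrite scaleN1r opprK.
  by rewrite h -scaleN1r cons_rvZ mulN1r scaler0.
- have [x ox [x0 Mx]] := unbounded_half om_cpt om_C1 nv c0 hc (sg := 1) (M1 + M2) om0 (or_introl erefl).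
  have x0' : 0 <= x 0 ord0 by rewrite mul1r in x0.
  by exfalso; have := H1 x ox x0'; have := H2 x ox x0'; move: Mx; rewrite mulN1r lter_normr => /orP[]; lra.
Qed.

(** A defining function of the cross-section composed with [tailv] defines the cylinder, and its
    normalized gradient is an outward normal; the nonzero normalization then cancels. *)
Lemma slip_tangential (v : V -> V) :
  (forall (x nu : V), (closure (cylinder (N := d.+1) om) `\` cylinder (N := d.+1) om) x ->
     outward_normal (cylinder (N := d.+1) om) x nu -> dotv (v x) nu = 0) -> tangential om v.
Proof.
move=> slip x r rho [cx nx] [r0 [C1 [g0 hom]]].
pose rho' (y : V) := rho (tailv y).
have sub (y : V) : ball x r y -> ball (tailv x) r (tailv y).
  by move=> /ball_normP h; apply/ball_normP; rewrite -tailvB; exact: le_lt_trans (tailv_norm _) h.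
have gr (y : V) : ball x r y -> gradient_at rho' y (cons_rv 0 (grad rho (tailv y))).
  by move=> /sub yr; apply: gradient_at_tailv; exact: C1_on_gradient C1 yr.
have gx : grad rho' x = cons_rv 0 (grad rho (tailv x)).
  by apply: gradient_atE; apply: gr; exact: ballxx.
have gn0 : grad rho' x != 0.
  by rewrite gx; apply: contra g0 => /eqP h; rewrite -(tailv_cons 0 (grad rho (tailv x))) h; apply/eqP/rowP => j; rewrite !mxE.
have ld : local_defining (cylinder (N := d.+1) om) x r rho'.
  split => //; split; last by split => // y /sub yr; exact: hom.
  apply: (C1_on_of_gradient (g := fun y : V => cons_rv 0 (grad rho (tailv y)))); first exact: ball_open.
  move=> y yr; split; first exact: gr.
  apply: (@continuous_at_cons0 _ _ _ (fun y : V => grad rho (tailv y))).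
  by apply: continuous_at_tailv; exact: C1_on_grad_continuous C1 (sub y yr).
have xb : (closure (cylinder (N := d.+1) om) `\` cylinder (N := d.+1) om) x.
  by split => //; apply/closure_cylinder.
have := slip x _ xb (ex_intro _ r (ex_intro _ rho' (conj ld erefl))).
have e0 : 0 < enorm (grad rho' x).
  rewrite lt_neqAle enorm_ge0 andbT eq_sym; apply: contra gn0 => /eqP h.
  by rewrite -dotv_eq0 -enorm_sq h expr0n.
by rewrite dotvZr => /eqP; rewrite mulf_eq0 invr_eq0 gt_eqF //= gx dotv_cons_tailv => /eqP.
Qed.

Lemma within_box_bounded_scalar (f : V -> R) :
  (forall x : V, om (tailv x) -> {for x, continuous f}) ->
  {within closure (cylinder (N := d.+1) om), continuous f} -> box_bounded om f.
Proof.
move=> cf wf; split => // A.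
have wA : {within box (closure om) A, continuous f}.
  by apply: continuous_subspaceW wf => x [_ h]; apply/closure_cylinder.
have [B B0 hB] := compact_fun_bounded (compact_box (A := A) om_cpt) wA.
by exists B => x ox xA; apply: hB; split => //; exact: subset_closure.
Qed.

Lemma euler_pressure_gradient (v : V -> V) (p : V -> R) (a x : V) :
  (forall y : V, om (tailv y) -> v y = a) -> om (tailv x) -> convect v x + grad p x = 0 -> grad p x = 0.
Proof.
move=> va ox; have -> : convect v x = 0; last by rewrite add0r.
have [oo _] := om_C1; have [r r0 h] := iffLR (open_normP _) (open_cylinder oo) x ox.
apply/rowP => i; rewrite !mxE big1 // => j _.
rewrite (gradient_at_partial j (_ : gradient_at _ x 0)) ?mxE ?mulr0 //.
apply: gradient_at_near (gradient_at_cst (a 0 i) x); apply/nbhs_normP.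
by exists r => // y /h /va ->.
Qed.

(** For constant [v] the convective term vanishes and the viscous one integrates to zero, so each
    partial derivative of [p] is orthogonal to all test functions. *)
Lemma navier_stokes_pressure_gradient (v : V -> V) (p : V -> R) (a x : V) (mu : R) :
  C1_on (cylinder (N := d.+1) om) p ->
  (forall y : V, om (tailv y) -> v y = a) ->
  (forall (i : 'I_d.+1) (phi : V -> R), test_fun (cylinder (N := d.+1) om) phi ->
     iint (fun x => mu * v x 0 i * laplacian phi x + (convect v x 0 i + partial i p x) * phi x) = 0) ->
  om (tailv x) -> grad p x = 0.
Proof.
move=> C1p va H ox; have [oo _] := om_C1; have oc := open_cylinder oo.
apply/rowP => i; rewrite !mxE.
apply: (test_fun_eq0 (U := cylinder (N := d.+1) om) oc) => // [y oy|phi tphi].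
  by have [_ h] := C1p y oy; exact: h.
have [C2phi [K [cK [KU p0]]]] := tphi.
have [lc li l0] := iint_laplacian C2phi cK p0.
have cs : compactly_supported (fun y => partial i p y * phi y).
  apply: (compactly_supported_ext0 cK KU) => y; first by move=> /p0 ->; rewrite mulr0.
  move=> oy; apply: (@continuousM _ _ (partial i p) phi).
    by have [_ h] := C1p y oy; exact: h.
  by have [df _] := (C2phi.1 y I); exact: differentiable_continuous.
have := H i phi tphi.
have -> : (fun x => mu * v x 0 i * laplacian phi x + (convect v x 0 i + partial i p x) * phi x) =
    fun x => mu * a 0 i * laplacian phi x + partial i p x * phi x.
  apply/funext => y; have [oy|ny] := pselect (om (tailv y)); last first.
    have nK : ~ K y by move=> /KU.
    by rewrite l0 // p0 // !mulr0.
  rewrite va //; have [r r0 h] := iffLR (open_normP _) oc y oy.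
  have -> : convect v y 0 i = 0; last by rewrite add0r.
  rewrite mxE big1 // => j _.
  rewrite (gradient_at_partial j (_ : gradient_at _ y 0)) ?mxE ?mulr0 //.
  apply: gradient_at_near (gradient_at_cst (a 0 i) y); apply/nbhs_normP.
  by exists r => // z /h /va ->.
by rewrite iintD ?iintZ ?li ?mulr0 ?add0r //; exact: compactly_supportedZ.
Qed.

End Main.

Unset Implicit Arguments.

Theorem theorem1p1 (R : realType) (N : nat) (om : set 'rV[R]_N.-1)
    (v : 'rV[R]_N -> 'rV[R]_N) (p psi : 'rV[R]_N -> R) :
  (2 <= N)%N ->
  bounded_set om -> connected om -> C1_open om ->
  (* p in C^1(Omega), v in C^1(Omega) /\ C(closure Omega) *)
  C1_on (cylinder om) p ->
  (forall i, C1_on (cylinder om) (fun x => v x 0 i)) ->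
  {within closure (cylinder om), continuous v} ->
  (* steady Euler, or steady Navier-Stokes in the weak (distributional) sense *)
  ((forall x, cylinder om x -> convect v x + grad p x = 0 /\ divv v x = 0)
   \/ (exists mu : R, 0 < mu /\ (forall x, cylinder om x -> divv v x = 0) /\
        forall (i : 'I_N) (phi : 'rV[R]_N -> R), test_fun (cylinder om) phi ->
          iint (fun x => mu * v x 0 i * laplacian phi x
                         + (convect v x 0 i + partial i p x) * phi x) = 0)) ->
  (* slip boundary condition v . n = 0 on the boundary of Omega *)
  (forall x nu, (closure (cylinder om) `\` cylinder om) x ->
     outward_normal (cylinder om) x nu -> dotv (v x) nu = 0) ->
  (* potential flow: psi in C^2(Omega) /\ C^1(closure Omega), v = grad psi *)
  C2_on (cylinder om) psi -> {within closure (cylinder om), continuous psi} ->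
  (forall x, cylinder om x -> grad psi x = v x) ->
  (* away from stagnation *)
  (exists c : R, 0 < c /\ forall x, closure (cylinder om) x -> c <= enorm (v x)) ->
  exists a : R, a != 0 /\
    (forall x, closure (cylinder om) x -> v x = \row_i (if val i == 0%N then a else 0)) /\
    (exists c : R, forall x, cylinder om x -> p x = c).
Proof.
case: N om v p psi => [|[|n]] om v p psi // _ bom co om_C1 C1p C1v cv eqn slip [C1psi _] cpsi gpsi [c [c0 hc]].
have om_cpt : compact (closure om).
  apply/compact_normP; split; first exact: closed_closure.
  (* The first 1 makes the bound strictly larger than [A], as [bounded_set] requires; the second is
     the distance from a point of the closure to the set. *)
  have [A [_ hA]] := bom; exists (A + 1 + 1) => x /closure_normP/(_ 1 ltr01)[y [oy xy]].
  have := hA (A + 1) _ y oy; rewrite ltrDl ltr01 => /(_ isT) yA.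
  by move: yA (lerB_dist x y) => /=; lra.
have [oo _] := om_C1.
have dv x : cylinder om x -> divv v x = 0.
  by move=> ox; case: eqn => [/(_ x ox)[]|[mu [_ [h _]]]] //; exact: h.
have g1 (x : 'rV[R]_n.+2) : om (tailv x) -> gradient_at psi x (v x).
  by move=> ox; rewrite -gpsi //; exact: C1_on_gradient C1psi ox.
have nv : neumann om psi v.
  split => //; first exact: divergence_freeP.
    exact: slip_tangential.
  by apply: within_box_bounded_scalar => // x /g1; exact: gradient_at_continuous.
have hc' (x : 'rV[R]_n.+2) : closure om (tailv x) -> c <= enorm (v x).
  by move=> cx; apply: hc; apply/closure_cylinder.
have rowE (a : R) : \row_i (if val i == 0%N then a else 0) = cons_rv a 0 :> 'rV[R]_n.+2.
  apply/rowP => j; rewrite mxE; case: (fintype.unliftP ord0 j) => [k|] ->.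
    by rewrite cons_rvS mxE.
  by rewrite cons_rv0.
(* The empty set is connected and satisfies all the hypotheses; the claims are then vacuous and any
   nonzero [a] serves. *)
have [om0|no] := pselect (om !=set0); last first.
  exists 1; split; first exact: oner_neq0.
  split; last by exists 0 => x ox; exfalso; apply: no; exists (tailv x).
  move=> x /closure_cylinder/closure_normP/(_ 1 ltr01)[y [oy _]].
  by exfalso; apply: no; exists y.
have [a ha] := potential_flow_axial om_cpt om_C1 co nv c0 hc'.
have gp (x : 'rV[R]_n.+2) : om (tailv x) -> grad p x = 0.
  move=> ox; case: eqn => [/(_ x ox)[h _]|[mu [_ [_ h]]]].
    exact: (euler_pressure_gradient om_C1 ha ox h).
  exact: (navier_stokes_pressure_gradient om_C1 C1p ha h ox).
have [y0 oy0] := om0.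
exists a; split.
  apply/eqP => a0; have := hc' (cons_rv 0 y0); rewrite tailv_cons ha ?tailv_cons // a0 cons_rv00.
  rewrite /enorm dotv0l sqrtr0 => /(_ (subset_closure oy0)); lra.
split => [x cx|].
  rewrite rowE; apply/eqP; rewrite -subr_eq0 -normr_le0; apply/ler_addgt0Pr => e e0.
  have [r r0 h] := iffLR (within_normP _ _) cv x cx e e0.
  have [y [oy xy]] := iffLR (closure_normP _ _) cx r r0.
  by have := h y (subset_closure oy) xy; rewrite (ha y oy) add0r => /ltW.
exists (p (cons_rv 0 y0)) => x ox.
apply: (cylinder_constant oo co _ ox); last by rewrite tailv_cons.
by move=> y oy; rewrite -(gp y oy); exact: C1_on_gradient C1p oy.
Qed.
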